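(* Let $0<d<\pi/2$, $\mathscr{D}_d=\{\zeta\in\mathbb{C}:|\Im\zeta|<d\}$, and let $i\in\{2,3\}$, with $\psi_2(t)=e^t$, $\psi_3(t)=\operatorname{arcsinh}(e^t)$, $E_2(z;\alpha,\beta)=z^{\alpha-1}(1+z^2)^{-(\alpha+\beta)/2}$, $E_3(z;\alpha,\beta)=\left(\frac{z}{1+z}\right)^{\alpha-1}e^{-\beta z}$. Assume $f$ is analytic on $\psi_i(\mathscr{D}_d)$ and there are constants $K,\alpha,\beta>0$ with $|f(z)|\le K|E_i(z;\alpha,\beta)|$ for all $z\in\psi_i(\mathscr{D}_d)$. Let $\mu=\min\{\alpha,\beta\}$, let $n$ be a positive integer, $h=\sqrt{\pi d/(\mu n)}$, and let $M=n$, $N=\lceil\alpha n/\beta\rceil$ if $\mu=\alpha$, and $N=n$, $M=\lceil\beta n/\alpha\rceil$ if $\mu=\beta$. Then \[ \sup_{\tau\in(0,\infty)}\left|\int_0^{\tau}f(t)\,dt-\sum_{k=-M}^{N}f(\psi_i(kh))\psi_i'(kh)J(k,h)(\psi_i^{-1}(\tau))\right|\le C_ie^{-\sqrt{\pi d\mu n}}, \] where \[ C_2=\frac{2K}{\mu}\left\{\frac{1}{(1-e^{-2\sqrt{\pi d\mu}})(\cos d)^{(\alpha+\beta)/2}}\sqrt{\frac{\pi}{d\mu}}+1.1\right\},\] \[ C_3=\frac{2K}{\mu}\left\{\frac{2^{1+\beta/2}c_{\alpha,d}}{(1-e^{-2\sqrt{\pi d\mu}})(\cos d)^{(\alpha+\beta)/2}}\sqrt{\frac{\pi}{d\mu}}+1.1\cdot2^{(1-\alpha+|1-\alpha|)/2}\right\},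 \] and $c_{\alpha,d}=\{2(1+1/\cos d)\}^{(1-\alpha)/2}$ if $0<\alpha<1$, $c_{\alpha,d}=2^{(\alpha-1)/2}$ if $\alpha\ge1$.
   Context: $J(k,h)(x)=h\left\{\frac12+\frac1\pi\operatorname{Si}[\pi(x/h-k)]\right\}$ with $\operatorname{Si}(x)=\int_0^x\frac{\sin\sigma}{\sigma}d\sigma$. $\psi_i^{-1}$ is the inverse of $\psi_i$ on the reals. Complex powers use principal branches. *)

(* Defs.v *)
From Stdlib Require Import Reals ZArith List.
From Coquelicot Require Import Coquelicot.
Open Scope R_scope.

Definition Cexp (z : C) : C :=
  (exp (Re z) * cos (Im z), exp (Re z) * sin (Im z)).

(* principal argument, with values in (-PI, PI] *)
Definition Carg (z : C) : R :=
  let x := Re z in let y := Im z in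
  if Rlt_dec 0 x then atan (y / x)
  else if Rlt_dec x 0 then
         (if Rle_dec 0 y then atan (y / x) + PI else atan (y / x) - PI)
  else
    if Rlt_dec 0 y then PI / 2
    else if Rlt_dec y 0 then - (PI / 2) else 0.

(* principal logarithm (only meaningful for z <> 0) *)
Definition Clog (z : C) : C := (ln (Cmod z), Carg z).

Definition Cpow (z w : C) : C :=
  if Req_EM_T (Cmod z) 0 then 0%C else Cexp (Cmult w (Clog z)).

Definition Casinh (w : C) : C :=
  Clog (Cplus w (Cpow (Cplus (Cmult w w) 1%C) (RtoC (1/2)))).

Definition psiC (i : nat) (z : C) : C :=
  match i with
  | 2%nat => Cexp z
  | _ => Casinh (Cexp z)
  end.

Definition psiR (i : nat) (t : R) : R :=
  match i with
  | 2%nat => exp t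
  | _ => arcsinh (exp t)
  end.

Definition psiR_inv (i : nat) (tau : R) : R :=
  match i with
  | 2%nat => ln tau
  | _ => ln (sinh tau)
  end.

Definition strip (d : R) (z : C) : Prop := Rabs (Im z) < d.

Definition psi_domain (i : nat) (d : R) (z : C) : Prop :=
  exists zeta : C, strip d zeta /\ z = psiC i zeta.

Definition E_fun (i : nat) (alpha beta : R) (z : C) : C :=
  match i with
  | 2%nat => Cmult (Cpow z (RtoC (alpha - 1)))
                   (Cpow (Cplus 1%C (Cmult z z)) (RtoC (- ((alpha + beta) / 2))))
  | _ => Cmult (Cpow (Cdiv z (Cplus 1%C z)) (RtoC (alpha - 1)))
               (Cexp (Cmult (RtoC (- beta)) z))
  end.

Definition sinc (s : R) : R := if Req_EM_T s 0 then 1 else sin s / s.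

Definition Si (x : R) : R := RInt sinc 0 x.

Definition Jfun (k : Z) (h x : R) : R :=
  h * (1 / 2 + (1 / PI) * Si (PI * (x / h - IZR k))).

Definition Rceil (x : R) : Z := (- Int_part (- x))%Z.

(* sum_{k=a}^{b} g k over integers (empty if b < a) *)
Definition sumZ (a b : Z) (g : Z -> C) : C :=
  fold_right Cplus 0%C
    (map (fun j : nat => g (a + Z.of_nat j)%Z) (seq 0 (Z.to_nat (b - a + 1)))).

Definition analytic_on (S : C -> Prop) (f : C -> C) : Prop :=
  forall z, S z -> ex_derive (K := C_AbsRing) (V := C_NormedModule) f z.

Definition c_alpha_d (alpha d : R) : R :=
  if Rlt_dec alpha 1 then Rpower (2 * (1 + 1 / cos d)) ((1 - alpha) / 2)
  else Rpower 2 ((alpha - 1) / 2).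

Definition const_C (i : nat) (K alpha beta d : R) : R :=
  let mu := Rmin alpha beta in
  let den := (1 - exp (- (2 * sqrt (PI * d * mu)))) * Rpower (cos d) ((alpha + beta) / 2) in
  match i with
  | 2%nat => 2 * K / mu * (1 / den * sqrt (PI / (d * mu)) + 11 / 10)
  | _ => 2 * K / mu *
         (Rpower 2 (1 + beta / 2) * c_alpha_d alpha d / den * sqrt (PI / (d * mu))
          + 11 / 10 * Rpower 2 ((1 - alpha + Rabs (1 - alpha)) / 2))
  end.

(* Main.v *)
(** The change of variables [t = psi s] turns the problem into sinc interpolation of
    [F = (f o psi) psi'] on the strip [|Im z| < d], integrated term by term. For fixed [t] the
    residue theorem on a rectangle [[-L, L] x [-del, del]] gives
    [F t - sum_k F (k h) sinc (PI (t / h - k))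
       = sin (PI t / h) / (2 PI i) * oint F z / ((z - t) sin (PI z / h)) dz].
    Integrating over [t] from [a = - (m + 1/2) h], where [cos (PI a / h) = 0], an integration by parts
    bounds [int_a^x sin (PI t / h) / (z - t) dt] by [(h / PI) (1 + PI) / |Im z|], which after Fubini
    controls the horizontal sides; since [(1 + 1/PI) (2/PI) < 1] this leaves room for the stated
    constant. The vertical sides vanish as [m] grows, and then [del] tends to [d]. The truncated
    terms are geometric tails weighted by [|J| <= 1.1 h], which comes from [Si PI <= 0.6 PI].

    Analyticity is only complex differentiability, so Cauchy's theorem is proved by Goursat's
    bisection. For [psi = asinh o exp] the growth of [F] follows by writing [exp zeta = sinh z] and
    comparing [|z / (1 + z)|] with [|tanh z|]. *)

Require Import Defs.
From Stdlib Require Import Reals ZArith List.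
From Stdlib Require Import Lra Lia Psatz FinFun.
From Coquelicot Require Import Coquelicot.
Open Scope R_scope.

(* Retypes an equation stated in a Coquelicot structure over [R] for [ring] and [field]. *)
Ltac toR := lazymatch goal with |- @eq _ ?a ?b => change (@eq R a b) end.

(** The integration over $t$ ought to start at $-\infty$, where every $J(k,h)$ vanishes. Starting at
    a finite [a] leaves the terms $F(kh)J(k,h)(a)$, and $J$ decays only like the inverse distance to
    its node; their sum is still $O(1/m)$ because $F$ decays exponentially. For the vertical sides
    to recede from $[a,x]$, the rectangle must grow faster than the interval: it carries the nodes
    up to $2m+1$ while [a] is $-(m+1/2)h$.

    Two bounds on $F$ are carried along, one on the strip and one on the real line. The first enters
    through the horizontal sides, the second through the truncated terms, which is why the two
    summands of $C_3$ have different factors. Both maps lead to the same weight $e^{\alpha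
    x}|1+w^2|^{-(\alpha+\beta)/2}$ with $w=e^{\zeta}$, $x=\Re\zeta$; only the constant in front
    differs.

    The step $h$ solves $\pi d/h=\mu nh$, so that discretization and truncation have the same
    exponent. The prefactor $2/\mu$ bounds $1/\alpha+1/\beta$, and $n\ge1$ turns $1-e^{-2\pi d/h}$
    into the denominator of the statement. *)

Definition ccont {U : UniformSpace} (f : U -> C) (x : U) : Prop :=
  @continuous U C_UniformSpace f x.

Notation ccontC := (ccont (U := C_UniformSpace)).

Lemma ccont_re {U : UniformSpace} (f : U -> C) x :
  ccont f x -> continuous (fun t => Re (f t)) x.
Proof.
  intros H. apply (continuous_comp f (fun z : C_UniformSpace => fst z) x H).
  destruct (f x) as [u v]. apply (@continuous_fst R_UniformSpace R_UniformSpace).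
Qed.

Lemma ccont_im {U : UniformSpace} (f : U -> C) x :
  ccont f x -> continuous (fun t => Im (f t)) x.
Proof.
  intros H. apply (continuous_comp f (fun z : C_UniformSpace => snd z) x H).
  destruct (f x) as [u v]. apply (@continuous_snd R_UniformSpace R_UniformSpace).
Qed.

Lemma ccont_pair {U : UniformSpace} (f g : U -> R) x :
  continuous f x -> continuous g x -> ccont (fun t => (f t, g t)) x.
Proof.
  intros Hf Hg. apply filterlim_locally. intros eps.
  assert (Hf' := proj1 (filterlim_locally f _) Hf eps).
  assert (Hg' := proj1 (filterlim_locally g _) Hg eps).
  generalize (filter_and _ _ Hf' Hg'). apply filter_imp.
  intros y [H1 H2]. split; assumption.
Qed.

Lemma ccont_const {U : UniformSpace} (c : C) (x : U) : ccont (fun _ => c) x.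
Proof. apply continuous_const. Qed.

Lemma ccont_ext {U : UniformSpace} (f g : U -> C) x :
  (forall t, f t = g t) -> ccont f x -> ccont g x.
Proof. intros E. apply continuous_ext. exact E. Qed.

Lemma ccont_plus {U : UniformSpace} (f g : U -> C) x :
  ccont f x -> ccont g x -> ccont (fun t => (f t + g t)%C) x.
Proof.
  intros Hf Hg.
  apply (ccont_pair (fun t => Re (f t) + Re (g t)) (fun t => Im (f t) + Im (g t)));
    apply (continuous_plus (K := R_AbsRing) (V := R_NormedModule)); auto using ccont_re, ccont_im.
Qed.

Lemma ccont_opp {U : UniformSpace} (f : U -> C) x :
  ccont f x -> ccont (fun t => (- f t)%C) x.
Proof.
  intros Hf.
  apply (ccont_pair (fun t => - Re (f t)) (fun t => - Im (f t)));
    apply (continuous_opp (K := R_AbsRing) (V := R_NormedModule)); auto using ccont_re, ccont_im.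
Qed.

Lemma ccont_minus {U : UniformSpace} (f g : U -> C) x :
  ccont f x -> ccont g x -> ccont (fun t => (f t - g t)%C) x.
Proof. intros Hf Hg. apply ccont_plus; [|apply ccont_opp]; assumption. Qed.

Lemma ccont_mult {U : UniformSpace} (f g : U -> C) x :
  ccont f x -> ccont g x -> ccont (fun t => (f t * g t)%C) x.
Proof.
  intros Hf Hg.
  apply (ccont_pair (fun t => Re (f t) * Re (g t) - Im (f t) * Im (g t))
     (fun t => Re (f t) * Im (g t) + Im (f t) * Re (g t))).
  - apply (continuous_minus (K := R_AbsRing) (V := R_NormedModule));
      apply (continuous_mult (K := R_AbsRing)); auto using ccont_re, ccont_im.
  - apply (continuous_plus (K := R_AbsRing) (V := R_NormedModule));
      apply (continuous_mult (K := R_AbsRing)); auto using ccont_re, ccont_im.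
Qed.

Lemma Csqnorm_pos (z : C) : z <> (RtoC 0) -> 0 < Re z ^ 2 + Im z ^ 2.
Proof.
  intros H. rewrite <- Cmod2_alt. apply pow_lt, Cmod_gt_0, H.
Qed.

Lemma ccont_inv {U : UniformSpace} (f : U -> C) x :
  ccont f x -> f x <> (RtoC 0) -> ccont (fun t => (/ f t)%C) x.
Proof.
  intros Hf Hz.
  assert (Hi : continuous (fun t => / (Re (f t) ^ 2 + Im (f t) ^ 2)) x).
  { apply (continuous_comp (fun t => Re (f t) ^ 2 + Im (f t) ^ 2) Rinv).
    - apply (continuous_plus (K := R_AbsRing) (V := R_NormedModule)).
      + apply continuous_ext with (f := fun t => Re (f t) * Re (f t)).
        { intros t; simpl; ring. }
        apply (continuous_mult (K := R_AbsRing)); auto using ccont_re.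
      + apply continuous_ext with (f := fun t => Im (f t) * Im (f t)).
        { intros t; simpl; ring. }
        apply (continuous_mult (K := R_AbsRing)); auto using ccont_im.
    - apply continuous_Rinv. apply Rgt_not_eq, Csqnorm_pos, Hz. }
  apply (ccont_pair (fun t => Re (f t) / (Re (f t) ^ 2 + Im (f t) ^ 2))
                    (fun t => - Im (f t) / (Re (f t) ^ 2 + Im (f t) ^ 2)));
    apply (continuous_mult (K := R_AbsRing)); auto using ccont_re.
  apply (continuous_opp (K := R_AbsRing) (V := R_NormedModule)); auto using ccont_im.
Qed.

Lemma ccont_div {U : UniformSpace} (f g : U -> C) x :
  ccont f x -> ccont g x -> g x <> (RtoC 0) -> ccont (fun t => (f t / g t)%C) x.
Proof. intros. apply ccont_mult; [|apply ccont_inv]; assumption. Qed.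

Lemma ccont_comp {U : UniformSpace} (f : U -> C) (g : C -> C) x :
  ccont f x -> ccontC g (f x) -> ccont (fun t => g (f t)) x.
Proof. intros Hf Hg. apply (continuous_comp f g x Hf Hg). Qed.

Lemma Cmod_le_abs (z : C) : Cmod z <= Rabs (Re z) + Rabs (Im z).
Proof.
  destruct z as [u v]. simpl.
  replace (u, v) with (RtoC u + Ci * RtoC v)%C.
  - eapply Rle_trans; [apply Cmod_triangle|].
    rewrite Cmod_mult, Cmod_Ci, !Cmod_R. lra.
  - unfold Cplus, Cmult, Ci, RtoC; simpl. f_equal; ring.
Qed.

Lemma im_le_Cmod (z : C) : Rabs (Im z) <= Cmod z.
Proof.
  eapply Rle_trans; [|apply Rmax_Cmod]. apply Rmax_r.
Qed.

(** Balls of the uniformity on [C] are squares in the two coordinates. Passing between squares and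
    discs costs a factor two, hence the halved radii; epsilon arguments can then be run with
    [Cmod]. *)
Lemma ccont_eps (g : C -> C) (z : C) :
  ccontC g z <->
  forall eps, 0 < eps -> exists del, 0 < del /\
    forall w, Cmod (w - z) < del -> Cmod (g w - g z) < eps.
Proof.
  split.
  - intros H eps He.
    assert (He2 : 0 < eps / 2) by lra.
    destruct (proj1 (filterlim_locally g _) H (mkposreal _ He2)) as [[del Hd] Hw].
    exists del. split; [exact Hd|]. intros w Hz.
    destruct (Hw w) as [H1 H2].
    { split; simpl; apply (Rle_lt_trans _ (Cmod (w - z)%C)); auto.
      - apply (re_le_Cmod (w - z)%C).
      - apply (im_le_Cmod (w - z)%C). }
    apply Rle_lt_trans with (1 := Cmod_le_abs _).
    replace eps with (eps / 2 + eps / 2) by field.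
    apply Rplus_lt_compat; assumption.
  - intros H. apply filterlim_locally. intros eps.
    destruct (H eps (cond_pos eps)) as [del [Hd Hw]].
    assert (Hd2 : 0 < del / 2) by lra.
    exists (mkposreal _ Hd2). intros w [H1 H2].
    assert (Hm : Cmod (w - z) < del).
    { apply Rle_lt_trans with (1 := Cmod_le_abs _).
      replace del with (del / 2 + del / 2) by field.
      apply Rplus_lt_compat; assumption. }
    specialize (Hw w Hm). split; apply (Rle_lt_trans _ (Cmod (g w - g z)%C)); auto.
    + apply (re_le_Cmod (g w - g z)%C).
    + apply (im_le_Cmod (g w - g z)%C).
Qed.

Lemma ccont_ext_loc (f g : C -> C) (z : C) del : 0 < del ->
  (forall w, Cmod (w - z) < del -> f w = g w) ->
  ccontC f z -> ccontC g z.
Proof.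
  intros Hd E H. apply ccont_eps. intros eps He.
  destruct (proj1 (ccont_eps f z) H eps He) as [d2 [H2 Hw]].
  exists (Rmin del d2). split; [apply Rmin_glb_lt; assumption|].
  intros w Hm. rewrite <- !E.
  - apply Hw. eapply Rlt_le_trans; [exact Hm|apply Rmin_r].
  - replace (z - z)%C with (RtoC 0) by ring. rewrite Cmod_0. exact Hd.
  - eapply Rlt_le_trans; [exact Hm|apply Rmin_l].
Qed.

(** * Complex derivatives in Caratheodory form *)

(** Carrying the difference quotient as a function continuous at [z] turns the product, chain and
    inverse rules into algebraic identities, with no separate case [w = z]. *)
Definition cderiv (f : C -> C) (z l : C) : Prop :=
  exists phi : C -> C, ccontC phi z /\ phi z = l /\
    forall w, f w = (f z + phi w * (w - z))%C.

Definition cdiff (f : C -> C) (z : C) : Prop := exists l, cderiv f z l.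

Lemma cderiv_quot (f : C -> C) (z l : C) :
  (forall eps, 0 < eps -> exists del, 0 < del /\ forall w, Cmod (w - z) < del ->
     Cmod (f w - f z - l * (w - z)) <= eps * Cmod (w - z)) -> cderiv f z l.
Proof.
  intros H.
  exists (fun w => if Ceq_dec w z then l else ((f w - f z) / (w - z))%C).
  assert (Ez : (if Ceq_dec z z then l else ((f z - f z) / (z - z))%C) = l).
  { destruct (Ceq_dec z z) as [_|n]; [reflexivity|now elim n]. }
  split; [|split; [exact Ez|]].
  - apply ccont_eps. intros eps He. destruct (H (eps / 2)) as [del [Hd Hw]]; [lra|].
    exists del. split; [exact Hd|]. intros w Hm. rewrite Ez.
    destruct (Ceq_dec w z) as [->|n].
    + replace (l - l)%C with (RtoC 0) by ring. now rewrite Cmod_0.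
    + assert (Hn : (w - z)%C <> (RtoC 0)) by now apply Cminus_eq_contra.
      replace ((f w - f z) / (w - z) - l)%C
        with ((f w - f z - l * (w - z)) / (w - z))%C by (now field).
      rewrite Cmod_div by exact Hn.
      apply Rle_lt_trans with (eps / 2); [|lra].
      assert (Hp := proj1 (Cmod_gt_0 _) Hn).
      apply Rmult_le_reg_r with (Cmod (w - z)); [exact Hp|].
      unfold Rdiv at 1. rewrite Rmult_assoc, Rinv_l by lra. rewrite Rmult_1_r.
      now apply Hw.
  - intros w. destruct (Ceq_dec w z) as [->|n]; [ring|].
    field. now apply Cminus_eq_contra.
Qed.

(** Entry point of the analyticity hypothesis: it unfolds the domination in the library derivative
    into the explicit first-order estimate. Nothing is claimed about continuity of the derivative,
    hence Goursat later. *)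
Lemma ex_derive_cdiff (f : C -> C) (z : C) :
  ex_derive (K := C_AbsRing) (V := C_NormedModule) f z -> cdiff f z.
Proof.
  intros [l [_ H]]. exists l. apply cderiv_quot. intros eps He.
  destruct (H z (fun P HP => HP) (mkposreal _ He)) as [[del Hd] Hw].
  exists del. split; [exact Hd|]. intros w Hm.
  specialize (Hw w Hm).
  replace (f w - f z - l * (w - z))%C with (f w - f z - (w - z) * l)%C by ring.
  exact Hw.
Qed.

Lemma cderiv_eps (f : C -> C) (z l : C) : cderiv f z l ->
  forall eps, 0 < eps -> exists del, 0 < del /\ forall w, Cmod (w - z) < del ->
     Cmod (f w - f z - l * (w - z)) <= eps * Cmod (w - z).
Proof.
  intros [phi [Hc [El E]]] eps He.
  destruct (proj1 (ccont_eps phi z) Hc eps He) as [del [Hd Hw]].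
  exists del. split; [exact Hd|]. intros w Hm. rewrite (E w).
  replace (f z + phi w * (w - z) - f z - l * (w - z))%C with ((phi w - phi z) * (w - z))%C
    by (rewrite El; ring).
  rewrite Cmod_mult. apply Rmult_le_compat_r; [apply Cmod_ge_0|].
  left. now apply Hw.
Qed.

Lemma cdiff_ccont (f : C -> C) (z : C) : cdiff f z -> ccontC f z.
Proof.
  intros [l [phi [Hc [El E]]]].
  apply ccont_ext with (f := fun w => (f z + phi w * (w - z))%C).
  { intros; symmetry; apply E. }
  apply ccont_plus; [apply ccont_const|]. apply ccont_mult; [exact Hc|].
  apply ccont_minus; [apply continuous_id|apply ccont_const].
Qed.

Lemma cderiv_const (c z : C) : cderiv (fun _ => c) z (RtoC 0).
Proof.
  exists (fun _ => (RtoC 0)). split; [apply ccont_const|split; [reflexivity|intros; ring]].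
Qed.

Lemma cderiv_id (z : C) : cderiv (fun w => w) z (RtoC 1).
Proof.
  exists (fun _ => (RtoC 1)). split; [apply ccont_const|split; [reflexivity|intros; ring]].
Qed.

Lemma cderiv_plus (f g : C -> C) (z l m : C) :
  cderiv f z l -> cderiv g z m -> cderiv (fun w => (f w + g w)%C) z (l + m)%C.
Proof.
  intros [p [Hp [<- Ep]]] [q [Hq [<- Eq]]].
  exists (fun w => (p w + q w)%C). split; [now apply ccont_plus|split; [reflexivity|]].
  intros w. rewrite (Ep w), (Eq w). ring.
Qed.

Lemma cderiv_mult (f g : C -> C) (z l m : C) :
  cderiv f z l -> cderiv g z m -> cderiv (fun w => (f w * g w)%C) z (l * g z + f z * m)%C.
Proof.
  intros Hf Hg. assert (Cg : ccontC g z) by (apply cdiff_ccont; now exists m).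
  destruct Hf as [p [Hp [<- Ep]]]. destruct Hg as [q [Hq [<- Eq]]].
  exists (fun w => (p w * g w + f z * q w)%C).
  split; [|split; [reflexivity|]].
  - apply ccont_plus; apply ccont_mult; auto. apply ccont_const.
  - intros w. rewrite (Ep w), (Eq w). ring.
Qed.

(** The factorization in [cderiv] must hold at every [w], far from [z] as well, which explains the
    global hypothesis of nonvanishing; [cdiff_inv] localizes it. *)
Lemma cderiv_inv (f : C -> C) (z l : C) :
  (forall w, f w <> (RtoC 0)) -> cderiv f z l -> cderiv (fun w => (/ f w)%C) z (- l / (f z * f z))%C.
Proof.
  intros Hn Hf. assert (Cf : ccontC f z) by (apply cdiff_ccont; now exists l).
  destruct Hf as [p [Hp [<- Ep]]].
  exists (fun w => (- p w / (f w * f z))%C).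
  split; [|split; [reflexivity|]].
  - apply ccont_div; [now apply ccont_opp| |].
    + apply ccont_mult; [exact Cf|apply ccont_const].
    + now apply Cmult_neq_0.
  - intros w. generalize (Hn w), (Hn z). rewrite (Ep w).
    intros Hw Hz. field. now split.
Qed.

Lemma cderiv_comp (f g : C -> C) (z l m : C) :
  cderiv f z l -> cderiv g (f z) m -> cderiv (fun w => g (f w)) z (m * l)%C.
Proof.
  intros Hf Hg. assert (Cf : ccontC f z) by (apply cdiff_ccont; now exists l).
  destruct Hf as [p [Hp [<- Ep]]]. destruct Hg as [q [Hq [<- Eq]]].
  exists (fun w => (q (f w) * p w)%C).
  split; [|split; [reflexivity|]].
  - apply ccont_mult; [|exact Hp]. now apply (ccont_comp f q).
  - intros w. rewrite (Eq (f w)). rewrite (Ep w) at 2. ring.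
Qed.

(** The factor [phi] of [f] is wrong for [g] away from [z]. Going back through the first-order
    estimate, which is local, produces a new factor. *)
Lemma cderiv_ext_loc (f g : C -> C) (z l : C) del : 0 < del ->
  (forall w, Cmod (w - z) < del -> f w = g w) -> cderiv f z l -> cderiv g z l.
Proof.
  intros Hd E H. apply cderiv_quot. intros eps He.
  destruct (cderiv_eps f z l H eps He) as [d2 [H2 Hw]].
  exists (Rmin del d2). split; [apply Rmin_glb_lt; assumption|].
  intros w Hm. rewrite <- !E.
  - apply Hw. eapply Rlt_le_trans; [exact Hm|apply Rmin_r].
  - replace (z - z)%C with (RtoC 0) by ring. rewrite Cmod_0. exact Hd.
  - eapply Rlt_le_trans; [exact Hm|apply Rmin_l].
Qed.

Lemma cdiff_inv (f : C -> C) (z : C) : f z <> (RtoC 0) -> cdiff f z -> cdiff (fun w => (/ f w)%C) z.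
Proof.
  intros Hn Hf. pose proof (cdiff_ccont f z Hf) as Cf. destruct Hf as [l Hl].
  destruct (proj1 (ccont_eps f z) Cf (Cmod (f z)) (proj1 (Cmod_gt_0 _) Hn)) as [del [Hd Hw]].
  assert (Hnz : forall w, Cmod (w - z) < del -> f w <> (RtoC 0)).
  { intros w Hm E0. specialize (Hw w Hm). rewrite E0 in Hw.
    replace (0 - f z)%C with (- f z)%C in Hw by ring. rewrite Cmod_opp in Hw. lra. }
  (* [cderiv_inv] wants a nonvanishing function, so the far zeros of [f] are replaced by [1]. *)
  set (f1 := fun w => if Ceq_dec (f w) 0 then (RtoC 1) else f w).
  assert (E1 : forall w, Cmod (w - z) < del -> f w = f1 w).
  { intros w Hm. unfold f1. destruct (Ceq_dec (f w) 0) as [e|e]; [|reflexivity].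
    now elim (Hnz w Hm). }
  assert (H1 := cderiv_ext_loc f f1 z l del Hd E1 Hl).
  exists (- l / (f1 z * f1 z))%C.
  apply cderiv_ext_loc with (f := fun w => (/ f1 w)%C) (del := del); auto.
  - intros w Hm. now rewrite (E1 w Hm).
  - apply cderiv_inv; [|exact H1].
    intros w. unfold f1. destruct (Ceq_dec (f w) 0); [apply C1_nz|assumption].
Qed.

Lemma cdiff_const c z : cdiff (fun _ => c) z.
Proof. eexists; apply cderiv_const. Qed.
Lemma cdiff_id z : cdiff (fun w => w) z.
Proof. eexists; apply cderiv_id. Qed.
Lemma cdiff_plus f g z : cdiff f z -> cdiff g z -> cdiff (fun w => (f w + g w)%C) z.
Proof. intros [l Hl] [m Hm]. eexists; apply cderiv_plus; eassumption. Qed.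
Lemma cdiff_mult f g z : cdiff f z -> cdiff g z -> cdiff (fun w => (f w * g w)%C) z.
Proof. intros [l Hl] [m Hm]. eexists; apply cderiv_mult; eassumption. Qed.
Lemma cdiff_comp f g z : cdiff f z -> cdiff g (f z) -> cdiff (fun w => g (f w)) z.
Proof. intros [l Hl] [m Hm]. eexists; apply cderiv_comp; eassumption. Qed.
Lemma cdiff_ext f g z : (forall w, f w = g w) -> cdiff f z -> cdiff g z.
Proof.
  intros E [l Hl]. exists l. apply cderiv_ext_loc with (f := f) (del := 1); auto. lra.
Qed.
Lemma cdiff_minus f g z : cdiff f z -> cdiff g z -> cdiff (fun w => (f w - g w)%C) z.
Proof.
  intros Hf Hg. apply cdiff_ext with (f := fun w => (f w + (-1) * g w)%C).
  { intros; ring. }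
  apply cdiff_plus; [exact Hf|]. apply cdiff_mult; [apply cdiff_const|exact Hg].
Qed.
Lemma cdiff_div f g z : g z <> (RtoC 0) -> cdiff f z -> cdiff g z -> cdiff (fun w => (f w / g w)%C) z.
Proof. intros. apply cdiff_mult; [|apply cdiff_inv]; assumption. Qed.

(** * Integrals of complex-valued functions of a real variable *)

(** Taken componentwise so that the real theory of [RInt] (antiderivatives, Fubini) applies to each
    coordinate; [CInt_is_RInt] recovers the vector-valued integral when the norm inequality is
    wanted. *)
Definition CInt (f : R -> C) (a b : R) : C :=
  (RInt (fun t => Re (f t)) a b, RInt (fun t => Im (f t)) a b).

Definition ccont_on (f : R -> C) (a b : R) : Prop :=
  forall t, Rmin a b <= t <= Rmax a b -> ccont f t.

Lemma ccont_on_ex_re f a b : ccont_on f a b -> ex_RInt (fun t => Re (f t)) a b.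
Proof. intros H. apply (ex_RInt_continuous (V := R_CompleteNormedModule)). intros. now apply ccont_re, H. Qed.

Lemma ccont_on_ex_im f a b : ccont_on f a b -> ex_RInt (fun t => Im (f t)) a b.
Proof. intros H. apply (ex_RInt_continuous (V := R_CompleteNormedModule)). intros. now apply ccont_im, H. Qed.

Lemma CInt_is_RInt f a b : ccont_on f a b ->
  is_RInt (V := C_R_NormedModule) f a b (CInt f a b).
Proof.
  intros H. unfold CInt.
  apply (@is_RInt_fct_extend_pair R_NormedModule R_NormedModule);
    apply (RInt_correct (V := R_CompleteNormedModule)); [now apply ccont_on_ex_re|now apply ccont_on_ex_im].
Qed.

Lemma CInt_unique f a b l : is_RInt (V := C_R_NormedModule) f a b l -> CInt f a b = l.
Proof.
  intros H. destruct l as [u v]. unfold CInt. f_equal; apply is_RInt_unique.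
  - exact (@is_RInt_fct_extend_fst R_NormedModule R_NormedModule f a b _ H).
  - exact (@is_RInt_fct_extend_snd R_NormedModule R_NormedModule f a b _ H).
Qed.

Lemma CInt_ext f g a b : (forall t, Rmin a b < t < Rmax a b -> f t = g t) ->
  CInt f a b = CInt g a b.
Proof. intros E. unfold CInt. f_equal; apply RInt_ext; intros t Ht; now rewrite E. Qed.

Lemma CInt_plus f g a b : ccont_on f a b -> ccont_on g a b ->
  CInt (fun t => (f t + g t)%C) a b = (CInt f a b + CInt g a b)%C.
Proof.
  intros Hf Hg. apply CInt_unique.
  apply (is_RInt_plus (V := C_R_NormedModule) f g); now apply CInt_is_RInt.
Qed.

Lemma CInt_scal c f a b : ccont_on f a b ->
  CInt (fun t => (c * f t)%C) a b = (c * CInt f a b)%C.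
Proof.
  intros Hf. pose proof (ccont_on_ex_re _ _ _ Hf) as Hr. pose proof (ccont_on_ex_im _ _ _ Hf) as Hi.
  destruct c as [u v]. unfold CInt, Cmult at 3. simpl fst; simpl snd. f_equal.
  - apply is_RInt_unique.
    apply (is_RInt_ext (fun t => minus (scal u (Re (f t))) (scal v (Im (f t))))).
    { intros; unfold minus, plus, opp, scal; simpl; unfold mult; simpl; unfold Re, Im; ring. }
    apply (is_RInt_minus (V := R_NormedModule)); apply (is_RInt_scal (V := R_NormedModule));
      apply (RInt_correct (V := R_CompleteNormedModule)); assumption.
  - apply is_RInt_unique.
    apply (is_RInt_ext (fun t => plus (scal u (Im (f t))) (scal v (Re (f t))))).
    { intros; unfold plus, scal; simpl; unfold mult; simpl; unfold Re, Im; ring. }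
    apply (is_RInt_plus (V := R_NormedModule)); apply (is_RInt_scal (V := R_NormedModule));
      apply (RInt_correct (V := R_CompleteNormedModule)); assumption.
Qed.

Lemma CInt_Chasles f a b c : ccont_on f a b -> ccont_on f b c ->
  (CInt f a b + CInt f b c)%C = CInt f a c.
Proof.
  intros H1 H2. symmetry. apply CInt_unique.
  apply (is_RInt_Chasles (V := C_R_NormedModule) f a b c); now apply CInt_is_RInt.
Qed.

Lemma CInt_le f (g : R -> R) a b : a <= b -> ccont_on f a b -> ex_RInt g a b ->
  (forall t, a <= t <= b -> Cmod (f t) <= g t) -> Cmod (CInt f a b) <= RInt g a b.
Proof.
  intros Hab Hf Hg H. rewrite Cmod_norm.
  apply (norm_RInt_le (V := C_R_NormedModule) f g a b).
  - exact Hab.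
  - intros t Ht. rewrite <- Cmod_norm. now apply H.
  - now apply CInt_is_RInt.
  - now apply (RInt_correct (V := R_CompleteNormedModule)).
Qed.

Lemma CInt_le_const f a b M : a <= b -> ccont_on f a b ->
  (forall t, a <= t <= b -> Cmod (f t) <= M) -> Cmod (CInt f a b) <= (b - a) * M.
Proof.
  intros Hab Hf H. eapply Rle_trans.
  - apply (CInt_le f (fun _ => M)); auto. apply ex_RInt_const.
  - rewrite RInt_const. unfold scal; simpl; unfold mult; simpl. lra.
Qed.

Lemma is_RInt_affine u v a b :
  is_RInt (fun t => u + v * t) a b (u * (b - a) + v * ((b ^ 2 - a ^ 2) / 2)).
Proof.
  replace (u * (b - a) + v * ((b ^ 2 - a ^ 2) / 2))
    with (minus (u * b + v * b ^ 2 / 2) (u * a + v * a ^ 2 / 2))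
    by (unfold minus, plus, opp; simpl; field).
  apply (is_RInt_derive (fun t => u * t + v * t ^ 2 / 2)).
  - intros t _. auto_derive; [trivial|toR; field].
  - intros t _. apply (ex_derive_continuous (V := R_NormedModule)). auto_derive; trivial.
Qed.

Lemma CInt_affine (u v : C) a b :
  CInt (fun t => (u + v * RtoC t)%C) a b = (u * RtoC (b - a) + v * RtoC ((b ^ 2 - a ^ 2) / 2))%C.
Proof.
  destruct u as [u1 u2], v as [v1 v2].
  unfold CInt, Cplus, Cmult, RtoC, Re, Im. simpl fst; simpl snd. f_equal.
  - rewrite (RInt_ext _ (fun t => u1 + v1 * t)) by (intros; toR; simpl; ring).
    rewrite (is_RInt_unique _ _ _ _ (is_RInt_affine u1 v1 a b)). toR; simpl; field.
  - rewrite (RInt_ext _ (fun t => u2 + v2 * t)) by (intros; toR; simpl; ring).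
    rewrite (is_RInt_unique _ _ _ _ (is_RInt_affine u2 v2 a b)). toR; simpl; field.
Qed.

(** * Cauchy's theorem on rectangles *)

(** The counterclockwise boundary integral: bottom, right, top and left side, where $dz=i\,dy$ on
    the vertical ones. *)
Definition rectInt (G : C -> C) (a b c e : R) : C :=
  (CInt (fun s => G (s, c)) a b + Ci * CInt (fun y => G (b, y)) c e
   - CInt (fun s => G (s, e)) a b - Ci * CInt (fun y => G (a, y)) c e)%C.

Definition in_rect (a b c e : R) (z : C) : Prop := a <= Re z <= b /\ c <= Im z <= e.

(** Restricted to the boundary because the integrands have poles inside. *)
Definition cont_bd (G : C -> C) (a b c e : R) : Prop :=
  (forall z, in_rect a b c e z -> (Re z = a \/ Re z = b \/ Im z = c \/ Im z = e) ->
     ccontC G z).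

Lemma ccont_hline (x y : R) : ccont (fun s => (s, y)) x.
Proof. apply ccont_pair; [apply continuous_id|apply continuous_const]. Qed.
Lemma ccont_vline (x y : R) : ccont (fun s => (x, s)) y.
Proof. apply ccont_pair; [apply continuous_const|apply continuous_id]. Qed.

Lemma ccont_on_h (G : C -> C) a b y : a <= b ->
  (forall x, a <= x <= b -> ccontC G (x, y)) -> ccont_on (fun s => G (s, y)) a b.
Proof.
  intros Hab H t. rewrite Rmin_left, Rmax_right by exact Hab. intros Ht.
  apply (ccont_comp (fun s => (s, y)) G); [apply ccont_hline|now apply H].
Qed.
Lemma ccont_on_v (G : C -> C) x c e : c <= e ->
  (forall y, c <= y <= e -> ccontC G (x, y)) -> ccont_on (fun s => G (x, s)) c e.
Proof.
  intros Hab H t. rewrite Rmin_left, Rmax_right by exact Hab. intros Ht.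
  apply (ccont_comp (fun s => (x, s)) G); [apply ccont_vline|now apply H].
Qed.

Lemma cont_bd_sides G a b c e : a <= b -> c <= e -> cont_bd G a b c e ->
  ccont_on (fun s => G (s, c)) a b /\ ccont_on (fun s => G (s, e)) a b /\
  ccont_on (fun s => G (a, s)) c e /\ ccont_on (fun s => G (b, s)) c e.
Proof.
  intros Hab Hce H.
  repeat split; (apply ccont_on_h || apply ccont_on_v); auto; intros t Ht; apply H;
    unfold in_rect; simpl; tauto || (split; lra).
Qed.

Lemma rectInt_plus F G a b c e : a <= b -> c <= e -> cont_bd F a b c e -> cont_bd G a b c e ->
  rectInt (fun z => (F z + G z)%C) a b c e = (rectInt F a b c e + rectInt G a b c e)%C.
Proof.
  intros Hab Hce HF HG.
  destruct (cont_bd_sides F a b c e Hab Hce HF) as [F1 [F2 [F3 F4]]].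
  destruct (cont_bd_sides G a b c e Hab Hce HG) as [G1 [G2 [G3 G4]]].
  unfold rectInt. rewrite !CInt_plus by assumption. ring.
Qed.

Lemma rectInt_scal k F a b c e : a <= b -> c <= e -> cont_bd F a b c e ->
  rectInt (fun z => (k * F z)%C) a b c e = (k * rectInt F a b c e)%C.
Proof.
  intros Hab Hce HF.
  destruct (cont_bd_sides F a b c e Hab Hce HF) as [F1 [F2 [F3 F4]]].
  unfold rectInt. rewrite !CInt_scal by assumption. ring.
Qed.

Lemma rectInt_ext F G a b c e : a <= b -> c <= e ->
  (forall z, in_rect a b c e z -> (Re z = a \/ Re z = b \/ Im z = c \/ Im z = e) -> F z = G z) ->
  rectInt F a b c e = rectInt G a b c e.
Proof.
  intros Hab Hce H. unfold rectInt.
  rewrite (CInt_ext (fun s => F (s, c)) (fun s => G (s, c))),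
   (CInt_ext (fun s => F (s, e)) (fun s => G (s, e))),
   (CInt_ext (fun s => F (a, s)) (fun s => G (a, s))),
   (CInt_ext (fun s => F (b, s)) (fun s => G (b, s))); [reflexivity| | | |];
   intros t Ht; rewrite Rmin_left, Rmax_right in Ht by assumption; apply H; unfold in_rect; simpl;
   tauto || (split; lra).
Qed.

Lemma rectInt_bound G a b c e M : a <= b -> c <= e -> cont_bd G a b c e ->
  (forall z, in_rect a b c e z -> (Re z = a \/ Re z = b \/ Im z = c \/ Im z = e) -> Cmod (G z) <= M) ->
  Cmod (rectInt G a b c e) <= 2 * ((b - a) + (e - c)) * M.
Proof.
  intros Hab Hce HG HM.
  destruct (cont_bd_sides G a b c e Hab Hce HG) as [G1 [G2 [G3 G4]]].
  unfold rectInt.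
  assert (B1 : Cmod (CInt (fun s => G (s, c)) a b) <= (b - a) * M).
  { apply CInt_le_const; auto. intros; apply HM; unfold in_rect; simpl; tauto || (split; lra). }
  assert (B2 : Cmod (CInt (fun s => G (s, e)) a b) <= (b - a) * M).
  { apply CInt_le_const; auto. intros; apply HM; unfold in_rect; simpl; tauto || (split; lra). }
  assert (B3 : Cmod (CInt (fun s => G (a, s)) c e) <= (e - c) * M).
  { apply CInt_le_const; auto. intros; apply HM; unfold in_rect; simpl; tauto || (split; lra). }
  assert (B4 : Cmod (CInt (fun s => G (b, s)) c e) <= (e - c) * M).
  { apply CInt_le_const; auto. intros; apply HM; unfold in_rect; simpl; tauto || (split; lra). }
  unfold Cminus.
  eapply Rle_trans; [apply Cmod_triangle|]. rewrite Cmod_opp, Cmod_mult, Cmod_Ci.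
  eapply Rle_trans; [apply Rplus_le_compat_r, Cmod_triangle|]. rewrite Cmod_opp.
  eapply Rle_trans; [apply Rplus_le_compat_r, Rplus_le_compat_r, Cmod_triangle|].
  rewrite Cmod_mult, Cmod_Ci. lra.
Qed.

Lemma rectInt_split_x G a m b c e : a <= m <= b -> c <= e ->
  cont_bd G a m c e -> cont_bd G m b c e ->
  rectInt G a b c e = (rectInt G a m c e + rectInt G m b c e)%C.
Proof.
  intros Hm Hce H1 H2.
  destruct (cont_bd_sides G a m c e (proj1 Hm) Hce H1) as [F1 [F2 [F3 F4]]].
  destruct (cont_bd_sides G m b c e (proj2 Hm) Hce H2) as [G1 [G2 [G3 G4]]].
  unfold rectInt.
  rewrite <- (CInt_Chasles (fun s => G (s, c)) a m b), <- (CInt_Chasles (fun s => G (s, e)) a m b)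
    by assumption. ring.
Qed.

Lemma rectInt_split_y G a b c m e : a <= b -> c <= m <= e ->
  cont_bd G a b c m -> cont_bd G a b m e ->
  rectInt G a b c e = (rectInt G a b c m + rectInt G a b m e)%C.
Proof.
  intros Hab Hm H1 H2.
  destruct (cont_bd_sides G a b c m Hab (proj1 Hm) H1) as [F1 [F2 [F3 F4]]].
  destruct (cont_bd_sides G a b m e Hab (proj2 Hm) H2) as [G1 [G2 [G3 G4]]].
  unfold rectInt.
  rewrite <- (CInt_Chasles (fun s => G (a, s)) c m e), <- (CInt_Chasles (fun s => G (b, s)) c m e)
    by assumption. ring.
Qed.

(** Cauchy's theorem for the first-order Taylor polynomial, by direct computation. Goursat's
    argument subtracts this polynomial and estimates only the remainder. *)
Lemma rectInt_affine (p q : C) a b c e : rectInt (fun z => (p + q * z)%C) a b c e = (RtoC 0).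
Proof.
  unfold rectInt.
  rewrite (CInt_ext (fun s => (p + q * (s, c))%C) (fun s => ((p + q * (0, c)) + q * RtoC s)%C)),
    (CInt_ext (fun s => (p + q * (s, e))%C) (fun s => ((p + q * (0, e)) + q * RtoC s)%C)),
    (CInt_ext (fun s => (p + q * (a, s))%C) (fun s => ((p + q * RtoC a) + (q * Ci) * RtoC s)%C)),
    (CInt_ext (fun s => (p + q * (b, s))%C) (fun s => ((p + q * RtoC b) + (q * Ci) * RtoC s)%C)).
  2-5: intros; destruct p as [p1 p2], q as [q1 q2];
    unfold Cplus, Cmult, RtoC, Ci; simpl; f_equal; ring.
  rewrite !CInt_affine. destruct p as [p1 p2], q as [q1 q2].
  unfold Cminus, Copp, Cplus, Cmult, RtoC, Ci; simpl; f_equal; field.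
Qed.

(** * Goursat's bisection *)

Record rect := Rect { rl : R; rr : R; rb : R; rt : R }.

Definition quarters (q : rect) : rect * rect * rect * rect :=
  let m := (rl q + rr q) / 2 in let p := (rb q + rt q) / 2 in
  (Rect (rl q) m (rb q) p, Rect m (rr q) (rb q) p, Rect (rl q) m p (rt q), Rect m (rr q) p (rt q)).

Definition rectI G q := rectInt G (rl q) (rr q) (rb q) (rt q).

(** The selection is a chain of decidable real comparisons, so the nested rectangles are a plain
    iteration. If three quarters fall short, the triangle inequality forces the fourth, which is the
    default. *)
Definition big_quarter (G : C -> C) (q : rect) : rect :=
  let '(q1, q2, q3, q4) := quarters q in
  let v := Cmod (rectI G q) / 4 in
  if Rle_dec v (Cmod (rectI G q1)) then q1
  else if Rle_dec v (Cmod (rectI G q2)) then q2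
  else if Rle_dec v (Cmod (rectI G q3)) then q3 else q4.

Lemma big_quarter_cases G q (P : rect -> Prop) :
  (let '(q1, q2, q3, q4) := quarters q in P q1 /\ P q2 /\ P q3 /\ P q4) -> P (big_quarter G q).
Proof.
  unfold big_quarter. destruct (quarters q) as [[[q1 q2] q3] q4]. intros [H1 [H2 [H3 H4]]].
  repeat destruct Rle_dec; assumption.
Qed.

Lemma big_quarter_le G q : rl q <= rr q -> rb q <= rt q ->
  (forall z, in_rect (rl q) (rr q) (rb q) (rt q) z -> ccontC G z) ->
  Cmod (rectI G q) / 4 <= Cmod (rectI G (big_quarter G q)).
Proof.
  intros Hx Hy HG. unfold big_quarter.
  destruct q as [a b c e]. simpl in *.
  set (m := (a + b) / 2). set (p := (c + e) / 2).
  assert (Hm : a <= m <= b) by (unfold m; lra). assert (Hp : c <= p <= e) by (unfold p; lra).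
  assert (E : rectInt G a b c e = (rectInt G a m c p + rectInt G m b c p
     + rectInt G a m p e + rectInt G m b p e)%C).
  { rewrite (rectInt_split_x G a m b c e), (rectInt_split_y G a m c p e),
     (rectInt_split_y G m b c p e); try tauto; try ring;
     intros z Hz _; apply HG; unfold in_rect in *; lra. }
  unfold rectI; simpl. destruct Rle_dec as [|N1]; [assumption|].
  destruct Rle_dec as [|N2]; [assumption|]. destruct Rle_dec as [|N3]; [assumption|]. simpl.
  assert (T : Cmod (rectInt G a b c e) <= Cmod (rectInt G a m c p) + Cmod (rectInt G m b c p)
     + Cmod (rectInt G a m p e) + Cmod (rectInt G m b p e)).
  { rewrite E. eapply Rle_trans; [apply Cmod_triangle|].
    eapply Rle_trans; [apply Rplus_le_compat_r, Cmod_triangle|].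
    eapply Rle_trans; [apply Rplus_le_compat_r, Rplus_le_compat_r, Cmod_triangle|]. lra. }
  lra.
Qed.

Lemma nested_point (u v : nat -> R) :
  (forall n, u n <= u (S n)) -> (forall n, v (S n) <= v n) -> (forall n, u n <= v n) ->
  exists x, forall n, u n <= x <= v n.
Proof.
  intros Hu Hv Huv.
  assert (Mu : forall n k, u n <= u (n + k)%nat).
  { intros n k. induction k as [|k IH]; [rewrite Nat.add_0_r; lra|].
    rewrite Nat.add_succ_r. eapply Rle_trans; [exact IH|apply Hu]. }
  assert (Mv : forall n k, v (n + k)%nat <= v n).
  { intros n k. induction k as [|k IH]; [rewrite Nat.add_0_r; lra|].
    rewrite Nat.add_succ_r. eapply Rle_trans; [apply Hv|exact IH]. }
  assert (H : forall n m, u n <= v m).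
  { intros n m. eapply Rle_trans; [apply (Mu n m)|].
    eapply Rle_trans; [apply Huv|]. rewrite Nat.add_comm. apply Mv. }
  destruct (completeness (fun x => exists n, x = u n)) as [x [Hx1 Hx2]].
  - exists (v O). intros y [n ->]. apply H.
  - exists (u O). now exists O.
  - exists x. intros n. split; [apply Hx1; now exists n|].
    apply Hx2. intros y [k ->]. apply H.
Qed.

Theorem goursat G a b c e : a <= b -> c <= e ->
  (forall z, in_rect a b c e z -> cdiff G z) -> rectInt G a b c e = (RtoC 0).
Proof.
  intros Hab Hce HG.
  set (q := fun n => Nat.iter n (big_quarter G) (Rect a b c e)).
  assert (qS : forall n, q (S n) = big_quarter G (q n)) by reflexivity.
  assert (Ord : forall n, rl (q n) <= rr (q n) /\ rb (q n) <= rt (q n)).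
  { induction n as [|n [IH1 IH2]]; [simpl; auto|]. rewrite qS. apply big_quarter_cases.
    unfold quarters. simpl. lra. }
  assert (Mon : forall n, rl (q n) <= rl (q (S n)) /\ rr (q (S n)) <= rr (q n) /\
    rb (q n) <= rb (q (S n)) /\ rt (q (S n)) <= rt (q n)).
  { intros n. destruct (Ord n). rewrite qS. apply big_quarter_cases. unfold quarters. simpl. lra. }
  assert (Siz : forall n, rr (q n) - rl (q n) = (b - a) * (/ 2) ^ n /\
    rt (q n) - rb (q n) = (e - c) * (/ 2) ^ n).
  { induction n as [|n [IH1 IH2]]; [simpl; lra|]. rewrite qS. apply big_quarter_cases.
    unfold quarters. simpl. lra. }
  assert (Sub : forall n z, in_rect (rl (q n)) (rr (q n)) (rb (q n)) (rt (q n)) z -> in_rect a b c e z).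
  { induction n as [|n IH]; intros z Hz; [exact Hz|]. apply IH.
    specialize (Mon n). unfold in_rect in *. lra. }
  assert (Big : forall n, Cmod (rectInt G a b c e) * (/ 4) ^ n <= Cmod (rectI G (q n))).
  { induction n as [|n IH]; [unfold rectI; simpl; lra|]. rewrite qS.
    eapply Rle_trans; [|apply big_quarter_le].
    - simpl. lra.
    - apply Ord.
    - apply Ord.
    - intros z Hz. apply cdiff_ccont, HG, (Sub n z Hz). }
  destruct (nested_point (fun n => rl (q n)) (fun n => rr (q n))) as [x0 Hx0];
    try (intros n; apply (Mon n) || apply (Ord n)).
  destruct (nested_point (fun n => rb (q n)) (fun n => rt (q n))) as [y0 Hy0];
    try (intros n; apply (Mon n) || apply (Ord n)).
  set (z0 := (x0, y0) : C).
  destruct (HG z0) as [l Hl].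
  { apply (Sub O). split; simpl; [apply (Hx0 O)|apply (Hy0 O)]. }
  set (L := (b - a) + (e - c)).
  assert (HL : 0 <= L) by (unfold L; lra).
  apply Cmod_eq_0, Rle_antisym; [|apply Cmod_ge_0].
  apply le_epsilon. intros eps He. rewrite Rplus_0_l.
  (* In the [n]-th rectangle the perimeter and the distance to [z0] are each of order
     [L * (/ 2) ^ n], so an error slope [k] gives at most [2 * (L * L) * k * (/ 4) ^ n]. This
     matches the factor [(/ 4) ^ n] lost in [Big]. The [+ 1] keeps the denominator positive for a
     rectangle reduced to a point. *)
  assert (Hk : 0 < eps / (2 * (L * L) + 1)).
  { apply Rdiv_lt_0_compat; [exact He|]. generalize (Rmult_le_pos L L HL HL). lra. }
  set (k := eps / (2 * (L * L) + 1)) in *.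
  destruct (cderiv_eps G z0 l Hl k Hk) as [del [Hd Hw]].
  destruct (pow_lt_1_zero (/ 2) ltac:(rewrite Rabs_pos_eq; lra) (del / (L + 1))) as [n Hn].
  { apply Rdiv_lt_0_compat; lra. }
  specialize (Hn n (Nat.le_refl n)).
  assert (P2 : 0 < (/ 2) ^ n) by (apply pow_lt; lra).
  rewrite Rabs_pos_eq in Hn by lra.
  assert (Hsmall : L * (/ 2) ^ n < del).
  { apply Rle_lt_trans with ((L + 1) * (/ 2) ^ n); [nra|].
    apply Rmult_lt_reg_l with (/ (L + 1)); [apply Rinv_0_lt_compat; lra|].
    rewrite <- Rmult_assoc, Rinv_l by lra. unfold Rdiv in Hn. lra. }
  destruct (Ord n) as [O1 O2]. destruct (Siz n) as [S1 S2].
  assert (Hdist : forall z, in_rect (rl (q n)) (rr (q n)) (rb (q n)) (rt (q n)) z ->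
    Cmod (z - z0) <= L * (/ 2) ^ n).
  { intros z [H1 H2]. eapply Rle_trans; [apply Cmod_le_abs|].
    specialize (Hx0 n). specialize (Hy0 n).
    destruct z as [x y]. simpl in *.
    apply Rle_trans with ((rr (q n) - rl (q n)) + (rt (q n) - rb (q n))).
    - apply Rplus_le_compat; apply Rabs_le; lra.
    - unfold L. rewrite S1, S2. lra. }
  (* The remainder after the affine part; it has the same boundary integral as [G] and is small to
     first order. *)
  set (H := fun z => (G z - G z0 - l * (z - z0))%C).
  assert (CH : forall z, in_rect (rl (q n)) (rr (q n)) (rb (q n)) (rt (q n)) z ->
    ccontC H z).
  { intros z Hz. unfold H. apply ccont_minus; [apply ccont_minus|].
    - apply cdiff_ccont, HG, (Sub n z Hz).
    - apply ccont_const.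
    - apply ccont_mult; [apply ccont_const|].
      apply ccont_minus; [apply continuous_id|apply ccont_const]. }
  assert (E : rectI G (q n) = rectInt H (rl (q n)) (rr (q n)) (rb (q n)) (rt (q n))).
  { unfold rectI.
    rewrite (rectInt_ext G (fun z => (H z + ((G z0 - l * z0) + l * z))%C)); auto.
    2: { intros; unfold H; ring. }
    rewrite rectInt_plus; auto.
    - rewrite rectInt_affine. ring.
    - intros z Hz _. now apply CH.
    - intros z _ _. apply ccont_plus; [apply ccont_const|].
      apply ccont_mult; [apply ccont_const|apply continuous_id]. }
  assert (B : Cmod (rectI G (q n)) <= 2 * (L * (/ 2) ^ n) * (k * (L * (/ 2) ^ n))).
  { rewrite E. replace (L * (/ 2) ^ n) with ((rr (q n) - rl (q n)) + (rt (q n) - rb (q n)))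
      by (rewrite S1, S2; unfold L; ring).
    apply rectInt_bound; auto.
    - intros z Hz _. now apply CH.
    - intros z Hz _. eapply Rle_trans.
      + apply Hw. eapply Rle_lt_trans; [now apply Hdist|exact Hsmall].
      + apply Rmult_le_compat_l; [lra|].
        eapply Rle_trans; [now apply Hdist|]. rewrite S1, S2. unfold L. lra. }
  assert (B2 := Rle_trans _ _ _ (Big n) B).
  assert (P4 : (/ 4) ^ n = (/ 2) ^ n * (/ 2) ^ n) by (rewrite <- Rpow_mult_distr; f_equal; lra).
  assert (P40 : 0 < (/ 4) ^ n) by (apply pow_lt; lra).
  assert (B3 : Cmod (rectInt G a b c e) <= 2 * (L * L) * k).
  { apply Rmult_le_reg_r with ((/ 4) ^ n); [exact P40|].
    eapply Rle_trans; [exact B2|]. rewrite P4. lra. }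
  assert (Ek : k * (2 * (L * L) + 1) = eps).
  { unfold k. field. generalize (Rmult_le_pos L L HL HL). lra. }
  lra.
Qed.

(** * Simple poles and the residue theorem on rectangles *)

Lemma is_RInt_re_inv (p c a b : R) : c <> 0 ->
  is_RInt (fun s => (s - p) / ((s - p) ^ 2 + c ^ 2)) a b
    (ln ((b - p) ^ 2 + c ^ 2) / 2 - ln ((a - p) ^ 2 + c ^ 2) / 2).
Proof.
  intros Hc.
  assert (P : forall s, 0 < (s - p) ^ 2 + c ^ 2).
  { intros s. assert (0 < c ^ 2) by (apply pow2_gt_0; lra). assert (0 <= (s - p) ^ 2) by apply pow2_ge_0.
    lra. }
  apply (is_RInt_derive (fun t => ln ((t - p) ^ 2 + c ^ 2) / 2)).
  - intros s _. auto_derive; [specialize (P s); simpl in P; lra|].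
    toR. field. specialize (P s). simpl in P. lra.
  - intros s _. apply (ex_derive_continuous (V := R_NormedModule)). auto_derive.
    specialize (P s). simpl in P. lra.
Qed.

Lemma is_RInt_im_inv (p c a b : R) : c <> 0 ->
  is_RInt (fun s => c / ((s - p) ^ 2 + c ^ 2)) a b (atan ((b - p) / c) - atan ((a - p) / c)).
Proof.
  intros Hc.
  assert (P : forall s, 0 < (s - p) ^ 2 + c ^ 2).
  { intros s. assert (0 < c ^ 2) by (apply pow2_gt_0; lra). assert (0 <= (s - p) ^ 2) by apply pow2_ge_0.
    lra. }
  apply (is_RInt_derive (fun t => atan ((t - p) / c))).
  - intros s _. auto_derive; [trivial|].
    toR. unfold Rsqr. field. specialize (P s). simpl in P. lra.
  - intros s _. apply (ex_derive_continuous (V := R_NormedModule)). auto_derive.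
    specialize (P s). simpl in P. lra.
Qed.

Lemma CInt_inv_h (p c a b : R) : c <> 0 ->
  CInt (fun s => (/ ((s, c) - p))%C) a b =
  (ln ((b - p) ^ 2 + c ^ 2) / 2 - ln ((a - p) ^ 2 + c ^ 2) / 2,
   - (atan ((b - p) / c) - atan ((a - p) / c))).
Proof.
  intros Hc. unfold CInt. f_equal; apply is_RInt_unique.
  - apply is_RInt_ext with (2 := is_RInt_re_inv p c a b Hc).
    intros s _. unfold Cinv, Cminus, Cplus, Copp, RtoC, Re; simpl. f_equal; try ring; f_equal; ring.
  - apply is_RInt_ext with (2 := is_RInt_opp _ _ _ _ (is_RInt_im_inv p c a b Hc)).
    intros s _. unfold Cinv, Cminus, Cplus, Copp, RtoC, Im, opp; simpl.
    unfold Rdiv. rewrite Ropp_mult_distr_l. f_equal; try ring; f_equal; ring.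
Qed.

Lemma CInt_inv_v (p x c e : R) : x <> p ->
  CInt (fun y => (/ ((x, y) - p))%C) c e =
  (atan (e / (x - p)) - atan (c / (x - p)),
   - (ln (e ^ 2 + (x - p) ^ 2) / 2 - ln (c ^ 2 + (x - p) ^ 2) / 2)).
Proof.
  intros Hx. assert (Hx' : x - p <> 0) by lra.
  unfold CInt. f_equal; apply is_RInt_unique.
  - replace e with (e - 0) at 2 by ring. replace c with (c - 0) at 2 by ring.
    apply is_RInt_ext with (2 := is_RInt_im_inv 0 (x - p) c e Hx').
    intros s _. unfold Cinv, Cminus, Cplus, Copp, RtoC, Re; simpl. f_equal; try ring; f_equal; ring.
  - replace e with (e - 0) at 2 by ring. replace c with (c - 0) at 2 by ring.
    apply is_RInt_ext with (2 := is_RInt_opp _ _ _ _ (is_RInt_re_inv 0 (x - p) c e Hx')).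
    intros s _. unfold Cinv, Cminus, Cplus, Copp, RtoC, Im, opp; simpl.
    unfold Rdiv. rewrite Ropp_mult_distr_l. f_equal; try ring; f_equal; ring.
Qed.

Lemma atan_swap (u v : R) : 0 < u -> 0 < v -> atan (u / v) + atan (v / u) = PI / 2.
Proof.
  intros Hu Hv. replace (v / u) with (/ (u / v)) by (field; lra).
  rewrite atan_inv; [lra|]. now apply Rdiv_lt_0_compat.
Qed.

(** Each side has an explicit antiderivative. The logarithms cancel at the corners, and the eight
    arctangents pair up by [atan_swap] into four right angles. *)
Lemma rectInt_inv (p a b c e : R) : a < p < b -> c < 0 < e ->
  rectInt (fun z => (/ (z - p))%C) a b c e = (2 * PI * Ci)%C.
Proof.
  intros Hp Hc. unfold rectInt. rewrite !CInt_inv_h, !CInt_inv_v by lra.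
  assert (A1 := atan_swap (b - p) e ltac:(lra) ltac:(lra)).
  assert (A2 := atan_swap (p - a) e ltac:(lra) ltac:(lra)).
  assert (A3 := atan_swap (b - p) (- c) ltac:(lra) ltac:(lra)).
  assert (A4 := atan_swap (p - a) (- c) ltac:(lra) ltac:(lra)).
  replace ((a - p) / e) with (- ((p - a) / e)) by (field; lra).
  replace (e / (a - p)) with (- (e / (p - a))) by (field; lra).
  replace ((a - p) / c) with ((p - a) / - c) by (field; lra).
  replace (c / (a - p)) with (- c / (p - a)) by (field; lra).
  replace ((b - p) / c) with (- ((b - p) / - c)) by (field; lra).
  replace (c / (b - p)) with (- (- c / (b - p))) by (field; lra).
  rewrite !atan_opp.
  unfold Cminus, Copp, Cplus, Cmult, Ci, RtoC; simpl fst; simpl snd.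
  rewrite (Rplus_comm (e ^ 2)), (Rplus_comm (c ^ 2)), (Rplus_comm (e ^ 2)), (Rplus_comm (c ^ 2)).
  simpl pow. f_equal; lra.
Qed.

Lemma re_minus (a b : C) : Re (a - b) = Re a - Re b.
Proof. reflexivity. Qed.
Lemma im_minus (a b : C) : Im (a - b) = Im a - Im b.
Proof. reflexivity. Qed.

(** The singularities to be met are [t] and the zeros of the sine, all real and treated as simple
    poles, so the residue is a limit. The value of [G] at [p] is ignored, and [r = 0] expresses a
    removable singularity. *)
Definition has_residue (G : C -> C) (p : R) (r : C) : Prop :=
  forall eps, 0 < eps -> exists del, 0 < del /\ forall z, z <> RtoC p -> Cmod (z - p) < del ->
    Cmod ((z - p) * G z - r) < eps.

(** By Cauchy's theorem the boundary integral shrinks to that over a small square around [p], where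
    $G$ is $o(1/r)$ on a contour of length $8r$. *)
Lemma rectInt_hole G a b c e (p : R) : a < p < b -> c < 0 < e ->
  (forall z, in_rect a b c e z -> z <> RtoC p -> cdiff G z) -> has_residue G p (RtoC 0) ->
  rectInt G a b c e = RtoC 0.
Proof.
  intros Hp Hc HG Hr.
  apply Cmod_eq_0, Rle_antisym; [|apply Cmod_ge_0].
  apply le_epsilon. intros eps He. rewrite Rplus_0_l.
  destruct (Hr (eps / 8)) as [del [Hd Hw]]; [lra|].
  (* The square of half-width [r] lies strictly inside the rectangle and within distance [del] of
     [p]. *)
  set (r := Rmin (del / 4) (Rmin (Rmin (p - a) (b - p)) (Rmin (- c) e)) / 2).
  assert (Hr0 : 0 < r).
  { unfold r. apply Rdiv_lt_0_compat; [|lra]. repeat apply Rmin_glb_lt; lra. }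
  assert (R1 : 2 * r <= del / 4 /\ 2 * r <= p - a /\ 2 * r <= b - p /\ 2 * r <= - c /\ 2 * r <= e).
  { unfold r. set (u := Rmin (p - a) (b - p)). set (v := Rmin (- c) e).
    assert (u <= p - a) by apply Rmin_l. assert (u <= b - p) by apply Rmin_r.
    assert (v <= - c) by apply Rmin_l. assert (v <= e) by apply Rmin_r.
    assert (Rmin u v <= u) by apply Rmin_l. assert (Rmin u v <= v) by apply Rmin_r.
    assert (Rmin (del / 4) (Rmin u v) <= del / 4) by apply Rmin_l.
    assert (Rmin (del / 4) (Rmin u v) <= Rmin u v) by apply Rmin_r. lra. }
  assert (HC : forall z, in_rect a b c e z -> Re z <> p \/ Im z <> 0 -> cdiff G z).
  { intros z Hz Hn. apply HG; [exact Hz|]. intros ->. simpl in Hn. destruct Hn; lra. }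
  assert (Z : forall a' b' c' e', a <= a' -> a' <= b' -> b' <= b -> c <= c' -> c' <= e' -> e' <= e ->
     (p < a' \/ b' < p \/ 0 < c' \/ e' < 0) -> rectInt G a' b' c' e' = RtoC 0).
  { intros a' b' c' e' ? ? ? ? ? ? Ho. apply goursat; try assumption.
    intros z [H6 H7]. apply HC; [unfold in_rect; lra|].
    destruct (Req_dec (Re z) p); [right; lra|left; assumption]. }
  assert (B : forall a' b' c' e', a <= a' -> b' <= b -> c <= c' -> e' <= e ->
     a' <> p -> b' <> p -> c' <> 0 -> e' <> 0 -> cont_bd G a' b' c' e').
  { intros a' b' c' e' ? ? ? ? ? ? ? ? z [H6 H7] Hz. apply cdiff_ccont, HC; [unfold in_rect; lra|].
    destruct Hz as [->|[->|[->| ->]]]; tauto. }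
  (* A slab on the left, a slab on the right, and the middle column cut into three: only the central
     square contains [p]. *)
  rewrite (rectInt_split_x G a (p - r) b c e), (rectInt_split_x G (p - r) (p + r) b c e),
    (rectInt_split_y G (p - r) (p + r) c (- r) e), (rectInt_split_y G (p - r) (p + r) (- r) r e);
    try (apply B; lra); try lra.
  rewrite (Z a (p - r) c e), (Z (p + r) b c e), (Z (p - r) (p + r) c (- r)), (Z (p - r) (p + r) r e)
    by lra.
  replace (_ + _)%C with (rectInt G (p - r) (p + r) (- r) r) by ring.
  replace eps with (2 * ((p + r - (p - r)) + (r - - r)) * (eps / 8 / r)) by (field; lra).
  apply rectInt_bound; try lra; [apply B; lra|].
  intros z [H6 H7] Hz.
  assert (Hrz : r <= Cmod (z - p)).
  { destruct Hz as [H|[H|H]].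
    - apply Rle_trans with (2 := re_le_Cmod _). rewrite re_minus, re_RtoC, H.
      rewrite Rabs_left; lra.
    - apply Rle_trans with (2 := re_le_Cmod _). rewrite re_minus, re_RtoC, H.
      rewrite Rabs_pos_eq; lra.
    - apply Rle_trans with (2 := im_le_Cmod _). rewrite im_minus, im_RtoC.
      destruct H as [-> | ->]; [rewrite Rabs_left|rewrite Rabs_pos_eq]; lra. }
  assert (Hzd : Cmod (z - p) < del).
  { eapply Rle_lt_trans; [apply Cmod_le_abs|].
    rewrite re_minus, re_RtoC, im_minus, im_RtoC.
    apply Rle_lt_trans with (r + r); [|lra]. apply Rplus_le_compat; apply Rabs_le; lra. }
  assert (Hnz : z <> RtoC p).
  { intros ->. replace (p - p)%C with (RtoC 0) in Hrz by ring. rewrite Cmod_0 in Hrz. lra. }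
  specialize (Hw z Hnz Hzd).
  replace ((z - p) * G z - 0)%C with ((z - p) * G z)%C in Hw by ring.
  rewrite Cmod_mult in Hw.
  apply Rmult_le_reg_l with r; [exact Hr0|].
  replace (r * (eps / 8 / r)) with (eps / 8) by (field; lra).
  left. eapply Rle_lt_trans; [|exact Hw]. apply Rmult_le_compat_r; [apply Cmod_ge_0|exact Hrz].
Qed.

Lemma isolated_in_list (l : list R) (p : R) :
  exists r, 0 < r /\ forall q, In q l -> q <> p -> r < Rabs (q - p).
Proof.
  induction l as [|q l [r [Hr H]]].
  - exists 1. split; [lra|]. intros q [].
  - destruct (Req_dec q p) as [->|n].
    + exists r. split; [exact Hr|]. intros q' [<-|Hq] Hn; [now elim Hn|auto].
    + assert (0 < Rabs (q - p)) by (apply Rabs_pos_lt; lra).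
      exists (Rmin r (Rabs (q - p) / 2)). split; [apply Rmin_glb_lt; lra|].
      intros q' [<-|Hq] Hn.
      * eapply Rle_lt_trans; [apply Rmin_r|lra].
      * eapply Rle_lt_trans; [apply Rmin_l|auto].
Qed.

Definition off (l : list R) (z : C) : Prop := forall p, In p l -> z <> RtoC p.

Lemma rectInt_removable G c e (l : list R) : c < 0 < e -> forall a b, a <= b ->
  ~ In a l -> ~ In b l ->
  (forall z, in_rect a b c e z -> off l z -> cdiff G z) ->
  (forall p, In p l -> a < p < b -> has_residue G p (RtoC 0)) ->
  rectInt G a b c e = RtoC 0.
Proof.
  intros Hc. induction l as [|p l IH]; intros a b Hab Ha Hb HG Hr.
  - apply goursat; [assumption|lra|]. intros z Hz. apply HG; [exact Hz|]. intros q [].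
  - simpl in Ha, Hb.
    assert (Out : forall a' b', a <= a' -> a' <= b' -> b' <= b -> ~ In a' l -> ~ In b' l ->
      (p < a' \/ b' < p) -> rectInt G a' b' c e = RtoC 0).
    { intros a' b' ? ? ? ? ? Ho. apply IH; try assumption.
      - intros z Hz Hoff. apply HG; [unfold in_rect in *; lra|].
        intros q [<-|Hq]; [|now apply Hoff]. intros ->. destruct Hz as [Hz _]. simpl in Hz. lra.
      - intros q Hq Hq2. apply Hr; [now right|lra]. }
    assert (Hpa : p <> a) by tauto. assert (Hpb' : p <> b) by tauto.
    destruct (Rlt_dec a p) as [Hap|Hap]; [|apply Out; tauto || lra].
    destruct (Rlt_dec p b) as [Hpb|Hpb]; [|apply Out; tauto || lra].
    (* Including [a] and [b] keeps the column strictly inside the rectangle; avoiding [l] keeps the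
       cuts off the other points. *)
    destruct (isolated_in_list (a :: b :: l) p) as [r [Hr0 Hiso]].
    assert (Hra : r < p - a).
    { assert (Hi := Hiso a (or_introl eq_refl) ltac:(lra)). rewrite Rabs_left in Hi; lra. }
    assert (Hrb : r < b - p).
    { assert (Hi := Hiso b (or_intror (or_introl eq_refl)) ltac:(lra)). rewrite Rabs_pos_eq in Hi; lra. }
    assert (Hin : forall q, In q l -> q <> p -> r < Rabs (q - p)).
    { intros q Hq. apply Hiso. right. now right. }
    assert (N1 : ~ In (p - r) l).
    { intros Hq. specialize (Hin _ Hq ltac:(lra)). rewrite Rabs_left in Hin; lra. }
    assert (N2 : ~ In (p + r) l).
    { intros Hq. specialize (Hin _ Hq ltac:(lra)). rewrite Rabs_pos_eq in Hin; lra. }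
    assert (B : forall a' b', a <= a' -> b' <= b -> ~ In a' (p :: l) -> ~ In b' (p :: l) ->
       cont_bd G a' b' c e).
    { intros a' b' ? ? Na Nb z [H6 H7] Hz. apply cdiff_ccont, HG; [unfold in_rect; lra|].
      intros q Hq ->. simpl in *. destruct Hz as [->|[->|Hz]]; [tauto|tauto|lra]. }
    assert (M1 : ~ In (p - r) (p :: l)) by (simpl; intros [E|E]; [lra|tauto]).
    assert (M2 : ~ In (p + r) (p :: l)) by (simpl; intros [E|E]; [lra|tauto]).
    rewrite (rectInt_split_x G a (p - r) b c e), (rectInt_split_x G (p - r) (p + r) b c e);
      try (apply B; simpl in *; tauto || lra); try lra.
    rewrite (Out a (p - r)), (Out (p + r) b); try tauto; try lra.
    rewrite (rectInt_hole G (p - r) (p + r) c e p); try lra; try ring.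
    + intros z Hz Hn. apply HG; [unfold in_rect in *; lra|].
      intros q [<-|Hq]; [exact Hn|]. intros ->. destruct (Req_dec q p) as [->|Hqp]; [tauto|].
      specialize (Hin q Hq Hqp). destruct Hz as [Hz _]. simpl in Hz.
      assert (Rabs (q - p) <= r) by (apply Rabs_le; lra). lra.
    + apply Hr; [now left|lra].
Qed.

Fixpoint csum {A : Type} (r : A -> C) (l : list A) : C :=
  match l with nil => RtoC 0 | p :: l' => (r p + csum r l')%C end.

Lemma cdiff_simple_pole (r : C) (p : R) z : z <> RtoC p -> cdiff (fun w => (r / (w - p))%C) z.
Proof.
  intros H. apply cdiff_div.
  - now apply Cminus_eq_contra.
  - apply cdiff_const.
  - apply cdiff_minus; [apply cdiff_id|apply cdiff_const].
Qed.

Lemma has_residue_minus G H p r s :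
  has_residue G p r -> has_residue H p s -> has_residue (fun z => (G z - H z)%C) p (r - s)%C.
Proof.
  intros HG HH eps He. destruct (HG (eps / 2)) as [d1 [H1 W1]]; [lra|].
  destruct (HH (eps / 2)) as [d2 [H2 W2]]; [lra|].
  exists (Rmin d1 d2). split; [now apply Rmin_glb_lt|]. intros z Hz Hm.
  specialize (W1 z Hz (Rlt_le_trans _ _ _ Hm (Rmin_l _ _))).
  specialize (W2 z Hz (Rlt_le_trans _ _ _ Hm (Rmin_r _ _))).
  replace ((z - p) * (G z - H z) - (r - s))%C
    with (((z - p) * G z - r) + - ((z - p) * H z - s))%C by ring.
  eapply Rle_lt_trans; [apply Cmod_triangle|]. rewrite Cmod_opp. lra.
Qed.

Lemma has_residue_cont (H : C -> C) (p : R) :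
  ccontC H (RtoC p) -> has_residue (fun z => (H z / (z - p))%C) p (H (RtoC p)).
Proof.
  intros HH eps He. destruct (proj1 (ccont_eps H p) HH eps He) as [del [Hd Hw]].
  exists del. split; [exact Hd|]. intros z Hz Hm.
  replace ((z - p) * (H z / (z - p)))%C with (H z).
  - now apply Hw.
  - field. now apply Cminus_eq_contra.
Qed.

Lemma has_residue_regular (H : C -> C) (p : R) :
  ccontC H (RtoC p) -> has_residue H p (RtoC 0).
Proof.
  intros HH eps He.
  assert (HK : ccontC (fun z => ((z - p) * H z)%C) (RtoC p)).
  { apply ccont_mult; [|exact HH]. apply ccont_minus; [apply continuous_id|apply ccont_const]. }
  destruct (proj1 (ccont_eps _ p) HK eps He) as [del [Hd Hw]].
  exists del. split; [exact Hd|]. intros z Hz Hm. specialize (Hw z Hm).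
  replace ((p - p) * H (RtoC p))%C with (RtoC 0) in Hw by ring. exact Hw.
Qed.

(** Principal parts are subtracted one pole at a time. The list [l0] collects the points already
    made removable, and generalizing over it and over [G] makes the induction go through. *)
Lemma rectInt_residues G c e a b (r : R -> C) (l l0 : list R) : c < 0 < e -> a <= b ->
  NoDup (l ++ l0) -> (forall p, In p (l ++ l0) -> a < p < b) ->
  (forall z, in_rect a b c e z -> off (l ++ l0) z -> cdiff G z) ->
  (forall p, In p l0 -> has_residue G p (RtoC 0)) ->
  (forall p, In p l -> has_residue G p (r p)) ->
  rectInt G a b c e = (2 * PI * Ci * csum r l)%C.
Proof.
  intros Hc Hab. revert G l0. induction l as [|p l IH]; intros G l0 Hnd Hin HG H0 Hr.
  - simpl in *. rewrite (rectInt_removable G c e l0); try assumption.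
    + ring.
    + intros H. apply Hin in H. lra.
    + intros H. apply Hin in H. lra.
    + intros q Hq _. now apply H0.
  - set (P := fun z => (r p / (z - p))%C).
    set (G' := fun z => (G z - P z)%C).
    assert (Hp : a < p < b) by (apply Hin; now left).
    simpl in Hnd. inversion Hnd as [|? ? Hnp Hnd']; subst.
    assert (Hne : forall q, In q (l ++ l0) -> has_residue P q (RtoC 0)).
    { intros q Hq. apply has_residue_regular, cdiff_ccont, cdiff_simple_pole.
      intros E. apply RtoC_inj in E. subst. tauto. }
    assert (Hsub : forall q, In q (l ++ l0) <-> In q l \/ In q l0) by (intros; apply in_app_iff).
    assert (E : rectInt G' a b c e = (2 * PI * Ci * csum r l)%C).
    (* The pole [p] passes from [l] to [l0]: subtracting [r p / (z - p)] leaves residue zero there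
       and changes no other residue. *)
    { apply (IH G' (p :: l0)).
      - apply NoDup_Add with (a := p) (l := l ++ l0); [apply Add_app|split; assumption].
      - intros q Hq. apply Hin. simpl. apply in_app_iff in Hq. simpl in Hq. rewrite Hsub. tauto.
      - intros z Hz Ho. apply cdiff_minus.
        + apply HG; [exact Hz|]. intros q Hq. apply Ho. simpl in Hq. rewrite Hsub in Hq.
          apply in_app_iff. simpl. tauto.
        + apply cdiff_simple_pole. apply Ho, in_app_iff. right. now left.
      - intros q [<-|Hq].
        + replace (RtoC 0) with (r p - r p)%C by ring.
          apply has_residue_minus; [apply Hr; now left|].
          apply (has_residue_cont (fun _ => r p) p), ccont_const.
        + replace (RtoC 0) with (RtoC 0 - RtoC 0)%C by ring.
          apply has_residue_minus; [now apply H0|]. apply Hne, Hsub. now right.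
      - intros q Hq. replace (r q) with (r q - RtoC 0)%C by ring.
        apply has_residue_minus; [apply Hr; now right|]. apply Hne, Hsub. now left. }
    assert (BG : forall z, in_rect a b c e z -> (Re z = a \/ Re z = b \/ Im z = c \/ Im z = e) ->
       forall q, In q ((p :: l) ++ l0) -> z <> RtoC q).
    { intros z _ Hz q Hq ->. apply Hin in Hq. simpl in Hz. lra. }
    assert (CP : cont_bd (fun z => (/ (z - p))%C) a b c e).
    { intros z Hz Hb. apply ccont_inv.
      - apply ccont_minus; [apply continuous_id|apply ccont_const].
      - apply Cminus_eq_contra. apply (BG z Hz Hb). now left. }
    assert (CP' : cont_bd (fun z => (r p * / (z - p))%C) a b c e).
    { intros z Hz Hb. apply ccont_mult; [apply ccont_const|]. now apply CP. }
    assert (CG : cont_bd G a b c e).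
    { intros z Hz Hb. apply cdiff_ccont, HG; [exact Hz|]. intros q Hq. now apply (BG z Hz Hb). }
    rewrite (rectInt_ext G (fun z => (G' z + r p * / (z - p))%C)); try lra.
    2: { intros; unfold G', P, Cdiv; ring. }
    rewrite rectInt_plus; try lra; try assumption.
    2: { intros z Hz Hb. apply ccont_minus; [now apply CG|now apply CP']. }
    rewrite rectInt_scal; try lra; try assumption.
    rewrite rectInt_inv by lra. rewrite E. simpl. ring.
Qed.

(** * The complex exponential *)

Lemma Cexp_plus (u v : C) : Cexp (u + v) = (Cexp u * Cexp v)%C.
Proof.
  unfold Cexp. rewrite re_plus, im_plus, exp_plus, cos_plus, sin_plus.
  unfold Cmult; simpl. f_equal; ring.
Qed.

Lemma Cexp_0 : Cexp 0 = RtoC 1.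
Proof. unfold Cexp. simpl. rewrite exp_0, cos_0, sin_0. unfold RtoC. f_equal; ring. Qed.

Lemma Cmod_Cexp (z : C) : Cmod (Cexp z) = exp (Re z).
Proof.
  unfold Cmod, Cexp. simpl fst; simpl snd.
  replace (_ + _) with (exp (Re z) * exp (Re z)).
  - apply sqrt_square. left. apply exp_pos.
  - generalize (sin2_cos2 (Im z)). unfold Rsqr. intros H. simpl. nra.
Qed.

Lemma Cexp_nz (z : C) : Cexp z <> RtoC 0.
Proof. apply Cmod_gt_0. rewrite Cmod_Cexp. apply exp_pos. Qed.

Lemma Cexp_opp (z : C) : Cexp (- z) = (/ Cexp z)%C.
Proof.
  assert (H : (Cexp z * Cexp (- z))%C = RtoC 1).
  { rewrite <- Cexp_plus. replace (z + - z)%C with (RtoC 0) by ring. apply Cexp_0. }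
  assert (Hn := Cexp_nz z).
  replace (Cexp (- z)) with (/ Cexp z * (Cexp z * Cexp (- z)))%C by (field; exact Hn).
  rewrite H. ring.
Qed.

Lemma Cexp_RtoC (x : R) : Cexp x = RtoC (exp x).
Proof. unfold Cexp, RtoC. simpl. rewrite cos_0, sin_0. f_equal; ring. Qed.

Lemma derivable_pt_lim_small (f : R -> R) (l : R) : derivable_pt_lim f 0 l ->
  forall eta, 0 < eta -> exists del, 0 < del /\
    forall x, Rabs x < del -> Rabs (f x - f 0 - l * x) <= eta * Rabs x.
Proof.
  intros H eta He. destruct (H eta He) as [del Hw].
  exists del. split; [apply cond_pos|]. intros x Hx.
  destruct (Req_dec x 0) as [->|n].
  - rewrite Rabs_R0. replace (f 0 - f 0 - l * 0) with 0 by ring. rewrite Rabs_R0. lra.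
  - specialize (Hw x n Hx). rewrite Rplus_0_l in Hw.
    replace (f x - f 0 - l * x) with (((f x - f 0) / x - l) * x) by (field; exact n).
    rewrite Rabs_mult. apply Rmult_le_compat_r; [apply Rabs_pos|lra].
Qed.

Lemma Cexp_near_0 eps : 0 < eps -> exists del, 0 < del /\ forall u, Cmod u < del ->
  Cmod (Cexp u - 1 - u) <= eps * Cmod u.
Proof.
  (* With first-order errors at most [eta * r] and [r < eta <= 1], the real part costs at most
     [4 * eta * r] and the imaginary part [5 * eta * r]; a sixteenth of [eps] covers both. *)
  intros He. set (eta := Rmin (eps / 16) 1).
  assert (Heta : 0 < eta) by (unfold eta; apply Rmin_glb_lt; lra).
  assert (Heta1 : eta <= 1) by apply Rmin_r.
  assert (Heta2 : eta <= eps / 16) by apply Rmin_l.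
  clearbody eta.
  destruct (derivable_pt_lim_small exp 1 derivable_pt_lim_exp_0 eta Heta) as [d1 [D1 W1]].
  destruct (derivable_pt_lim_small cos 0) with (eta := eta) as [d2 [D2 W2]]; auto.
  { replace 0 with (- sin 0) at 2 by (rewrite sin_0; ring). apply derivable_pt_lim_cos. }
  destruct (derivable_pt_lim_small sin 1 derivable_pt_lim_sin_0 eta Heta) as [d3 [D3 W3]].
  rewrite exp_0 in W1. rewrite cos_0 in W2. rewrite sin_0 in W3.
  exists (Rmin (Rmin d1 d2) (Rmin d3 eta)).
  split; [repeat apply Rmin_glb_lt; assumption|].
  intros u Hu. set (r := Cmod u) in *.
  assert (Hr1 : r < d1 /\ r < d2 /\ r < d3 /\ r < eta).
  { generalize (Rmin_l (Rmin d1 d2) (Rmin d3 eta)) (Rmin_r (Rmin d1 d2) (Rmin d3 eta))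
      (Rmin_l d1 d2) (Rmin_r d1 d2) (Rmin_l d3 eta) (Rmin_r d3 eta). lra. }
  assert (Hx := re_le_Cmod u). assert (Hy := im_le_Cmod u). fold r in Hx, Hy.
  set (x := Re u) in *. set (y := Im u) in *.
  specialize (W1 x ltac:(lra)). specialize (W2 y ltac:(lra)). specialize (W3 y ltac:(lra)).
  assert (Hr : 0 <= r) by apply Cmod_ge_0.
  set (e1 := exp x - 1 - 1 * x) in *. set (e2 := cos y - 1 - 0 * y) in *.
  set (e3 := sin y - 0 - 1 * y) in *.
  assert (B1 : Rabs e1 <= eta * r) by (eapply Rle_trans; [exact W1|apply Rmult_le_compat_l; lra]).
  assert (B2 : Rabs e2 <= eta * r) by (eapply Rle_trans; [exact W2|apply Rmult_le_compat_l; lra]).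
  assert (B3 : Rabs e3 <= eta * r) by (eapply Rle_trans; [exact W3|apply Rmult_le_compat_l; lra]).
  assert (Er : eta * r <= r) by nra.
  eapply Rle_trans; [apply Cmod_le_abs|].
  rewrite !re_minus, !im_minus, re_RtoC, im_RtoC. fold x y.
  unfold Cexp. fold x y. unfold Re, Im; simpl fst; simpl snd.
  replace (exp x * cos y - 1 - x) with (e2 + (x + e1) * e2 + e1) by (unfold e1, e2; ring).
  replace (exp x * sin y - 0 - y) with (e3 + (x + e1) * (y + e3)) by (unfold e1, e3; ring).
  assert (T1 : Rabs (x + e1) <= 2 * r) by (eapply Rle_trans; [apply Rabs_triang|lra]).
  assert (T2 : Rabs (y + e3) <= 2 * r) by (eapply Rle_trans; [apply Rabs_triang|lra]).
  assert (U1 : Rabs ((x + e1) * e2) <= 2 * r * (eta * r)).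
  { rewrite Rabs_mult. apply Rmult_le_compat; auto using Rabs_pos. }
  assert (U2 : Rabs ((x + e1) * (y + e3)) <= 2 * r * (2 * r)).
  { rewrite Rabs_mult. apply Rmult_le_compat; auto using Rabs_pos. }
  assert (V1 : Rabs (e2 + (x + e1) * e2 + e1) <= Rabs e2 + Rabs ((x + e1) * e2) + Rabs e1).
  { eapply Rle_trans; [apply Rabs_triang|]. apply Rplus_le_compat_r, Rabs_triang. }
  assert (V2 := Rabs_triang e3 ((x + e1) * (y + e3))).
  assert (2 * r * (eta * r) <= 2 * (eta * r)) by nra.
  assert (r * r <= eta * r) by nra.
  assert (eta * r <= eps / 16 * r) by nra. assert (0 <= eps * r) by nra. lra.
Qed.

Lemma cderiv_Cexp (z : C) : cderiv Cexp z (Cexp z).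
Proof.
  apply cderiv_quot. intros eps He.
  assert (Hp : 0 < Cmod (Cexp z)) by (apply Cmod_gt_0, Cexp_nz).
  destruct (Cexp_near_0 (eps / Cmod (Cexp z))) as [del [Hd Hw]]; [now apply Rdiv_lt_0_compat|].
  exists del. split; [exact Hd|]. intros w Hm. specialize (Hw _ Hm).
  replace (Cexp w) with (Cexp z * Cexp (w - z))%C by (rewrite <- Cexp_plus; f_equal; ring).
  replace (Cexp z * Cexp (w - z) - Cexp z - Cexp z * (w - z))%C
    with (Cexp z * (Cexp (w - z) - 1 - (w - z)))%C by ring.
  rewrite Cmod_mult. replace eps with (Cmod (Cexp z) * (eps / Cmod (Cexp z))) by (field; lra).
  rewrite Rmult_assoc. apply Rmult_le_compat_l; [lra|exact Hw].
Qed.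

(** * The principal logarithm *)

(** The plane cut along the closed negative real axis, where the principal logarithm is
    holomorphic. *)
Definition slit (z : C) : Prop := 0 < Re z \/ Im z <> 0.

Lemma slit_nz z : slit z -> z <> RtoC 0.
Proof. intros [H|H] ->; simpl in H; lra. Qed.

Lemma Carg_right z : 0 < Re z -> Carg z = atan (Im z / Re z).
Proof. intros H. unfold Carg. destruct Rlt_dec; [reflexivity|lra]. Qed.

(** With [Carg_right] and [Carg_down] this covers the cut plane by three open half-planes, on each
    of which the argument is a single smooth formula free of branch tests. *)
Lemma Carg_up z : 0 < Im z -> Carg z = PI / 2 - atan (Re z / Im z).
Proof.
  intros H. unfold Carg. destruct Rlt_dec as [Hx|Hx]; [|destruct Rlt_dec as [Hx'|Hx']].
  - replace (Im z / Re z) with (/ (Re z / Im z)) by (field; lra).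
    apply atan_inv. now apply Rdiv_lt_0_compat.
  - destruct Rle_dec; [|lra].
    replace (Im z / Re z) with (- / (- Re z / Im z)) by (field; lra).
    rewrite atan_opp, atan_inv by (apply Rdiv_lt_0_compat; lra).
    replace (- Re z / Im z) with (- (Re z / Im z)) by (field; lra). rewrite atan_opp. lra.
  - assert (E : Re z = 0) by lra. rewrite E. destruct Rlt_dec; [|lra].
    replace (0 / Im z) with 0 by (field; lra). rewrite atan_0. lra.
Qed.

Lemma Carg_down z : Im z < 0 -> Carg z = - (PI / 2) - atan (Re z / Im z).
Proof.
  intros H. unfold Carg. destruct Rlt_dec as [Hx|Hx]; [|destruct Rlt_dec as [Hx'|Hx']].
  - replace (Im z / Re z) with (- / (Re z / - Im z)) by (field; lra).
    rewrite atan_opp, atan_inv by (apply Rdiv_lt_0_compat; lra).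
    replace (Re z / - Im z) with (- (Re z / Im z)) by (field; lra). rewrite atan_opp. lra.
  - destruct Rle_dec; [lra|].
    replace (Im z / Re z) with (/ (- Re z / - Im z)) by (field; lra).
    rewrite atan_inv by (apply Rdiv_lt_0_compat; lra).
    replace (- Re z / - Im z) with (Re z / Im z) by (field; lra). lra.
  - assert (E : Re z = 0) by lra. rewrite E. destruct Rlt_dec; [lra|]. destruct Rlt_dec; [|lra].
    replace (0 / Im z) with 0 by (field; lra). rewrite atan_0. lra.
Qed.

Lemma Carg_slit_bound z : slit z -> - PI < Carg z < PI.
Proof.
  intros H. destruct (Rlt_dec 0 (Im z)) as [H1|H1]; [|destruct (Rlt_dec (Im z) 0) as [H2|H2]].
  - rewrite Carg_up by exact H1. generalize (atan_bound (Re z / Im z)). lra.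
  - rewrite Carg_down by exact H2. generalize (atan_bound (Re z / Im z)). lra.
  - destruct H as [H|H]; [|lra].
    rewrite Carg_right by exact H. generalize (atan_bound (Im z / Re z)). generalize PI_RGT_0. lra.
Qed.

Lemma Cmod_sqrt_factor (x y : R) : 0 < x -> sqrt (x ^ 2 + y ^ 2) = x * sqrt (1 + Rsqr (y / x)).
Proof.
  intros Hx. replace (x ^ 2 + y ^ 2) with (x ^ 2 * (1 + Rsqr (y / x))) by (unfold Rsqr; field; lra).
  rewrite sqrt_mult_alt by (apply pow2_ge_0). now rewrite sqrt_pow2 by lra.
Qed.

Lemma sqrt_1_sqr_pos t : 0 < sqrt (1 + Rsqr t).
Proof. apply sqrt_lt_R0. generalize (Rle_0_sqr t). lra. Qed.

Lemma Cexp_Clog z : slit z -> Cexp (Clog z) = z.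
Proof.
  intros H. assert (Hz := proj1 (Cmod_gt_0 z) (slit_nz z H)).
  change (Cexp (Clog z)) with ((exp (ln (Cmod z)) * cos (Carg z), exp (ln (Cmod z)) * sin (Carg z)) : C).
  rewrite exp_ln by exact Hz. destruct z as [x y]. unfold Cmod. simpl fst; simpl snd.
  destruct (Rlt_dec 0 y) as [H1|H1]; [|destruct (Rlt_dec y 0) as [H2|H2]].
  - rewrite Carg_up by exact H1. unfold Re, Im; simpl fst; simpl snd.
    rewrite cos_shift, sin_shift, cos_atan, sin_atan.
    rewrite (Rplus_comm (x ^ 2)), Cmod_sqrt_factor by exact H1.
    generalize (sqrt_1_sqr_pos (x / y)). intros Hs. f_equal; field; lra.
  - rewrite Carg_down by exact H2. unfold Re, Im; simpl fst; simpl snd.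
    replace (- (PI / 2) - atan (x / y)) with (- (PI / 2 - atan (x / - y))).
    2: { replace (x / - y) with (- (x / y)) by (field; lra). rewrite atan_opp. ring. }
    rewrite cos_neg, sin_neg, cos_shift, sin_shift, cos_atan, sin_atan.
    replace (x ^ 2 + y ^ 2) with ((- y) ^ 2 + x ^ 2) by ring. rewrite Cmod_sqrt_factor by lra.
    generalize (sqrt_1_sqr_pos (x / - y)). intros Hs. f_equal; field; lra.
  - destruct H as [H|H]; [|simpl in H; lra]. rewrite Carg_right by exact H.
    simpl in H. unfold Re, Im; simpl fst; simpl snd.
    rewrite cos_atan, sin_atan. rewrite Cmod_sqrt_factor by exact H.
    generalize (sqrt_1_sqr_pos (y / x)). intros Hs. f_equal; field; lra.
Qed.

Lemma continuous_re (z : C) : continuous (T := C_UniformSpace) (U := R_UniformSpace) (fun w => Re w) z.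
Proof. apply (ccont_re (U := C_UniformSpace) (fun w : C => w)), continuous_id. Qed.
Lemma continuous_im (z : C) : continuous (T := C_UniformSpace) (U := R_UniformSpace) (fun w => Im w) z.
Proof. apply (ccont_im (U := C_UniformSpace) (fun w : C => w)), continuous_id. Qed.

Lemma continuous_quot {U : UniformSpace} (f g : U -> R) x :
  continuous f x -> continuous g x -> g x <> 0 -> continuous (fun t => f t / g t) x.
Proof.
  intros Hf Hg Hn. apply (continuous_mult (K := R_AbsRing)); [exact Hf|].
  apply (continuous_comp g Rinv); [exact Hg|now apply continuous_Rinv].
Qed.

Lemma continuous_Cmod (z : C) : continuous (T := C_UniformSpace) (U := R_UniformSpace) Cmod z.
Proof.
  apply (continuous_comp (fun w : C_UniformSpace => (Re w) ^ 2 + (Im w) ^ 2) sqrt).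
  - apply (continuous_plus (K := R_AbsRing) (V := R_NormedModule)).
    + apply continuous_ext with (f := fun w => Re w * Re w); [intros; toR; simpl; ring|].
      apply (continuous_mult (K := R_AbsRing)); apply continuous_re.
    + apply continuous_ext with (f := fun w => Im w * Im w); [intros; toR; simpl; ring|].
      apply (continuous_mult (K := R_AbsRing)); apply continuous_im.
  - apply continuous_sqrt.
Qed.

Lemma continuous_atan x : continuous atan x.
Proof. apply (ex_derive_continuous (V := R_NormedModule)). auto_derive. trivial. Qed.

Lemma re_near (z w : C) : Cmod (w - z) < Rabs (Re z) -> 0 < Re z * Re w.
Proof.
  intros H. assert (H1 := re_le_Cmod (w - z)). rewrite re_minus in H1.
  unfold Rabs in *. repeat destruct Rcase_abs; nra.
Qed.
Lemma im_near (z w : C) : Cmod (w - z) < Rabs (Im z) -> 0 < Im z * Im w.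
Proof.
  intros H. assert (H1 := im_le_Cmod (w - z)). rewrite im_minus in H1.
  unfold Rabs in *. repeat destruct Rcase_abs; nra.
Qed.

Lemma slit_near z : slit z -> exists del, 0 < del /\ forall w, Cmod (w - z) < del -> slit w.
Proof.
  intros [H|H].
  - exists (Rabs (Re z)). split; [apply Rabs_pos_lt; lra|]. intros w Hm.
    apply re_near in Hm. left. nra.
  - exists (Rabs (Im z)). split; [apply Rabs_pos_lt; lra|]. intros w Hm.
    apply im_near in Hm. right. nra.
Qed.

Lemma ccont_Clog z : slit z -> ccontC Clog z.
Proof.
  intros H.
  assert (L : continuous (T := C_UniformSpace) (U := R_UniformSpace) (fun w => ln (Cmod w)) z).
  { apply (continuous_comp Cmod ln); [apply continuous_Cmod|]. apply continuous_ln.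
    apply Cmod_gt_0, slit_nz, H. }
  destruct (Rlt_dec 0 (Re z)) as [H0|H0].
  - apply ccont_ext_loc with (f := fun w => (ln (Cmod w), atan (Im w / Re w))) (del := Rabs (Re z)).
    + apply Rabs_pos_lt; lra.
    + intros w Hm. apply re_near in Hm. unfold Clog. rewrite Carg_right; [reflexivity|nra].
    + apply ccont_pair; [exact L|]. apply (continuous_comp _ atan); [|apply continuous_atan].
      apply continuous_quot; [apply continuous_im|apply continuous_re|lra].
  - destruct H as [H|H]; [lra|].
    assert (A : continuous (T := C_UniformSpace) (U := R_UniformSpace) (fun w => atan (Re w / Im w)) z).
    { apply (continuous_comp _ atan); [|apply continuous_atan].
      apply continuous_quot; [apply continuous_re|apply continuous_im|lra]. }
    destruct (Rlt_dec 0 (Im z)) as [H1|H1].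
    + apply ccont_ext_loc with (f := fun w => (ln (Cmod w), PI / 2 - atan (Re w / Im w)))
        (del := Rabs (Im z)).
      * apply Rabs_pos_lt; lra.
      * intros w Hm. apply im_near in Hm. unfold Clog. rewrite Carg_up; [reflexivity|nra].
      * apply ccont_pair; [exact L|].
        apply (continuous_minus (K := R_AbsRing) (V := R_NormedModule)); [apply continuous_const|exact A].
    + apply ccont_ext_loc with (f := fun w => (ln (Cmod w), - (PI / 2) - atan (Re w / Im w)))
        (del := Rabs (Im z)).
      * apply Rabs_pos_lt; lra.
      * intros w Hm. apply im_near in Hm. unfold Clog. rewrite Carg_down; [reflexivity|nra].
      * apply ccont_pair; [exact L|].
        apply (continuous_minus (K := R_AbsRing) (V := R_NormedModule)); [apply continuous_const|exact A].
Qed.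

(** Inverse function rule: the factor [phi] of [Cexp] at [Clog z] satisfies
    [w - z = phi (Clog w) * (Clog w - Clog z)]. Continuity of [Clog] allows dividing by it near [z],
    and no Cauchy-Riemann computation arises. *)
Lemma cderiv_Clog z : slit z -> cderiv Clog z (/ z)%C.
Proof.
  intros H. destruct (cderiv_Cexp (Clog z)) as [phi [Hc [E0 E]]].
  rewrite (Cexp_Clog z H) in E0, E.
  assert (Hn : phi (Clog z) <> RtoC 0) by (rewrite E0; now apply slit_nz).
  assert (C1 : ccontC (fun w => (/ phi (Clog w))%C) z).
  { apply ccont_inv; [|exact Hn]. apply (ccont_comp Clog phi); [now apply ccont_Clog|exact Hc]. }
  assert (C2 : ccontC (fun w => phi (Clog w)) z).
  { apply (ccont_comp Clog phi); [now apply ccont_Clog|exact Hc]. }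
  destruct (slit_near z H) as [d1 [D1 W1]].
  destruct (proj1 (ccont_eps _ z) C2 (Cmod (phi (Clog z))) (proj1 (Cmod_gt_0 _) Hn)) as [d2 [D2 W2]].
  apply cderiv_ext_loc with (f := fun w => (Clog z + / phi (Clog w) * (w - z))%C) (del := Rmin d1 d2).
  - now apply Rmin_glb_lt.
  - intros w Hm.
    assert (Sw : slit w) by (apply W1; eapply Rlt_le_trans; [exact Hm|apply Rmin_l]).
    assert (Nw : phi (Clog w) <> RtoC 0).
    { intros E1. specialize (W2 w (Rlt_le_trans _ _ _ Hm (Rmin_r _ _))). rewrite E1 in W2.
      replace (0 - phi (Clog z))%C with (- phi (Clog z))%C in W2 by ring.
      rewrite Cmod_opp in W2. lra. }
    specialize (E (Clog w)). rewrite (Cexp_Clog w Sw) in E.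
    replace (w - z)%C with (phi (Clog w) * (Clog w - Clog z))%C by (transitivity ((z + phi (Clog w) *
      (Clog w - Clog z)) - z)%C; [ring|now rewrite <- E]).
    field. exact Nw.
  - exists (fun w => (/ phi (Clog w))%C). split; [exact C1|]. split; [now rewrite E0|].
    intros w. ring.
Qed.

(** * The complex sine *)

(** Given in coordinates so that the modulus and the zeros can be read off; the exponential form
    serves for the derivative. *)
Definition csin (z : C) : C := (sin (Re z) * cosh (Im z), cos (Re z) * sinh (Im z)).
Definition ccos (z : C) : C := (cos (Re z) * cosh (Im z), - sin (Re z) * sinh (Im z)).

Lemma csin_Cexp z : csin z = ((Cexp (Ci * z) - Cexp (- Ci * z)) * - (Ci / 2))%C.
Proof.
  destruct z as [x y]. unfold csin, Cexp, cosh, sinh.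
  replace (Ci / 2)%C with ((0, 1 / 2) : C) by
    (unfold Cdiv, Cinv, Cmult, Ci, RtoC; simpl; f_equal; field).
  replace (Re (Ci * (x, y))) with (- y) by (simpl; ring).
  replace (Im (Ci * (x, y))) with x by (simpl; ring).
  replace (Re (- Ci * (x, y))) with y by (simpl; ring).
  replace (Im (- Ci * (x, y))) with (- x) by (simpl; ring).
  rewrite cos_neg, sin_neg.
  unfold Cminus, Cplus, Copp, Cmult, Re, Im; simpl. f_equal; field.
Qed.

Lemma ccos_Cexp z : ccos z = ((Cexp (Ci * z) + Cexp (- Ci * z)) * / 2)%C.
Proof.
  destruct z as [x y]. unfold ccos, Cexp, cosh, sinh.
  replace (/ 2)%C with ((1 / 2, 0) : C) by
    (unfold Cdiv, Cinv, Cmult, Ci, RtoC; simpl; f_equal; field).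
  replace (Re (Ci * (x, y))) with (- y) by (simpl; ring).
  replace (Im (Ci * (x, y))) with x by (simpl; ring).
  replace (Re (- Ci * (x, y))) with y by (simpl; ring).
  replace (Im (- Ci * (x, y))) with (- x) by (simpl; ring).
  rewrite cos_neg, sin_neg.
  unfold Cminus, Cplus, Copp, Cmult, Re, Im; simpl. f_equal; field.
Qed.

Lemma cderiv_scal (k z : C) : cderiv (fun w => (k * w)%C) z k.
Proof.
  exists (fun _ => k). split; [apply ccont_const|split; [reflexivity|intros; ring]].
Qed.

Lemma cderiv_csin z : cderiv csin z (ccos z).
Proof.
  apply cderiv_ext_loc with (del := 1)
    (f := fun w => ((Cexp (Ci * w) + (- (1)) * Cexp (- Ci * w)) * - (Ci / 2))%C).
  - lra.
  - intros w _. rewrite csin_Cexp. ring.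
  - assert (D : forall k : C, cderiv (fun w => Cexp (k * w)) z (Cexp (k * z) * k)%C).
    { intros k. apply (cderiv_comp (fun w => (k * w)%C) Cexp); [apply cderiv_scal|apply cderiv_Cexp]. }
    assert (K : ccos z = ((Cexp (Ci * z) * Ci + (0 * Cexp (- Ci * z)
       + (- (1)) * (Cexp (- Ci * z) * - Ci))) * - (Ci / 2)
       + (Cexp (Ci * z) + (- (1)) * Cexp (- Ci * z)) * 0)%C).
    { rewrite ccos_Cexp.
      replace (- (Ci / 2))%C with (/ 2 * / Ci)%C by (rewrite Ci_inv; unfold Cdiv; ring).
      field. apply Ci_nz. }
    rewrite K.
    apply (cderiv_mult (fun w => Cexp (Ci * w) + - (1) * Cexp (- Ci * w))%C (fun _ => (- (Ci / 2))%C));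
      [|apply cderiv_const].
    apply (cderiv_plus (fun w => Cexp (Ci * w)) (fun w => - (1) * Cexp (- Ci * w))%C); [apply D|].
    apply (cderiv_mult (fun _ => (- (1))%C) (fun w => Cexp (- Ci * w))); [apply cderiv_const|apply D].
Qed.

Lemma cosh2_sinh2 y : cosh y * cosh y = 1 + sinh y * sinh y.
Proof.
  unfold cosh, sinh. assert (E : exp y * exp (- y) = 1).
  { rewrite <- exp_plus, Rplus_opp_r. apply exp_0. }
  nra.
Qed.

Lemma Cmod_csin z : Cmod (csin z) = sqrt (sin (Re z) ^ 2 + sinh (Im z) ^ 2).
Proof.
  unfold Cmod, csin. simpl fst; simpl snd. f_equal.
  assert (H := cosh2_sinh2 (Im z)). assert (H2 := sin2_cos2 (Re z)). unfold Rsqr in H2.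
  simpl. nra.
Qed.

Lemma sinh_inj_0 y : sinh y = 0 -> y = 0.
Proof.
  unfold sinh. intros H. assert (E : exp y = exp (- y)) by lra.
  apply exp_inv in E. lra.
Qed.

Lemma csin_zero z : csin z = RtoC 0 -> Im z = 0 /\ sin (Re z) = 0.
Proof.
  intros H. assert (E : Cmod (csin z) = 0) by (rewrite H; apply Cmod_0).
  rewrite Cmod_csin in E. apply sqrt_eq_0 in E.
  2: { generalize (pow2_ge_0 (sin (Re z))) (pow2_ge_0 (sinh (Im z))). lra. }
  assert (E1 : sinh (Im z) ^ 2 = 0).
  { generalize (pow2_ge_0 (sin (Re z))) (pow2_ge_0 (sinh (Im z))). lra. }
  assert (E2 : sin (Re z) ^ 2 = 0) by lra.
  split; [apply sinh_inj_0|]; nra.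
Qed.

(** This bound yields the exponentially small factor on the horizontal sides; [Cmod_csin_sin] serves
    on the vertical sides, placed where the real sine has modulus one. *)
Lemma Cmod_csin_sinh z : Rabs (sinh (Im z)) <= Cmod (csin z).
Proof.
  rewrite Cmod_csin, <- sqrt_Rsqr_abs. apply sqrt_le_1_alt. unfold Rsqr.
  generalize (pow2_ge_0 (sin (Re z))). simpl. lra.
Qed.

Lemma Cmod_csin_sin z : Rabs (sin (Re z)) <= Cmod (csin z).
Proof.
  rewrite Cmod_csin, <- sqrt_Rsqr_abs. apply sqrt_le_1_alt. unfold Rsqr.
  generalize (pow2_ge_0 (sinh (Im z))). simpl. lra.
Qed.

Lemma csin_RtoC (x : R) : csin x = RtoC (sin x).
Proof. unfold csin, RtoC. simpl. rewrite cosh_0, sinh_0. f_equal; ring. Qed.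
Lemma ccos_RtoC (x : R) : ccos x = RtoC (cos x).
Proof. unfold ccos, RtoC. simpl. rewrite cosh_0, sinh_0. f_equal; ring. Qed.

(** * Numerical bounds for pi and the function sinc *)

Lemma PI_bounds : 3.1 < PI < 3.2.
Proof.
  generalize (PI_2_3_7_ineq 1). unfold PI_2_3_7_tg, Ratan_seq, tg_alt. simpl. lra.
Qed.

Lemma sinc_0 : sinc 0 = 1.
Proof. unfold sinc. destruct Req_EM_T; lra. Qed.

Lemma sinc_nz s : s <> 0 -> sinc s = sin s / s.
Proof. intros H. unfold sinc. destruct Req_EM_T; lra. Qed.

Lemma sinc_opp s : sinc (- s) = sinc s.
Proof.
  destruct (Req_dec s 0) as [->|n]; [now rewrite Ropp_0|].
  rewrite !sinc_nz by lra. rewrite sin_neg. field. exact n.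
Qed.

Lemma continuous_sinc x : continuous sinc x.
Proof.
  destruct (Req_dec x 0) as [->|n].
  - apply filterlim_locally. intros eps.
    destruct (derivable_pt_lim_sin_0 eps (cond_pos eps)) as [del Hd].
    exists del. intros y Hy. rewrite sinc_0.
    destruct (Req_dec y 0) as [->|n]; [rewrite sinc_0; apply ball_center|].
    rewrite sinc_nz by exact n.
    assert (Hy' : Rabs y < del).
    { replace y with (y - 0) by ring. exact Hy. }
    specialize (Hd y n Hy'). rewrite Rplus_0_l, sin_0, Rminus_0_r in Hd. exact Hd.
  - apply continuous_ext_loc with (g := fun s => sin s / s).
    + assert (Hp : 0 < Rabs x) by now apply Rabs_pos_lt.
      exists (mkposreal _ Hp). intros y Hy. rewrite sinc_nz; [reflexivity|]. intros ->.
      unfold ball in Hy. simpl in Hy. unfold AbsRing_ball, abs, minus, plus, opp in Hy. simpl in Hy.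
      rewrite Rplus_0_l, Rabs_Ropp in Hy. lra.
    + apply (ex_derive_continuous (V := R_NormedModule)). auto_derive. exact n.
Qed.

Lemma ex_RInt_sinc a b : ex_RInt sinc a b.
Proof. apply (ex_RInt_continuous (V := R_CompleteNormedModule)). intros; apply continuous_sinc. Qed.

Lemma Si_diff a b : Si b - Si a = RInt sinc a b.
Proof.
  unfold Si. rewrite <- (RInt_Chasles sinc 0 a b) by apply ex_RInt_sinc.
  unfold plus; simpl. ring.
Qed.

Lemma Si_opp x : Si (- x) = - Si x.
Proof.
  unfold Si. apply is_RInt_unique.
  apply is_RInt_ext with (f := fun y => opp (opp (sinc (- - y)))).
  { intros s _. now rewrite opp_opp, Ropp_involutive. }
  apply (is_RInt_comp_opp (V := R_NormedModule) (fun s => opp (sinc (- s)))).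
  rewrite Ropp_0, Ropp_involutive.
  apply (is_RInt_opp (V := R_NormedModule)).
  apply is_RInt_ext with (f := sinc); [intros; now rewrite sinc_opp|].
  apply (RInt_correct (V := R_CompleteNormedModule)), ex_RInt_sinc.
Qed.

(** * The sine integral *)

(* [Si x = PI / 2 - si_tail x]: the real part of a Laplace integral over a quarter circle, whose
   derivative in [x] is exact in [t]. *)
Definition si_kernel (x t : R) : R := exp (- (x * cos t)) * cos (x * sin t).
Definition si_kernel' (x t : R) : R :=
  - (exp (- (x * cos t)) * (cos t * cos (x * sin t) + sin t * sin (x * sin t))).
Definition si_tail (x : R) : R := RInt (si_kernel x) 0 (PI / 2).

Lemma is_derive_si_kernel x t : is_derive (fun u => si_kernel u t) x (si_kernel' x t).
Proof. unfold si_kernel, si_kernel'. auto_derive; [trivial|]. toR. ring. Qed.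

Lemma continuous_si_kernel x t : continuous (si_kernel x) t.
Proof.
  apply (ex_derive_continuous (V := R_NormedModule)). unfold si_kernel. auto_derive. trivial.
Qed.

Lemma continuous_si_kernel' x t : continuous (si_kernel' x) t.
Proof.
  apply (ex_derive_continuous (V := R_NormedModule)). unfold si_kernel'. auto_derive. trivial.
Qed.

Lemma continuity_2d_comp1 (f : R -> R) (g : R -> R -> R) x y :
  (forall u, continuous f u) -> continuity_2d_pt g x y -> continuity_2d_pt (fun u v => f (g u v)) x y.
Proof.
  intros Hf Hg. apply (continuity_1d_2d_pt_comp f g); [|exact Hg].
  apply continuity_pt_filterlim, Hf.
Qed.

Lemma continuity_2d_si_kernel' x t : continuity_2d_pt si_kernel' x t.
Proof.
  assert (Cs : forall u, continuous sin u) by (intros; apply continuous_sin).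
  assert (Cc : forall u, continuous cos u) by (intros; apply continuous_cos).
  assert (Ce : forall u, continuous exp u) by (intros; apply continuous_exp).
  assert (S : continuity_2d_pt (fun _ v => sin v) x t)
    by (apply (continuity_2d_comp1 sin); [exact Cs|apply continuity_2d_pt_id2]).
  assert (C : continuity_2d_pt (fun _ v => cos v) x t)
    by (apply (continuity_2d_comp1 cos); [exact Cc|apply continuity_2d_pt_id2]).
  assert (XS : continuity_2d_pt (fun u v => u * sin v) x t)
    by (apply continuity_2d_pt_mult; [apply continuity_2d_pt_id1|exact S]).
  assert (XC : continuity_2d_pt (fun u v => u * cos v) x t)
    by (apply continuity_2d_pt_mult; [apply continuity_2d_pt_id1|exact C]).
  unfold si_kernel'. apply continuity_2d_pt_opp, continuity_2d_pt_mult.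
  - apply (continuity_2d_comp1 exp (fun u v => - (u * cos v))); [exact Ce|].
    now apply continuity_2d_pt_opp.
  - apply continuity_2d_pt_plus; apply continuity_2d_pt_mult; try assumption.
    + now apply (continuity_2d_comp1 cos (fun u v => u * sin v)).
    + now apply (continuity_2d_comp1 sin (fun u v => u * sin v)).
Qed.

(** The kernel is the real part of $g(xe^{-it})$ with $g(s)=e^{-s}$, and for such functions
    $x\partial_x=i\partial_t$. So [x] times its [x]-derivative is minus the [t]-derivative of the
    imaginary part. *)
Lemma si_kernel'_exact x t :
  is_derive (fun v => - (exp (- (x * cos v)) * sin (x * sin v))) t (x * si_kernel' x t).
Proof. unfold si_kernel'. auto_derive; [trivial|]. toR. ring. Qed.

Lemma is_derive_si_tail x : is_derive si_tail x (- sinc x).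
Proof.
  assert (E : forall u t, Derive (fun z => si_kernel z t) u = si_kernel' u t).
  { intros u t. apply is_derive_unique, is_derive_si_kernel. }
  assert (D : is_derive si_tail x (RInt (fun t => Derive (fun u => si_kernel u t) x) 0 (PI / 2))).
  { apply is_derive_RInt_param.
    - apply filter_forall. intros u t _. eexists. apply is_derive_si_kernel.
    - intros t _. apply continuity_2d_pt_ext with (f := si_kernel'); [intros; symmetry; apply E|].
      apply continuity_2d_si_kernel'.
    - apply filter_forall. intros u. apply (ex_RInt_continuous (V := R_CompleteNormedModule)).
      intros; apply continuous_si_kernel. }
  replace (- sinc x) with (RInt (fun t => Derive (fun u => si_kernel u t) x) 0 (PI / 2)); [exact D|].
  rewrite (RInt_ext _ (si_kernel' x)) by (intros; apply E).
  destruct (Req_dec x 0) as [->|n].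
  (* At [x = 0] exactness cannot be divided by [x]; there the differentiated kernel is simply $-\cos
     t$, with integral $-1$. *)
  - rewrite sinc_0. apply is_RInt_unique.
    replace (- (1)) with (minus (- sin (PI / 2)) (- sin 0)).
    2: { rewrite sin_PI2, sin_0. unfold minus, plus, opp; simpl. ring. }
    apply (is_RInt_derive (fun t => - sin t)).
    + intros t _. unfold si_kernel'. auto_derive; [trivial|]. toR.
      rewrite !Rmult_0_l, Ropp_0, exp_0, cos_0, sin_0. ring.
    + intros; apply continuous_si_kernel'.
  - assert (I : is_RInt (fun t => x * si_kernel' x t) 0 (PI / 2)
      (minus (- (exp (- (x * cos (PI / 2))) * sin (x * sin (PI / 2))))
             (- (exp (- (x * cos 0)) * sin (x * sin 0))))).
    { apply (is_RInt_derive (fun v => - (exp (- (x * cos v)) * sin (x * sin v)))).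
      - intros t _. apply si_kernel'_exact.
      - intros t _. apply (continuous_mult (K := R_AbsRing)); [apply continuous_const|].
        apply continuous_si_kernel'. }
    assert (I2 := is_RInt_scal (V := R_NormedModule) _ _ _ x _
      (RInt_correct (V := R_CompleteNormedModule) (si_kernel' x) 0 (PI / 2)
        (ex_RInt_continuous (V := R_CompleteNormedModule) _ _ _
          (fun z _ => continuous_si_kernel' x z)))).
    assert (U := eq_trans (eq_sym (is_RInt_unique (V := R_CompleteNormedModule) _ _ _ _ I))
       (is_RInt_unique (V := R_CompleteNormedModule) _ _ _ _ I2)).
    unfold minus, plus, opp, scal in U; simpl in U; unfold mult in U; simpl in U.
    rewrite cos_PI2, sin_PI2, sin_0, cos_0, !Rmult_0_r, sin_0, Ropp_0, exp_0 in U.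
    rewrite sinc_nz by exact n. apply Rmult_eq_reg_l with x; [|exact n].
    match type of U with _ = ?r => transitivity r; [reflexivity|] end.
    rewrite <- U. rewrite !Rmult_1_r. field. exact n.
Qed.

Lemma si_tail_0 : si_tail 0 = PI / 2.
Proof.
  unfold si_tail. rewrite (RInt_ext _ (fun _ => 1)).
  - rewrite RInt_const. unfold scal; simpl; unfold mult; simpl. ring.
  - intros t _. unfold si_kernel. rewrite !Rmult_0_l, Ropp_0, exp_0, cos_0. toR. ring.
Qed.

Lemma Si_si_tail x : Si x = PI / 2 - si_tail x.
Proof.
  unfold Si. apply is_RInt_unique.
  replace (PI / 2 - si_tail x) with (minus (- si_tail x) (- si_tail 0)).
  2: { rewrite si_tail_0. unfold minus, plus, opp; simpl. ring. }
  apply (is_RInt_derive (fun t => - si_tail t)).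
  - intros t _. replace (sinc t) with (opp (- sinc t)) by (unfold opp; simpl; ring).
    apply (is_derive_opp (V := R_NormedModule) si_tail), is_derive_si_tail.
  - intros; apply continuous_sinc.
Qed.

(** A Jordan inequality with 0.57 instead of $2/\pi$, read off the cubic Taylor bound: $u^2\le2.56$
    gives $1-u^2/6>0.57$. *)
Lemma sin_ge_linear u : 0 <= u <= PI / 2 -> (57 / 100) * u <= sin u.
Proof.
  intros Hu. generalize PI_bounds. intros HP.
  destruct (sin_bound u 0) as [H _]; [lra|lra|].
  unfold sin_approx, sin_term in H. simpl in H.
  assert (u * u <= 2.56) by nra.
  assert (u * (u * u) <= u * 2.56) by (apply Rmult_le_compat_l; lra). lra.
Qed.

(** Jordan's lemma on the quarter circle: the kernel is at most $e^{-x\cos t}$, and $\cos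
    t=\sin(\pi/2-t)$ dominates a linear function. *)
Lemma si_tail_bound x : 0 < x -> Rabs (si_tail x) <= / ((57 / 100) * x).
Proof.
  intros Hx. generalize PI_bounds. intros HP. unfold si_tail.
  assert (I : is_RInt (fun t => exp (- ((57 / 100) * x * (PI / 2 - t)))) 0 (PI / 2)
     (/ ((57 / 100) * x) * (1 - exp (- ((57 / 100) * x * (PI / 2)))))).
  { replace (/ ((57 / 100) * x) * (1 - exp (- ((57 / 100) * x * (PI / 2))))) with
     (minus (/ ((57 / 100) * x) * exp (- ((57 / 100) * x * (PI / 2 - PI / 2))))
            (/ ((57 / 100) * x) * exp (- ((57 / 100) * x * (PI / 2 - 0))))).
    2: { replace (PI / 2 - PI / 2) with 0 by ring. rewrite Rmult_0_r, Ropp_0, exp_0, Rminus_0_r.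
         unfold minus, plus, opp; simpl. ring. }
    apply (is_RInt_derive (fun t => / ((57 / 100) * x) * exp (- ((57 / 100) * x * (PI / 2 - t))))).
    - intros t _. auto_derive; [trivial|]. toR. unfold Rminus. field. lra.
    - intros t _. apply (ex_derive_continuous (V := R_NormedModule)). auto_derive. trivial. }
  apply Rle_trans with (/ ((57 / 100) * x) * (1 - exp (- ((57 / 100) * x * (PI / 2))))).
  - apply (norm_RInt_le (V := R_NormedModule) (si_kernel x) (fun t => exp (- ((57 / 100) * x * (PI / 2 -
    t)))) 0 (PI / 2)).
    + lra.
    + intros t Ht. change (Rabs (si_kernel x t) <= exp (- ((57 / 100) * x * (PI / 2 - t)))).
      unfold si_kernel. rewrite Rabs_mult, (Rabs_pos_eq (exp _)) by (left; apply exp_pos).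
      apply Rle_trans with (exp (- (x * cos t)) * 1).
      * apply Rmult_le_compat_l; [left; apply exp_pos|]. apply Rabs_le, COS_bound.
      * rewrite Rmult_1_r.
        assert (H := sin_ge_linear (PI / 2 - t) ltac:(lra)). rewrite sin_shift in H.
        destruct (Req_dec (- (x * cos t)) (- ((57 / 100) * x * (PI / 2 - t)))) as [->|n]; [lra|].
        left. apply exp_increasing. nra.
    + apply (RInt_correct (V := R_CompleteNormedModule)).
      apply (ex_RInt_continuous (V := R_CompleteNormedModule)). intros; apply continuous_si_kernel.
    + exact I.
  - assert (0 < / ((57 / 100) * x)) by (apply Rinv_0_lt_compat; lra).
    assert (0 < exp (- ((57 / 100) * x * (PI / 2)))) by apply exp_pos. nra.
Qed.

Lemma Si_mono_pos x : 0 <= x <= PI -> 0 <= Si x <= Si PI.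
Proof.
  intros Hx. assert (P : forall s, 0 < s < PI -> 0 <= sinc s).
  { intros s Hs. rewrite sinc_nz by lra. left. apply Rdiv_lt_0_compat; [|lra].
    apply sin_gt_0; lra. }
  split.
  - unfold Si. apply RInt_ge_0; [lra|apply ex_RInt_sinc|]. intros s Hs. apply P. lra.
  - apply Rminus_le_0. rewrite Si_diff.
    apply RInt_ge_0; [lra|apply ex_RInt_sinc|]. intros s Hs. apply P. lra.
Qed.

Lemma sinc_neg s : PI < s < 2 * PI -> sinc s <= 0.
Proof.
  intros Hs. generalize PI_RGT_0; intros HP. rewrite sinc_nz by lra.
  assert (0 < / s) by (apply Rinv_0_lt_compat; lra).
  assert (sin s < 0) by (apply sin_lt_0; lra). unfold Rdiv. nra.
Qed.

Lemma RInt_sinc_le0 a b : PI <= a -> a <= b -> b <= 2 * PI -> RInt sinc a b <= 0.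
Proof.
  intros Ha Hab Hb.
  replace 0 with (RInt (fun _ => 0) a b)
    by (rewrite RInt_const; unfold scal; simpl; unfold mult; simpl; ring).
  apply RInt_le; [lra|apply ex_RInt_sinc|apply ex_RInt_const|].
  intros s Hs. apply sinc_neg. lra.
Qed.

Lemma sinc_le_poly s : 0 < s < PI ->
  sinc s <= 1 - s ^ 2 / 6 + s ^ 4 / 120 - s ^ 6 / 5040 + s ^ 8 / 362880.
Proof.
  intros Hs. destruct (sin_bound s 1) as [_ H]; [lra|lra|].
  rewrite sinc_nz by lra.
  apply Rmult_le_reg_r with s; [lra|]. unfold Rdiv at 1. rewrite Rmult_assoc, Rinv_l by lra.
  rewrite Rmult_1_r. eapply Rle_trans; [exact H|].
  unfold sin_approx, sin_term.
  assert (F : forall n, INR (Factorial.fact (S n)) = INR (S n) * INR (Factorial.fact n)).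
  { intros n. now rewrite fact_simpl, mult_INR. }
  cbn [sum_f_R0 Nat.mul Nat.add]. rewrite !F. change (INR (Factorial.fact 0)) with 1.
  rewrite !S_INR, INR_0. simpl pow. lra.
Qed.

(** The true value is about 1.852, against 1.885 on the right. The margin admits a Taylor polynomial
    of degree eight for sinc and the crude enclosure of [PI]. *)
Lemma Si_PI : Si PI <= 0.6 * PI.
Proof.
  generalize PI_bounds. intros HP. unfold Si.
  assert (I : is_RInt (fun s => 1 - s ^ 2 / 6 + s ^ 4 / 120 - s ^ 6 / 5040 + s ^ 8 / 362880) 0 PI
    (PI - PI ^ 3 / 18 + PI ^ 5 / 600 - PI ^ 7 / 35280 + PI ^ 9 / 3265920)).
  { replace (PI - PI ^ 3 / 18 + PI ^ 5 / 600 - PI ^ 7 / 35280 + PI ^ 9 / 3265920) with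
     (minus (PI - PI ^ 3 / 18 + PI ^ 5 / 600 - PI ^ 7 / 35280 + PI ^ 9 / 3265920)
            (0 - 0 ^ 3 / 18 + 0 ^ 5 / 600 - 0 ^ 7 / 35280 + 0 ^ 9 / 3265920))
      by (unfold minus, plus, opp; simpl; field).
    apply (is_RInt_derive (fun s => s - s ^ 3 / 18 + s ^ 5 / 600 - s ^ 7 / 35280 + s ^ 9 / 3265920)).
    - intros s _. auto_derive; [trivial|]. toR. field.
    - intros s _. apply (ex_derive_continuous (V := R_NormedModule)). auto_derive. trivial. }
  apply Rle_trans with (PI - PI ^ 3 / 18 + PI ^ 5 / 600 - PI ^ 7 / 35280 + PI ^ 9 / 3265920).
  - rewrite <- (is_RInt_unique (V := R_CompleteNormedModule) _ _ _ _ I).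
    apply RInt_le; [lra|apply ex_RInt_sinc|now exists (PI - PI ^ 3 / 18 + PI ^ 5 / 600 - PI ^ 7 / 35280 +
      PI ^ 9 / 3265920)|].
    intros s Hs. now apply sinc_le_poly.
  - set (u := PI * PI). assert (Hu : 9.61 <= u <= 10.24) by (unfold u; nra).
    replace (PI - PI ^ 3 / 18 + PI ^ 5 / 600 - PI ^ 7 / 35280 + PI ^ 9 / 3265920)
      with (PI * (1 - u / 18 + u * u / 600 - u * u * u / 35280 + u * u * u * u / 3265920))
      by (unfold u; field).
    rewrite (Rmult_comm 0.6). apply Rmult_le_compat_l; [lra|].
    assert (u * u <= 104.8576) by nra. assert (9.61 * 9.61 <= u * u) by nra.
    assert (u * u * u <= 10.24 * 104.8576) by nra.
    assert (9.61 * (9.61 * 9.61) <= u * u * u) by nra.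
    assert (u * u * u * u <= 10.24 * (10.24 * 104.8576)) by nra.
    (* The chord of the convex function $u^2$ over the enclosure of [u]. With constant bounds for
       the higher powers, the final comparison becomes linear in [u]. *)
    assert (u * u <= 9.61 * 9.61 + (9.61 + 10.24) * (u - 9.61)) by nra.
    lra.
Qed.

Lemma si_tail_far x : 2 * PI <= x -> Rabs (si_tail x) <= 0.1 * PI.
Proof.
  intros Hx. generalize PI_bounds. intros HP.
  eapply Rle_trans; [apply si_tail_bound; lra|].
  apply Rle_trans with (/ ((57 / 100) * 6.2)); [|lra].
  apply Rinv_le_contravar; lra.
Qed.

(** [Si] lies between [0] and [Si PI] up to [PI], then between [Si (2 * PI)] and [Si PI] up to
    [2 * PI]. From there on the tail estimate puts it within [0.1 * PI] of [PI / 2]. *)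
Lemma Si_abs_bound_pos x : 0 <= x -> Rabs (Si x) <= 0.6 * PI.
Proof.
  intros Hx. generalize PI_bounds. intros HP.
  destruct (Rle_dec x PI) as [H1|H1]; [|destruct (Rle_dec x (2 * PI)) as [H2|H2]].
  - destruct (Si_mono_pos x ltac:(lra)) as [A B]. rewrite Rabs_pos_eq by exact A.
    generalize Si_PI. lra.
  - assert (A : Si x <= Si PI).
    { apply Rminus_le. rewrite Si_diff. apply RInt_sinc_le0; lra. }
    assert (B : Si (2 * PI) <= Si x).
    { apply Rminus_le. rewrite Si_diff. apply RInt_sinc_le0; lra. }
    assert (Bt := si_tail_far (2 * PI) ltac:(lra)). rewrite Si_si_tail in B.
    apply Rabs_le_between in Bt. generalize Si_PI. intros. apply Rabs_le. lra.
  - assert (Bt := si_tail_far x ltac:(lra)). apply Rabs_le_between in Bt.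
    rewrite Si_si_tail. apply Rabs_le. lra.
Qed.

Lemma Si_abs_bound x : Rabs (Si x) <= 0.6 * PI.
Proof.
  destruct (Rle_dec 0 x) as [H|H]; [now apply Si_abs_bound_pos|].
  replace x with (- - x) by ring. rewrite Si_opp, Rabs_Ropp. apply Si_abs_bound_pos. lra.
Qed.

Lemma Jfun_abs_bound k h x : 0 < h -> Rabs (Jfun k h x) <= 1.1 * h.
Proof.
  intros Hh. generalize PI_bounds. intros HP. unfold Jfun.
  rewrite Rabs_mult, Rabs_pos_eq by lra. rewrite Rmult_comm. apply Rmult_le_compat_r; [lra|].
  set (s := Si _). assert (H := Si_abs_bound (PI * (x / h - IZR k))). fold s in H.
  apply Rabs_le_between in H. apply Rabs_le.
  replace (1 / PI * s) with (s / PI) by (field; lra).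
  assert (s / PI <= 0.6). { apply Rmult_le_reg_r with PI; [lra|]. unfold Rdiv. rewrite Rmult_assoc,
    Rinv_l by lra. lra. }
  assert (- 0.6 <= s / PI). { apply Rmult_le_reg_r with PI; [lra|]. unfold Rdiv. rewrite Rmult_assoc,
    Rinv_l by lra. lra. }
  lra.
Qed.

(** Left of its node the limit $-\pi/2$ of [Si] cancels the summand [1 / 2], leaving [h / PI] times
    the tail at [PI * u]. *)
Lemma Jfun_decay k h x u : 0 < h -> 0 < u -> x / h - IZR k = - u -> Rabs (Jfun k h x) <= h / u.
Proof.
  intros Hh Hu E. generalize PI_bounds. intros HP. unfold Jfun. rewrite E.
  replace (PI * - u) with (- (PI * u)) by ring. rewrite Si_opp, Si_si_tail.
  replace (h * (1 / 2 + 1 / PI * - (PI / 2 - si_tail (PI * u)))) with (h * / PI * si_tail (PI * u))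
    by (field; lra).
  assert (Hip : 0 < / PI) by (apply Rinv_0_lt_compat; lra).
  rewrite Rabs_mult, Rabs_pos_eq by (apply Rmult_le_pos; lra).
  assert (B := si_tail_bound (PI * u) ltac:(apply Rmult_lt_0_compat; lra)).
  unfold Rdiv. rewrite Rmult_assoc. apply Rmult_le_compat_l; [lra|].
  apply Rle_trans with (/ PI * / ((57 / 100) * (PI * u))); [apply Rmult_le_compat_l; lra|].
  rewrite <- Rinv_mult. apply Rinv_le_contravar; [exact Hu|].
  assert (1 * u <= PI * ((57 / 100) * PI) * u) by (apply Rmult_le_compat_r; nra). lra.
Qed.

Lemma is_derive_Si x : is_derive Si x (sinc x).
Proof.
  apply is_derive_ext with (f := fun t => PI / 2 - si_tail t).
  - intros; now rewrite Si_si_tail.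
  - replace (sinc x) with (minus 0 (- sinc x)) by (unfold minus, plus, opp; simpl; ring).
    apply (is_derive_minus (V := R_NormedModule) (fun _ => PI / 2) si_tail);
      [apply (is_derive_const (V := R_NormedModule))|apply is_derive_si_tail].
Qed.

Lemma is_RInt_Jfun k h a b : 0 < h ->
  is_RInt (fun t => sinc (PI * (t / h - IZR k))) a b (Jfun k h b - Jfun k h a).
Proof.
  intros Hh. generalize PI_RGT_0; intros HP.
  assert (D : forall t, is_derive (fun t => PI * (t / h - IZR k)) t (PI / h)).
  { intros t. auto_derive; [trivial|]. toR. field. lra. }
  apply (is_RInt_derive (Jfun k h)).
  - intros t _. unfold Jfun.
    assert (D2 := is_derive_comp Si _ t _ _ (is_derive_Si (PI * (t / h - IZR k))) (D t)).
    replace (sinc (PI * (t / h - IZR k)))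
      with (scal h (plus 0 (scal (1 / PI) (scal (PI / h) (sinc (PI * (t / h - IZR k))))))).
    2: { unfold scal, plus; simpl; unfold mult; simpl. field. lra. }
    apply (is_derive_scal (fun t => 1 / 2 + 1 / PI * Si (PI * (t / h - IZR k))) t h).
    apply (is_derive_plus (V := R_NormedModule) (fun _ => 1 / 2)).
    + apply (is_derive_const (V := R_NormedModule)).
    + now apply (is_derive_scal (fun t => Si (PI * (t / h - IZR k)))).
  - intros t _. apply (continuous_comp (fun t => PI * (t / h - IZR k)) sinc); [|apply continuous_sinc].
    apply (ex_derive_continuous (V := R_NormedModule)). eexists. apply D.
Qed.

(** * Fubini for continuous functions *)

Lemma continuity_2d_fst (g : R -> R -> R) x y :
  continuity_2d_pt g x y -> continuous (fun u => g u y) x.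
Proof.
  intros H. apply filterlim_locally. intros eps. destruct (H eps) as [del Hd].
  exists del. intros u Hu. apply Hd; [exact Hu|].
  rewrite Rminus_diag_eq, Rabs_R0 by reflexivity. apply cond_pos.
Qed.

Lemma continuity_2d_swap (g : R -> R -> R) x y :
  continuity_2d_pt g x y -> continuity_2d_pt (fun v u => g u v) y x.
Proof.
  intros H eps. destruct (H eps) as [del Hd]. exists del. intros u v Hu Hv. now apply Hd.
Qed.

Lemma continuous_RInt_param (g : R -> R -> R) a b y :
  (forall u v, continuity_2d_pt g u v) -> continuous (fun v => RInt (fun u => g u v) a b) y.
Proof.
  intros Hg.
  assert (X : forall v c d, ex_RInt (fun u => g u v) c d).
  { intros v c d. apply (ex_RInt_continuous (V := R_CompleteNormedModule)).
    intros u _. now apply continuity_2d_fst. }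
  assert (Main : forall a b, a <= b -> continuous (fun v => RInt (fun u => g u v) a b) y).
  { clear a b. intros a b Hab. apply filterlim_locally. intros eps.
    assert (He : 0 < eps / (b - a + 1)) by (apply Rdiv_lt_0_compat; [apply cond_pos|lra]).
    destruct (uniform_continuity_2d_1d g a b y (fun x _ => Hg x y) (mkposreal _ He)) as [del Hd].
    exists del. intros v Hv.
    change (Rabs (v - y) < del) in Hv.
    change (Rabs (RInt (fun u => g u v) a b - RInt (fun u => g u y) a b) < eps).
    assert (Hv' := proj1 (Rabs_lt_between _ _) Hv). generalize (cond_pos del). intros Hdel.
    replace (RInt (fun u => g u v) a b - RInt (fun u => g u y) a b)
      with (RInt (fun u => minus (g u v) (g u y)) a b).
    2: { rewrite (RInt_minus (V := R_CompleteNormedModule)) by apply X. reflexivity. }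
    apply Rle_lt_trans with ((b - a) * (eps / (b - a + 1))).
    - apply abs_RInt_le_const; [exact Hab| |].
      + apply (ex_RInt_minus (V := R_NormedModule) (fun u => g u v) (fun u => g u y)); apply X.
      + intros u Hu. left. apply (Hd u y u v); try lra.
        rewrite Rminus_diag_eq, Rabs_R0 by reflexivity. exact Hdel.
    - apply Rlt_le_trans with ((b - a + 1) * (eps / (b - a + 1))).
      + apply Rmult_lt_compat_r; [exact He|lra].
      + right. field. lra. }
  destruct (Rle_dec a b) as [H|H]; [now apply Main|].
  apply continuous_ext with (f := fun v => opp (RInt (fun u => g u v) b a)).
  - intros v. now apply (opp_RInt_swap (V := R_CompleteNormedModule)).
  - apply (continuous_opp (K := R_AbsRing) (V := R_NormedModule)). apply Main. lra.
Qed.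

(** As functions of the upper limit [b], both iterated integrals vanish at [a] and have the same
    derivative, by differentiation under the integral sign. *)
Lemma fubini (g : R -> R -> R) a b c d : (forall u v, continuity_2d_pt g u v) ->
  RInt (fun u => RInt (fun v => g u v) c d) a b = RInt (fun v => RInt (fun u => g u v) a b) c d.
Proof.
  intros Hg.
  assert (X1 : forall v p q, ex_RInt (fun u => g u v) p q).
  { intros v p q. apply (ex_RInt_continuous (V := R_CompleteNormedModule)).
    intros u _. now apply continuity_2d_fst. }
  assert (D1 : forall v x, is_derive (fun y => RInt (fun u => g u v) a y) x (g x v)).
  { intros v x. apply (is_derive_RInt (fun u => g u v) _ a).
    - apply filter_forall. intros y. apply (RInt_correct (V := R_CompleteNormedModule)), X1.
    - now apply continuity_2d_fst. }
  set (Phi := fun x => RInt (fun v => RInt (fun u => g u v) a x) c d).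
  assert (D : forall x, is_derive Phi x (RInt (fun v => g x v) c d)).
  { intros x.
    rewrite (RInt_ext (fun v => g x v) (fun v => Derive (fun y => RInt (fun u => g u v) a y) x)).
    2: { intros v _. symmetry. apply is_derive_unique, D1. }
    apply (is_derive_RInt_param (fun y v => RInt (fun u => g u v) a y)).
    - apply filter_forall. intros y t _. eexists. apply D1.
    - intros t _. apply continuity_2d_pt_ext with (f := g); [|apply Hg].
      intros y v. symmetry. apply is_derive_unique, D1.
    - apply filter_forall. intros y. apply (ex_RInt_continuous (V := R_CompleteNormedModule)).
      intros v _. now apply continuous_RInt_param. }
  assert (P0 : Phi a = 0).
  { unfold Phi. rewrite (RInt_ext _ (fun _ => 0)).
    - rewrite RInt_const. apply (scal_zero_r (V := R_ModuleSpace)).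
    - intros v _. apply (RInt_point (V := R_CompleteNormedModule)). }
  transitivity (minus (Phi b) (Phi a)).
  - apply is_RInt_unique. apply (is_RInt_derive Phi).
    + intros x _. apply D.
    + intros x _. apply (continuous_RInt_param (fun v u => g u v)).
      intros u v. apply continuity_2d_swap, Hg.
  - rewrite P0. unfold minus, plus, opp; simpl. unfold Phi. ring.
Qed.

Definition ccont2 (g : R -> R -> C) : Prop :=
  forall p, ccont (U := prod_UniformSpace R_UniformSpace R_UniformSpace) (fun p => g (fst p) (snd p)) p.

Lemma ccont2_re g : ccont2 g -> forall u v, continuity_2d_pt (fun u v => Re (g u v)) u v.
Proof.
  intros H u v. apply continuity_2d_pt_filterlim.
  apply (ccont_re (U := prod_UniformSpace R_UniformSpace R_UniformSpace) _ _ (H (u, v))).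
Qed.

Lemma ccont2_im g : ccont2 g -> forall u v, continuity_2d_pt (fun u v => Im (g u v)) u v.
Proof.
  intros H u v. apply continuity_2d_pt_filterlim.
  apply (ccont_im (U := prod_UniformSpace R_UniformSpace R_UniformSpace) _ _ (H (u, v))).
Qed.

Lemma CInt_fubini g a b c d : ccont2 g ->
  CInt (fun u => CInt (g u) c d) a b = CInt (fun v => CInt (fun u => g u v) a b) c d.
Proof.
  intros H. unfold CInt. simpl. f_equal.
  - apply (fubini (fun u v => Re (g u v))). now apply ccont2_re.
  - apply (fubini (fun u v => Im (g u v))). now apply ccont2_im.
Qed.

Lemma ccont_CInt_param g c d u : ccont2 g -> ccont (fun u => CInt (g u) c d) u.
Proof.
  intros H. unfold CInt. apply ccont_pair.
  - apply (continuous_RInt_param (fun v u => Re (g u v))). intros.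
    apply (continuity_2d_swap (fun u v => Re (g u v))). now apply ccont2_re.
  - apply (continuous_RInt_param (fun v u => Im (g u v))). intros.
    apply (continuity_2d_swap (fun u v => Im (g u v))). now apply ccont2_im.
Qed.

(** * The integrated Cauchy kernel *)

Lemma RtoC_ne_off_axis (z : C) (t : R) : Im z <> 0 -> (z - t)%C <> RtoC 0.
Proof.
  intros H E. apply H. apply (f_equal Im) in E. rewrite im_minus, !im_RtoC in E. lra.
Qed.

Lemma ccont_RtoC_comp {U : UniformSpace} (f : U -> R) x :
  continuous f x -> ccont (fun t => RtoC (f t)) x.
Proof. intros H. apply ccont_pair; [exact H|apply continuous_const]. Qed.

Lemma ccont_RtoC (t : R) : ccont RtoC t.
Proof. apply (ccont_RtoC_comp (fun t => t)), continuous_id. Qed.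

Lemma continuous_sin_lin k t : continuous (fun t => sin (k * t)) t.
Proof. apply (ex_derive_continuous (V := R_NormedModule)). auto_derive. trivial. Qed.
Lemma continuous_cos_lin k t : continuous (fun t => cos (k * t)) t.
Proof. apply (ex_derive_continuous (V := R_NormedModule)). auto_derive. trivial. Qed.

Lemma ccont_kernel (z : C) t : Im z <> 0 -> ccont (fun t => (/ (z - RtoC t))%C) t.
Proof.
  intros H. apply ccont_inv; [|now apply RtoC_ne_off_axis].
  apply ccont_minus; [apply ccont_const|apply ccont_RtoC].
Qed.

(** Trades the kernel $1/(z-t)$, whose absolute integral grows logarithmically, for $1/(z-t)^2$,
    which is integrable over the whole line, and gains a factor $1/k$. *)
Lemma kernel_by_parts (z : C) k a b : Im z <> 0 -> k <> 0 ->
  CInt (fun t => (RtoC (sin (k * t)) * / (z - t))%C) a b =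
  (RtoC (- cos (k * b) / k) * / (z - b) - RtoC (- cos (k * a) / k) * / (z - a)
   + RtoC (/ k) * CInt (fun t => (RtoC (cos (k * t)) * (/ (z - t) * / (z - t)))%C) a b)%C.
Proof.
  intros Hz Hk.
  assert (C0 : forall t, ccont (fun t => (RtoC (sin (k * t)) * / (z - t))%C) t).
  { intros t. apply ccont_mult; [apply ccont_RtoC_comp, continuous_sin_lin|now apply ccont_kernel]. }
  assert (C1 : forall t, ccont (fun t => (RtoC (cos (k * t)) * (/ (z - t) * / (z - t)))%C) t).
  { intros t. apply ccont_mult; [apply ccont_RtoC_comp, continuous_cos_lin|].
    apply ccont_mult; now apply ccont_kernel. }
  (* The integrand is the exact derivative of $-\cos(kt)/(k(z-t))$. The two coordinates [u] and [v]
     are integrated separately. *)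
  assert (E : CInt (fun t => (RtoC (sin (k * t)) * / (z - t)
       + RtoC (- / k) * (RtoC (cos (k * t)) * (/ (z - t) * / (z - t))))%C) a b
     = (RtoC (- cos (k * b) / k) * / (z - b) - RtoC (- cos (k * a) / k) * / (z - a))%C).
  { destruct z as [s y]. simpl in Hz.
    assert (P : forall t, 0 < (s - t) * (s - t) + y * y).
    { intros t. assert (0 < y * y) by nra. assert (0 <= (s - t) * (s - t)) by apply Rle_0_sqr. lra. }
    assert (Ei : forall t : R, (/ ((s, y) - t))%C
       = (((s - t) / ((s - t) * (s - t) + y * y), - y / ((s - t) * (s - t) + y * y)) : C)).
    { intros t. unfold Cinv, Cminus, Cplus, Copp, RtoC; simpl. f_equal; f_equal; try ring; f_equal; ring. }
    set (u := fun t => sin (k * t) * ((s - t) / ((s - t) * (s - t) + y * y)) - / k * cos (k * t)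
       * (((s - t) * (s - t) - y * y) / ((s - t) * (s - t) + y * y) ^ 2)).
    set (v := fun t => sin (k * t) * (- y / ((s - t) * (s - t) + y * y)) - / k * cos (k * t)
       * ((- 2 * (s - t) * y) / ((s - t) * (s - t) + y * y) ^ 2)).
    rewrite (CInt_ext _ (fun t => (u t, v t) : C)).
    2: { intros t _. rewrite Ei. specialize (P t). unfold u, v, Cplus, Cmult, RtoC; simpl fst; simpl snd.
         f_equal; field; lra. }
    rewrite !Ei. unfold CInt, Cminus, Cplus, Copp, Cmult, RtoC, Re, Im; simpl fst; simpl snd.
    f_equal; apply is_RInt_unique.
    - replace (_ + _) with (minus
        (- cos (k * b) / k * ((s - b) / ((s - b) * (s - b) + y * y)))
        (- cos (k * a) / k * ((s - a) / ((s - a) * (s - a) + y * y))))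
        by (unfold minus, plus, opp; simpl; ring).
      apply (is_RInt_derive (fun t => - cos (k * t) / k * ((s - t) / ((s - t) * (s - t) + y * y)))).
      + intros t _. specialize (P t). unfold u. auto_derive; [lra|]. toR. unfold Rminus. field.
        unfold Rminus in P. lra.
      + intros t _. specialize (P t). apply (ex_derive_continuous (V := R_NormedModule)).
        unfold u. auto_derive. unfold Rminus in P. repeat split; try lra.
        rewrite Rmult_1_r. apply Rmult_integral_contrapositive. split; lra.
    - replace (_ + _) with (minus
        (- cos (k * b) / k * (- y / ((s - b) * (s - b) + y * y)))
        (- cos (k * a) / k * (- y / ((s - a) * (s - a) + y * y))))
        by (unfold minus, plus, opp; simpl; ring).
      apply (is_RInt_derive (fun t => - cos (k * t) / k * (- y / ((s - t) * (s - t) + y * y)))).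
      + intros t _. specialize (P t). unfold v. auto_derive; [lra|]. toR. unfold Rminus. field.
        unfold Rminus in P. lra.
      + intros t _. specialize (P t). apply (ex_derive_continuous (V := R_NormedModule)).
        unfold v. auto_derive. unfold Rminus in P. repeat split; try lra.
        rewrite Rmult_1_r. apply Rmult_integral_contrapositive. split; lra. }
  rewrite CInt_plus, CInt_scal in E.
  - rewrite <- E. rewrite RtoC_opp. ring.
  - intros t _. apply C1.
  - intros t _. apply C0.
  - intros t _. apply ccont_mult; [apply ccont_const|apply C1].
Qed.

Lemma Cmod_ge_dist (z : C) (t : R) : Rabs (Im z) <= Cmod (z - t).
Proof.
  replace (Im z) with (Im (z - t)) by (rewrite im_minus, im_RtoC; ring). apply im_le_Cmod.
Qed.

(** The cosine condition removes the boundary term at [a]. The term at [b] contributes the [1], the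
    remaining integral the [PI], and the bound does not depend on the length of the interval. *)
Lemma kernel_bound (z : C) k a b : Im z <> 0 -> 0 < k -> a <= b -> cos (k * a) = 0 ->
  Cmod (CInt (fun t => (RtoC (sin (k * t)) * / (z - t))%C) a b) <= (1 + PI) / (k * Rabs (Im z)).
Proof.
  intros Hz Hk Hab Ha. set (r := Rabs (Im z)). assert (Hr : 0 < r) by now apply Rabs_pos_lt.
  rewrite kernel_by_parts by lra. rewrite Ha.
  replace (- 0 / k) with 0 by (field; lra).
  assert (B1 : Cmod (RtoC (- cos (k * b) / k) * / (z - b)) <= 1 / (k * r)).
  { rewrite Cmod_mult, Cmod_R, Cmod_inv by now apply RtoC_ne_off_axis.
    unfold Rdiv. rewrite Rmult_1_l, Rinv_mult. apply Rmult_le_compat.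
    - apply Rabs_pos.
    - left. apply Rinv_0_lt_compat, Cmod_gt_0. now apply RtoC_ne_off_axis.
    - rewrite Rabs_mult, Rabs_Ropp, (Rabs_pos_eq (/ k)) by (left; now apply Rinv_0_lt_compat).
      rewrite <- (Rmult_1_l (/ k)) at 2. apply Rmult_le_compat_r.
      + left; now apply Rinv_0_lt_compat.
      + apply Rabs_le, COS_bound.
    - apply Rinv_le_contravar; [exact Hr|apply Cmod_ge_dist]. }
  assert (B2 : Cmod (CInt (fun t => (RtoC (cos (k * t)) * (/ (z - t) * / (z - t)))%C) a b) <= PI / r).
  (* This is $1/|z-t|^2$ written as a multiple of the Poisson kernel; the arctangents in its
     integral differ by less than [PI]. *)
  { set (g := fun t => / r * (r / ((t - Re z) ^ 2 + r ^ 2))).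
    assert (I : is_RInt g a b (/ r * (atan ((b - Re z) / r) - atan ((a - Re z) / r)))).
    { apply (is_RInt_scal (V := R_NormedModule)), is_RInt_im_inv. lra. }
    eapply Rle_trans.
    - apply (CInt_le _ g a b Hab).
      + intros t _. apply ccont_mult; [apply ccont_RtoC_comp, continuous_cos_lin|].
        apply ccont_mult; now apply ccont_kernel.
      + eexists; exact I.
      + intros t _. rewrite !Cmod_mult, Cmod_R, Cmod_inv by now apply RtoC_ne_off_axis.
        assert (Hp : 0 < Cmod (z - t)) by (apply Cmod_gt_0; now apply RtoC_ne_off_axis).
        assert (E : g t = / Cmod (z - t) * / Cmod (z - t)).
        { rewrite <- Rinv_mult. unfold g.
          replace (Cmod (z - t) * Cmod (z - t)) with ((t - Re z) ^ 2 + r ^ 2).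
          - field. split; [|lra]. assert (0 < r ^ 2) by (apply pow_lt; lra).
            generalize (pow2_ge_0 (t - Re z)). lra.
          - replace (Cmod (z - t) * Cmod (z - t)) with (Cmod (z - t) ^ 2) by ring.
            rewrite Cmod2_alt, re_minus, im_minus, re_RtoC, im_RtoC.
            unfold r. rewrite pow2_abs. ring. }
        rewrite E. rewrite <- (Rmult_1_l (/ Cmod (z - t) * / Cmod (z - t))) at 2.
        apply Rmult_le_compat_r.
        * apply Rmult_le_pos; left; now apply Rinv_0_lt_compat.
        * apply Rabs_le, COS_bound.
    - rewrite (is_RInt_unique (V := R_CompleteNormedModule) _ _ _ _ I).
      unfold Rdiv. rewrite Rmult_comm. apply Rmult_le_compat_r; [left; now apply Rinv_0_lt_compat|].
      generalize (atan_bound ((b - Re z) * / r)) (atan_bound ((a - Re z) * / r)). lra. }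
  replace ((1 + PI) / (k * r)) with (1 / (k * r) + / k * (PI / r)) by (field; lra).
  replace (RtoC (- cos (k * b) / k) * / (z - b) - 0 * / (z - a))%C
    with (RtoC (- cos (k * b) / k) * / (z - b))%C by ring.
  eapply Rle_trans; [apply Cmod_triangle|]. apply Rplus_le_compat; [exact B1|].
  rewrite Cmod_mult, Cmod_R, Rabs_pos_eq by (left; now apply Rinv_0_lt_compat).
  apply Rmult_le_compat_l; [left; now apply Rinv_0_lt_compat|exact B2].
Qed.

(** * Finite sums over integer ranges *)

Definition zlist (a b : Z) : list Z :=
  map (fun j : nat => (a + Z.of_nat j)%Z) (seq 0 (Z.to_nat (b - a + 1))).

Lemma sumZ_csum a b g : sumZ a b g = csum g (zlist a b).
Proof.
  unfold sumZ, zlist. induction (seq 0 (Z.to_nat (b - a + 1))) as [|j l IH]; [reflexivity|].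
  simpl. now rewrite IH.
Qed.

Lemma zlist_In a b k : In k (zlist a b) <-> (a <= k <= b)%Z.
Proof.
  unfold zlist. rewrite in_map_iff. split.
  - intros [j [<- Hj]]. apply in_seq in Hj. lia.
  - intros H. exists (Z.to_nat (k - a)). split; [lia|]. apply in_seq. lia.
Qed.

Lemma zlist_NoDup a b : NoDup (zlist a b).
Proof.
  unfold zlist. apply FinFun.Injective_map_NoDup; [|apply seq_NoDup].
  intros i j H. lia.
Qed.

Lemma zlist_app a b c : (a <= b + 1)%Z -> (b <= c)%Z -> zlist a c = zlist a b ++ zlist (b + 1) c.
Proof.
  intros H1 H2. unfold zlist.
  replace (Z.to_nat (c - a + 1)) with (Z.to_nat (b - a + 1) + Z.to_nat (c - (b + 1) + 1))%nat by lia.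
  rewrite seq_app, map_app. f_equal. rewrite Nat.add_0_l.
  generalize (Z.to_nat (c - (b + 1) + 1)). intros n.
  assert (G : forall i, map (fun j => (a + Z.of_nat j)%Z) (seq (Z.to_nat (b - a + 1) + i) n)
     = map (fun j => (b + 1 + Z.of_nat j)%Z) (seq i n)).
  { induction n as [|n IH]; intros i; [reflexivity|].
    simpl. f_equal; [lia|]. rewrite <- Nat.add_succ_r. apply IH. }
  specialize (G 0%nat). now rewrite Nat.add_0_r in G.
Qed.

Fixpoint rsum {A : Type} (r : A -> R) (l : list A) : R :=
  match l with nil => 0 | p :: l' => r p + rsum r l' end.

Lemma csum_app {A} (r : A -> C) l l' : csum r (l ++ l') = (csum r l + csum r l')%C.
Proof. induction l as [|a l IH]; simpl; [ring|]. rewrite IH. ring. Qed.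

Lemma csum_ext {A} (r s : A -> C) l : (forall a, In a l -> r a = s a) -> csum r l = csum s l.
Proof.
  induction l as [|a l IH]; intros H; [reflexivity|]. simpl.
  rewrite H by now left. rewrite IH; [reflexivity|]. intros b Hb. apply H. now right.
Qed.

Lemma csum_scal {A} c (r : A -> C) l : csum (fun a => (c * r a)%C) l = (c * csum r l)%C.
Proof. induction l as [|a l IH]; simpl; [ring|]. rewrite IH. ring. Qed.

Lemma csum_minus {A} (r s : A -> C) l : csum (fun a => (r a - s a)%C) l = (csum r l - csum s l)%C.
Proof. induction l as [|a l IH]; simpl; [ring|]. rewrite IH. ring. Qed.

Lemma csum_map {A B} (f : A -> B) (r : B -> C) l : csum r (map f l) = csum (fun a => r (f a)) l.
Proof. induction l as [|a l IH]; simpl; [reflexivity|]. now rewrite IH. Qed.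

Lemma csum_zero {A} (r : A -> C) l : (forall a, In a l -> r a = RtoC 0) -> csum r l = RtoC 0.
Proof.
  induction l as [|a l IH]; intros H; [reflexivity|]. simpl. rewrite H by now left.
  rewrite IH; [ring|]. intros b Hb. apply H. now right.
Qed.

Lemma csum_single {A} (r : A -> C) l a : NoDup l -> In a l ->
  (forall b, In b l -> b <> a -> r b = RtoC 0) -> csum r l = r a.
Proof.
  induction l as [|b l IH]; intros Hn Ha H; [destruct Ha|].
  inversion Hn as [|? ? Hb Hl]; subst. simpl. destruct Ha as [->|Ha].
  - rewrite csum_zero; [ring|]. intros c Hc. apply H; [now right|]. intros ->. tauto.
  - rewrite IH; auto.
    + rewrite H; [ring|now left|]. intros ->. tauto.
    + intros c Hc. apply H. now right.
Qed.

Lemma csum_le {A} (r : A -> C) (g : A -> R) l : (forall a, In a l -> Cmod (r a) <= g a) ->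
  Cmod (csum r l) <= rsum g l.
Proof.
  induction l as [|a l IH]; intros H; simpl; [rewrite Cmod_0; lra|].
  eapply Rle_trans; [apply Cmod_triangle|]. apply Rplus_le_compat; [apply H; now left|].
  apply IH. intros b Hb. apply H. now right.
Qed.

Lemma rsum_le {A} (f g : A -> R) l : (forall a, In a l -> f a <= g a) -> rsum f l <= rsum g l.
Proof.
  induction l as [|a l IH]; intros H; simpl; [lra|].
  apply Rplus_le_compat; [apply H; now left|]. apply IH. intros b Hb. apply H. now right.
Qed.

Lemma rsum_scal {A} c (f : A -> R) l : rsum (fun a => c * f a) l = c * rsum f l.
Proof. induction l as [|a l IH]; simpl; [ring|]. rewrite IH. ring. Qed.

Lemma rsum_app {A} (r : A -> R) l l' : rsum r (l ++ l') = rsum r l + rsum r l'.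
Proof. induction l as [|a l IH]; simpl; [ring|]. rewrite IH. ring. Qed.

(** A discrete integral test: the increments of [T] dominate [g]. The case [a = b + 1] covers the
    empty sum. *)
Lemma rsum_telescope (g T : Z -> R) a b : (a <= b + 1)%Z ->
  (forall k, (a <= k <= b)%Z -> g k <= T (k + 1)%Z - T k) -> rsum g (zlist a b) <= T (b + 1)%Z - T a.
Proof.
  intros Hab H. unfold zlist.
  assert (G : forall n, (n <= Z.to_nat (b - a + 1))%nat ->
    rsum g (map (fun j : nat => (a + Z.of_nat j)%Z) (seq 0 n)) <= T (a + Z.of_nat n)%Z - T a).
  { induction n as [|n IH]; intros Hn.
    - simpl. rewrite Z.add_0_r. lra.
    - rewrite seq_S, map_app, rsum_app. simpl rsum.
      specialize (IH ltac:(lia)). specialize (H (a + Z.of_nat n)%Z ltac:(lia)).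
      replace (a + Z.of_nat (S n))%Z with (a + Z.of_nat n + 1)%Z by lia. simpl in *. lra. }
  specialize (G _ (Nat.le_refl _)).
  replace (a + Z.of_nat (Z.to_nat (b - a + 1)))%Z with (b + 1)%Z in G by lia. exact G.
Qed.

(** * Sinc interpolation by residues *)

(** The sign $(-1)^k$ enters only through its square, which avoids a parity analysis. *)
Lemma cos_IZR_PI k : cos (IZR k * PI) * cos (IZR k * PI) = 1.
Proof.
  assert (H := sin2_cos2 (IZR k * PI)). unfold Rsqr in H.
  rewrite (sin_eq_0_1 (IZR k * PI)) in H by now exists k. lra.
Qed.

Lemma sin_half_PI k : Rabs (sin ((IZR k + 1 / 2) * PI)) = 1.
Proof.
  replace ((IZR k + 1 / 2) * PI) with (PI / 2 + IZR k * PI) by field.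
  rewrite <- cos_sin. assert (H := cos_IZR_PI k).
  rewrite <- sqrt_Rsqr_abs. unfold Rsqr. rewrite H. apply sqrt_1.
Qed.

Lemma cos_half_PI k : cos ((IZR k + 1 / 2) * PI) = 0.
Proof.
  replace ((IZR k + 1 / 2) * PI) with (IZR k * PI + PI / 2) by field.
  rewrite cos_plus, cos_PI2, (sin_eq_0_1 (IZR k * PI)) by now exists k. ring.
Qed.

Lemma has_residue_ext_loc G H p r del : 0 < del ->
  (forall z, z <> RtoC p -> Cmod (z - p) < del -> G z = H z) -> has_residue G p r -> has_residue H p r.
Proof.
  intros Hd E HG eps He. destruct (HG eps He) as [d2 [H2 W]].
  exists (Rmin del d2). split; [now apply Rmin_glb_lt|]. intros z Hz Hm. rewrite <- E.
  - apply W; [exact Hz|]. eapply Rlt_le_trans; [exact Hm|apply Rmin_r].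
  - exact Hz.
  - eapply Rlt_le_trans; [exact Hm|apply Rmin_l].
Qed.

Lemma cderiv_csin_scal (k : R) z : cderiv (fun w => csin (k * w)) z (ccos (k * z) * k)%C.
Proof. apply (cderiv_comp (fun w => (k * w)%C) csin); [apply cderiv_scal|apply cderiv_csin]. Qed.

Definition cauchy_integrand (F : C -> C) (k t : R) (z : C) : C := (F z / csin (k * z) / (z - t))%C.

Lemma csin_scal_zero (h : R) z : 0 < h -> csin (RtoC (PI / h) * z) = RtoC 0 ->
  exists j, z = RtoC (IZR j * h).
Proof.
  intros Hh E. generalize PI_RGT_0; intros HP.
  assert (Hk : PI / h <> 0) by (apply Rgt_not_eq, Rdiv_lt_0_compat; lra).
  apply csin_zero in E. destruct E as [E1 E2].
  rewrite im_scal_l in E1. rewrite re_scal_l in E2.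
  destruct (sin_eq_0_0 _ E2) as [j Hj]. exists j.
  apply injective_projections; simpl.
  - apply Rmult_eq_reg_l with (PI / h); [|exact Hk].
    unfold Re in Hj. rewrite Hj. field. lra.
  - unfold Im in E1. apply Rmult_integral in E1. tauto.
Qed.

Lemma grid_in_range h m j : 0 < h -> Rabs (IZR j * h) <= (IZR m + 1 / 2) * h -> (- m <= j <= m)%Z.
Proof.
  intros Hh H. rewrite Rabs_mult, (Rabs_pos_eq h) in H by lra.
  apply Rmult_le_reg_r in H; [|exact Hh]. apply Rabs_le_between in H.
  split.
  - apply Z.lt_succ_r, lt_IZR. rewrite succ_IZR. rewrite opp_IZR. lra.
  - apply Z.lt_succ_r, lt_IZR. rewrite succ_IZR. lra.
Qed.

Lemma residue_at_t F (k t : R) : cdiff F (RtoC t) -> sin (k * t) <> 0 ->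
  has_residue (cauchy_integrand F k t) t (F (RtoC t) / RtoC (sin (k * t)))%C.
Proof.
  intros HF Hs. unfold cauchy_integrand.
  assert (E : csin (k * t) = RtoC (sin (k * t))) by (rewrite <- RtoC_mult; apply csin_RtoC).
  rewrite <- E. apply (has_residue_cont (fun z => (F z / csin (k * z))%C)).
  apply cdiff_ccont, cdiff_div.
  - rewrite E. intros E0. apply RtoC_inj in E0. tauto.
  - exact HF.
  - eexists. apply cderiv_csin_scal.
Qed.

(** The factor [phi] in the Caratheodory form of the sine at [p] is exactly the sine divided by
    [z - p]. It equals [cos (k * p) * k] at [p], so the pole is simple. *)
Lemma residue_at_zero F (k t p : R) : cdiff F (RtoC p) -> k <> 0 -> t <> p -> sin (k * p) = 0 ->
  cos (k * p) <> 0 ->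
  has_residue (cauchy_integrand F k t) p (F (RtoC p) / RtoC (cos (k * p) * k) / RtoC (p - t))%C.
Proof.
  intros HF Hk Ht Hs Hc. destruct (cderiv_csin_scal k (RtoC p)) as [phi [Cphi [E0 E]]].
  rewrite <- RtoC_mult, csin_RtoC, Hs in E. rewrite <- RtoC_mult, ccos_RtoC, <- RtoC_mult in E0.
  assert (Hn : phi (RtoC p) <> RtoC 0).
  { rewrite E0. intros E1. apply RtoC_inj in E1. apply Rmult_integral in E1. tauto. }
  assert (Hpt : (RtoC p - RtoC t)%C <> RtoC 0).
  { apply Cminus_eq_contra. intros E1. apply RtoC_inj in E1. lra. }
  destruct (proj1 (ccont_eps phi p) Cphi _ (proj1 (Cmod_gt_0 _) Hn)) as [del [Hd Hw]].
  rewrite <- E0, RtoC_minus.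
  apply has_residue_ext_loc with (del := Rmin del (Rabs (p - t)))
    (G := fun z => (F z / phi z / (z - t) / (z - p))%C).
  - apply Rmin_glb_lt; [exact Hd|]. apply Rabs_pos_lt. lra.
  - intros z Hz Hm. unfold cauchy_integrand. rewrite (E z).
    assert (N1 : phi z <> RtoC 0).
    { intros E1. specialize (Hw z (Rlt_le_trans _ _ _ Hm (Rmin_l _ _))). rewrite E1 in Hw.
      replace (0 - phi (RtoC p))%C with (- phi (RtoC p))%C in Hw by ring. rewrite Cmod_opp in Hw. lra. }
    assert (N2 : (z - t)%C <> RtoC 0).
    { intros E1. assert (Hm2 := Rlt_le_trans _ _ _ Hm (Rmin_r _ _)).
      apply (Rlt_irrefl (Rabs (p - t))).
      replace (Rabs (p - t)) with (Cmod (z - p)) at 1; [exact Hm2|].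
      replace (z - p)%C with ((z - t) - RtoC (p - t))%C by (rewrite RtoC_minus; ring).
      rewrite E1. replace (0 - RtoC (p - t))%C with (- RtoC (p - t))%C by ring.
      now rewrite Cmod_opp, Cmod_R. }
    assert (N3 := Cminus_eq_contra _ _ Hz).
    field. repeat split; try assumption.
  - apply (has_residue_cont (fun z => (F z / phi z / (z - t))%C)).
    apply ccont_div; [apply ccont_div; [now apply cdiff_ccont|exact Cphi|exact Hn]| |exact Hpt].
    apply ccont_minus; [apply continuous_id|apply ccont_const].
Qed.

Lemma sinc_shift (h : R) t k : 0 < h -> t <> IZR k * h ->
  sin (PI / h * t) / (cos (PI / h * (IZR k * h)) * (PI / h)) / (IZR k * h - t)
  = - sinc (PI * (t / h - IZR k)).
Proof.
  intros Hh Ht. generalize PI_RGT_0; intros HP.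
  replace (PI / h * (IZR k * h)) with (IZR k * PI) by (field; lra).
  assert (Hd : t / h - IZR k <> 0).
  { intros E. apply Ht. replace t with (t / h * h) by (field; lra). f_equal. lra. }
  rewrite sinc_nz by (apply Rmult_integral_contrapositive; split; lra).
  replace (PI * (t / h - IZR k)) with (PI / h * t - IZR k * PI) at 1 by (field; lra).
  rewrite sin_minus, (sin_eq_0_1 (IZR k * PI)) by now exists k.
  assert (H := cos_IZR_PI k). set (c := cos (IZR k * PI)) in *.
  assert (Hc : c <> 0) by (intros E; rewrite E in H; lra).
  (* Since [c * c = 1], the cosine may move from the denominator to the numerator, where the
     addition formula puts it. *)
  replace (sin (PI / h * t) / (c * (PI / h)) / (IZR k * h - t))
   with (sin (PI / h * t) * c * / (c * c) / (PI / h) / (IZR k * h - t)).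
  - rewrite H. field. repeat split; try lra.
  - field. repeat split; try lra.
Qed.

Definition interp_error (F : C -> C) (h : R) (m : Z) (t : R) : C :=
  (F (RtoC t) - csum (fun k => F (RtoC (IZR k * h)) * RtoC (sinc (PI * (t / h - IZR k)))) (zlist (- m) m))%C.

Lemma interp_error_residues F h del m t : 0 < h -> 0 < del -> (0 <= m)%Z ->
  (forall z, Rabs (Im z) <= del -> cdiff F z) ->
  Rabs t < (IZR m + 1 / 2) * h -> sin (PI / h * t) <> 0 ->
  (2 * PI * Ci * interp_error F h m t)%C =
  (RtoC (sin (PI / h * t)) * rectInt (cauchy_integrand F (PI / h) t)
     (- ((IZR m + 1 / 2) * h)) ((IZR m + 1 / 2) * h) (- del) del)%C.
Proof.
  intros Hh Hdel Hm HF Ht Hs. generalize PI_RGT_0; intros HP.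
  set (L := (IZR m + 1 / 2) * h) in *. set (k := PI / h) in *.
  assert (Hk : k <> 0) by (apply Rgt_not_eq, Rdiv_lt_0_compat; lra).
  assert (Hm' := IZR_le 0 m Hm).
  assert (HL : 0 < L) by (unfold L; apply Rmult_lt_0_compat; lra).
  apply Rabs_lt_between in Ht.
  (* One residue function for both kinds of poles. The test is unambiguous because
     [sin (k * t) <> 0] keeps [t] off the grid. *)
  set (r := fun p : R => if Req_EM_T p t then (F (RtoC t) / RtoC (sin (k * t)))%C
     else (F (RtoC p) / RtoC (cos (k * p) * k) / RtoC (p - t))%C).
  set (g := map (fun j => IZR j * h) (zlist (- m) m)).
  assert (Hsin : forall j, sin (k * (IZR j * h)) = 0).
  { intros j. apply sin_eq_0_1. exists j. unfold k. field. lra. }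
  assert (Hg : forall p, In p g -> sin (k * p) = 0 /\ cos (k * p) <> 0 /\ - L < p < L).
  { intros p Hp. apply in_map_iff in Hp. destruct Hp as [j [<- Hj]]. apply zlist_In in Hj.
    split; [apply Hsin|]. split.
    - replace (k * (IZR j * h)) with (IZR j * PI) by (unfold k; field; lra).
      intros E. assert (H := cos_IZR_PI j). rewrite E in H. lra.
    - assert (J1 := IZR_le _ _ (proj1 Hj)). assert (J2 := IZR_le _ _ (proj2 Hj)).
      rewrite opp_IZR in J1. unfold L. split; nra. }
  assert (Htg : ~ In t g) by (intros H; apply Hg in H; tauto).
  assert (Hreal : forall p : R, cdiff F (RtoC p)).
  { intros p. apply HF. simpl. rewrite Rabs_R0. lra. }
  rewrite (rectInt_residues _ (- del) del (- L) L r (t :: g) nil); try lra.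
  - unfold interp_error. simpl csum. unfold r at 1. destruct Req_EM_T as [_|n]; [|now elim n].
    unfold g at 1. rewrite csum_map.
    assert (E : (RtoC (sin (k * t)) * csum (fun j => r (IZR j * h)%R) (zlist (- m) m))%C =
      (- csum (fun k => F (RtoC (IZR k * h)) * RtoC (sinc (PI * (t / h - IZR k)))) (zlist (- m) m))%C).
    { replace (- csum _ _)%C with (- (1) * csum (fun k => F (RtoC (IZR k * h)) *
        RtoC (sinc (PI * (t / h - IZR k)))) (zlist (- m) m))%C by ring.
      rewrite <- !csum_scal. apply csum_ext. intros j Hj.
      assert (Hin : In (IZR j * h) g) by (apply (in_map (fun j => IZR j * h)); exact Hj).
      destruct (Hg _ Hin) as [_ [Hc _]].
      assert (Hjt : t <> IZR j * h) by (intros E; rewrite <- E in Hin; tauto).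
      unfold r. destruct Req_EM_T as [e|_]; [now elim Hjt|].
      assert (S := sinc_shift h t j Hh Hjt). fold k in S.
      assert (Hd : IZR j * h - t <> 0) by lra.
      assert (Hck : cos (k * (IZR j * h)) * k <> 0) by (apply Rmult_integral_contrapositive; tauto).
      replace (sinc (PI * (t / h - IZR j)))
        with (- (sin (k * t) / (cos (k * (IZR j * h)) * k) / (IZR j * h - t))) by lra.
      rewrite RtoC_opp, !RtoC_div by assumption.
      field. split; intros E; apply RtoC_inj in E; tauto. }
    transitivity (2 * PI * Ci * (F (RtoC t) / RtoC (sin (k * t)) * RtoC (sin (k * t))
      + RtoC (sin (k * t)) * csum (fun j => r (IZR j * h)%R) (zlist (- m) m)))%C; [|ring].
    rewrite E. field. intros E0. apply RtoC_inj in E0. tauto.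
  - rewrite app_nil_r. constructor; [exact Htg|].
    apply FinFun.Injective_map_NoDup; [|apply zlist_NoDup].
    intros i j H. apply eq_IZR. apply Rmult_eq_reg_r with h; lra.
  - rewrite app_nil_r. intros p [<-|Hp]; [lra|]. now apply Hg.
  - rewrite app_nil_r. intros z [Hz1 Hz2] Ho. unfold cauchy_integrand.
    apply cdiff_div; [|apply cdiff_div|].
    + apply Cminus_eq_contra. apply Ho. now left.
    + intros E. destruct (csin_scal_zero h z Hh E) as [j Hj].
      apply (Ho (IZR j * h)); [|exact Hj]. right. apply (in_map (fun j => IZR j * h)).
      apply zlist_In. apply (grid_in_range h); [exact Hh|].
      apply Rabs_le. rewrite Hj in Hz1. simpl in Hz1. exact Hz1.
    + apply HF. apply Rabs_le. exact Hz2.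
    + eexists. apply cderiv_csin_scal.
    + apply cdiff_minus; [apply cdiff_id|apply cdiff_const].
  - intros p [].
  - intros p [<-|Hp].
    + unfold r. destruct Req_EM_T as [_|n]; [|now elim n]. now apply residue_at_t.
    + unfold r. destruct Req_EM_T as [e|n]; [subst; tauto|].
      destruct (Hg p Hp) as [S [Cn _]]. now apply residue_at_zero; auto.
Qed.

Lemma interp_error_grid F h m j : 0 < h -> (- m <= j <= m)%Z -> interp_error F h m (IZR j * h) = RtoC 0.
Proof.
  intros Hh Hj. unfold interp_error.
  rewrite (csum_single _ (zlist (- m) m) j).
  - replace (IZR j * h / h - IZR j) with 0 by (field; lra). rewrite Rmult_0_r, sinc_0. ring.
  - apply zlist_NoDup.
  - now apply zlist_In.
  - intros i _ Hij. generalize PI_RGT_0; intros HP.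
    replace (IZR j * h / h - IZR i) with (IZR (j - i)) by (rewrite minus_IZR; field; lra).
    rewrite sinc_nz.
    + rewrite Rmult_comm with (r1 := PI). rewrite (sin_eq_0_1 (IZR (j - i) * PI)) by now exists (j - i)%Z.
      unfold Rdiv. rewrite Rmult_0_l. ring.
    + apply Rmult_integral_contrapositive. split; [lra|].
      intros E. apply eq_IZR in E. lia.
Qed.

(** When [t] is a node its pole merges with one of the sine and the simple-pole computation fails.
    There both sides vanish: the sine factor on the right, the interpolation error on the left. *)
Lemma interp_error_rect F h del m t : 0 < h -> 0 < del -> (0 <= m)%Z ->
  (forall z, Rabs (Im z) <= del -> cdiff F z) -> Rabs t < (IZR m + 1 / 2) * h ->
  (2 * PI * Ci * interp_error F h m t)%C =
  (RtoC (sin (PI / h * t)) * rectInt (cauchy_integrand F (PI / h) t)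
     (- ((IZR m + 1 / 2) * h)) ((IZR m + 1 / 2) * h) (- del) del)%C.
Proof.
  intros Hh Hdel Hm HF Ht.
  destruct (Req_dec (sin (PI / h * t)) 0) as [E|n]; [|now apply interp_error_residues].
  generalize PI_RGT_0; intros HP.
  destruct (sin_eq_0_0 _ E) as [j Hj].
  assert (Et : t = IZR j * h).
  { replace t with (PI / h * t * h / PI) by (field; lra). rewrite Hj. field. lra. }
  rewrite E. rewrite Et, interp_error_grid; [ring|exact Hh|].
  apply (grid_in_range h); [exact Hh|]. rewrite <- Et. lra.
Qed.

(** * Error of the integrated sinc interpolant *)

Lemma is_RInt_exp (c k a b : R) : k <> 0 ->
  is_RInt (fun s => c * exp (k * s)) a b (c / k * exp (k * b) - c / k * exp (k * a)).
Proof.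
  intros Hk. apply (is_RInt_derive (fun s => c / k * exp (k * s))).
  - intros s _. auto_derive; [trivial|]. toR. field. exact Hk.
  - intros s _. apply (ex_derive_continuous (V := R_NormedModule)). auto_derive. trivial.
Qed.

Lemma CInt_exp_bound (G : R -> C) c al be L : 0 <= c -> 0 < al -> 0 < be -> 0 <= L ->
  (forall s, ccont G s) ->
  (forall s, Cmod (G s) <= c * exp (al * s)) -> (forall s, Cmod (G s) <= c * exp (- be * s)) ->
  Cmod (CInt G (- L) L) <= c * (1 / al + 1 / be).
Proof.
  intros Hc Ha Hb HL HG H1 H2.
  rewrite <- (CInt_Chasles G (- L) 0 L) by (intros s _; apply HG).
  eapply Rle_trans; [apply Cmod_triangle|].
  rewrite Rmult_plus_distr_l. apply Rplus_le_compat.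
  - assert (I := is_RInt_exp c al (- L) 0 ltac:(lra)).
    eapply Rle_trans.
    + apply (CInt_le G (fun s => c * exp (al * s))); [lra|intros s _; apply HG|eexists; exact I|].
      intros; apply H1.
    + rewrite (is_RInt_unique (V := R_CompleteNormedModule) _ _ _ _ I), Rmult_0_r, exp_0.
      assert (0 <= c / al * exp (al * - L)).
      { apply Rmult_le_pos; [|left; apply exp_pos].
        apply Rmult_le_pos; [exact Hc|left; now apply Rinv_0_lt_compat]. }
      unfold Rdiv in *. lra.
  - assert (I := is_RInt_exp c (- be) 0 L ltac:(lra)).
    eapply Rle_trans.
    + apply (CInt_le G (fun s => c * exp (- be * s))); [lra|intros s _; apply HG|eexists; exact I|].
      intros; apply H2.
    + rewrite (is_RInt_unique (V := R_CompleteNormedModule) _ _ _ _ I), Rmult_0_r, exp_0.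
      assert (0 <= c / be * exp (- be * L)).
      { apply Rmult_le_pos; [|left; apply exp_pos].
        apply Rmult_le_pos; [exact Hc|left; now apply Rinv_0_lt_compat]. }
      replace (c / - be) with (- (c / be)) by (field; lra).
      unfold Rdiv in *. lra.
Qed.

(** The first bound is meant for the left end of the strip, the second for the right end. Asking for
    both everywhere avoids a case split on the sign of [Re z]. *)
Definition decays (F : C -> C) (d B al be : R) : Prop := forall z, Rabs (Im z) < d ->
  Cmod (F z) <= B * exp (al * Re z) /\ Cmod (F z) <= B * exp (- be * Re z).

Lemma csin_scal_nz (k : R) z : k <> 0 -> Im z <> 0 -> csin (k * z) <> RtoC 0.
Proof.
  intros Hk Hz E. apply csin_zero in E. rewrite im_scal_l in E.
  destruct E as [E _]. apply Rmult_integral in E. tauto.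
Qed.

Lemma cdiff_csin_scal (k : R) z : cdiff (fun w => csin (k * w)) z.
Proof. eexists. apply cderiv_csin_scal. Qed.

Lemma ccont2_cauchy F d k y : k <> 0 -> y <> 0 -> Rabs y < d ->
  (forall z, Rabs (Im z) < d -> cdiff F z) ->
  ccont2 (fun t s => (RtoC (sin (k * t)) * cauchy_integrand F k t (s, y))%C).
Proof.
  intros Hk Hy Hyd HF [t s]. unfold cauchy_integrand.
  set (U := prod_UniformSpace R_UniformSpace R_UniformSpace).
  assert (C1 : continuous (T := U) (U := R_UniformSpace) (fun p => fst p) (t, s))
    by apply (@continuous_fst R_UniformSpace R_UniformSpace).
  assert (C2 : continuous (T := U) (U := R_UniformSpace) (fun p => snd p) (t, s))
    by apply (@continuous_snd R_UniformSpace R_UniformSpace).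
  assert (CZ : ccont (U := U) (fun p => (snd p, y) : C) (t, s)).
  { apply ccont_pair; [exact C2|apply continuous_const]. }
  apply ccont_mult.
  - apply ccont_RtoC_comp.
    apply (continuous_comp (fun p : U => fst p) (fun t => sin (k * t))); [exact C1|apply continuous_sin_lin].
  - apply ccont_div; [apply ccont_div| |].
    + apply (ccont_comp (U := U) (fun p => (snd p, y)) F); [exact CZ|].
      apply cdiff_ccont, HF. exact Hyd.
    + apply (ccont_comp (U := U) (fun p => (snd p, y)) (fun w => csin (k * w))); [exact CZ|].
      apply cdiff_ccont, cdiff_csin_scal.
    + apply csin_scal_nz; [exact Hk|exact Hy].
    + apply ccont_minus; [exact CZ|now apply ccont_RtoC_comp].
    + apply RtoC_ne_off_axis. exact Hy.
Qed.

Lemma ccont_h_quot F d k y s : k <> 0 -> y <> 0 -> Rabs y < d ->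
  (forall z, Rabs (Im z) < d -> cdiff F z) -> ccont (fun s => (F (s, y) / csin (k * (s, y)))%C) s.
Proof.
  intros Hk Hy Hyd HF.
  apply ccont_div.
  - apply (ccont_comp (fun s => (s, y)) F); [apply ccont_hline|]. apply cdiff_ccont, HF. exact Hyd.
  - apply (ccont_comp (fun s => (s, y)) (fun w => csin (k * w))); [apply ccont_hline|].
    apply cdiff_ccont, cdiff_csin_scal.
  - apply csin_scal_nz; [exact Hk|exact Hy].
Qed.

Lemma sinh_pos x : 0 < x -> 0 < sinh x.
Proof. intros H. unfold sinh. assert (exp (- x) < exp x) by (apply exp_increasing; lra). lra. Qed.

Lemma Rabs_sinh x : Rabs (sinh x) = sinh (Rabs x).
Proof.
  assert (O : forall x, sinh (- x) = - sinh x) by (intros; unfold sinh; rewrite Ropp_involutive; field).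
  destruct (Rlt_dec 0 x) as [H|H]; [|destruct (Req_dec x 0) as [->|n]].
  - rewrite !Rabs_pos_eq; [reflexivity|lra|left; now apply sinh_pos].
  - rewrite Rabs_R0, sinh_0. apply Rabs_R0.
  - rewrite (Rabs_left x) by lra. rewrite O, Rabs_left; [reflexivity|].
    assert (P := sinh_pos (- x) ltac:(lra)). rewrite O in P. lra.
Qed.

(** The oscillating [t]-integral is done first and is uniformly bounded by [kernel_bound]. The
    [s]-integral then converges by the decay of [F], so the estimate is uniform in [a], [b] and
    [L]. *)
Lemma horizontal_side F d B al be k y a b L : 0 < k -> y <> 0 -> Rabs y < d ->
  (forall z, Rabs (Im z) < d -> cdiff F z) -> decays F d B al be -> 0 <= B -> 0 < al -> 0 < be ->
  a <= b -> 0 <= L -> cos (k * a) = 0 ->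
  Cmod (CInt (fun t => CInt (fun s => (RtoC (sin (k * t)) * cauchy_integrand F k t (s, y))%C) (- L) L) a b)
  <= B / sinh (k * Rabs y) * ((1 + PI) / (k * Rabs y)) * (1 / al + 1 / be).
Proof.
  intros Hk Hy Hyd HF HB HB0 Hal Hbe Hab HL Ha.
  assert (Hr : 0 < Rabs y) by now apply Rabs_pos_lt.
  assert (Hsh : 0 < sinh (k * Rabs y)) by (apply sinh_pos, Rmult_lt_0_compat; assumption).
  assert (CC := ccont2_cauchy F d k y ltac:(lra) Hy Hyd HF).
  rewrite (CInt_fubini _ a b (- L) L CC).
  assert (E : forall s, CInt (fun t => (RtoC (sin (k * t)) * cauchy_integrand F k t (s, y))%C) a b =
    (F (s, y) / csin (k * (s, y)) * CInt (fun t => (RtoC (sin (k * t)) * / ((s, y) - t))%C) a b)%C).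
  { intros s. rewrite <- CInt_scal.
    - apply CInt_ext. intros t _. unfold cauchy_integrand, Cdiv. ring.
    - intros t _. apply ccont_mult; [apply ccont_RtoC_comp, continuous_sin_lin|now apply ccont_kernel]. }
  assert (Bd : forall s e, Cmod (F (s, y)) <= B * e -> 0 <= e -> Cmod (CInt (fun t => (RtoC (sin (k * t))
     * cauchy_integrand F k t (s, y))%C) a b) <= B / sinh (k * Rabs y) * ((1 + PI) / (k * Rabs y)) * e).
  { intros s e He He0. rewrite E, Cmod_mult.
    assert (K := kernel_bound (s, y) k a b Hy Hk Hab Ha).
    assert (S := Cmod_csin_sinh (k * (s, y))). rewrite im_scal_l in S.
    change (Im (s, y)) with y in S, K.
    rewrite Rabs_sinh, Rabs_mult, (Rabs_pos_eq k) in S by lra.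
    rewrite Cmod_div by (apply csin_scal_nz; [lra|exact Hy]).
    replace (B / sinh (k * Rabs y) * ((1 + PI) / (k * Rabs y)) * e)
      with (B * e / sinh (k * Rabs y) * ((1 + PI) / (k * Rabs y))) by (unfold Rdiv; ring).
    apply Rmult_le_compat; [|apply Cmod_ge_0| |exact K].
    - apply Rmult_le_pos; [apply Cmod_ge_0|]. left. apply Rinv_0_lt_compat. lra.
    - apply Rmult_le_compat; [apply Cmod_ge_0| |exact He|].
      + left. apply Rinv_0_lt_compat. lra.
      + apply Rinv_le_contravar; assumption. }
  apply CInt_exp_bound; try assumption.
  - generalize PI_RGT_0. intros HP. apply Rmult_le_pos; apply Rmult_le_pos; try lra; left;
      apply Rinv_0_lt_compat; try assumption. now apply Rmult_lt_0_compat.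
  - intros s. apply (ccont_CInt_param (fun s t => (RtoC (sin (k * t)) * cauchy_integrand F k t (s, y))%C)
    a b s).
    intros [s' t']. 
    apply (ccont_comp (U := prod_UniformSpace R_UniformSpace R_UniformSpace) (fun p => (snd p, fst p))
      (fun p => (RtoC (sin (k * fst p)) * cauchy_integrand F k (fst p) (snd p, y))%C)).
    + apply ccont_pair;
        [apply (@continuous_snd R_UniformSpace R_UniformSpace)|apply (@continuous_fst R_UniformSpace
          R_UniformSpace)].
    + apply CC.
  - intros s. apply Bd; [|left; apply exp_pos]. apply (HB (s, y) Hyd).
  - intros s. apply Bd; [|left; apply exp_pos]. apply (HB (s, y) Hyd).
Qed.

Lemma vertical_side F d B al be k t del x D e : 0 < del < d ->
  (forall z, Rabs (Im z) < d -> cdiff F z) -> decays F d B al be ->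
  k <> 0 -> Rabs (sin (k * x)) = 1 -> 0 < D -> D <= Rabs (x - t) -> 
  (B * exp (al * x) <= e \/ B * exp (- be * x) <= e) ->
  Cmod (CInt (fun y => cauchy_integrand F k t (x, y)) (- del) del) <= 2 * del * (e / D).
Proof.
  intros Hd HF HB Hk Hs HD HDx He.
  replace (2 * del) with (del - - del) by ring.
  assert (Hsn : forall y, 1 <= Cmod (csin (k * (x, y)))).
  { intros y. rewrite <- Hs. replace (k * x) with (Re (k * (x, y))%C) by (rewrite re_scal_l; reflexivity).
    apply Cmod_csin_sin. }
  assert (Hnz : forall y, csin (k * (x, y)) <> RtoC 0).
  { intros y. apply Cmod_gt_0. specialize (Hsn y). lra. }
  assert (Hdist : forall y, D <= Cmod ((x, y) - t)).
  { intros y. eapply Rle_trans; [exact HDx|]. apply (re_le_Cmod ((x, y) - t)). }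
  assert (Hnt : forall y, ((x, y) - t)%C <> RtoC 0).
  { intros y. apply Cmod_gt_0. specialize (Hdist y). lra. }
  apply CInt_le_const; [lra| |].
  - intros y Hy. rewrite Rmin_left, Rmax_right in Hy by lra.
    apply (ccont_comp (fun y => (x, y)) (cauchy_integrand F k t)); [apply ccont_vline|].
    apply cdiff_ccont. unfold cauchy_integrand.
    apply cdiff_div; [apply Hnt|apply cdiff_div|].
    + apply Hnz.
    + apply HF. simpl. apply Rabs_def1; lra.
    + apply cdiff_csin_scal.
    + apply cdiff_minus; [apply cdiff_id|apply cdiff_const].
  - intros y Hy. unfold cauchy_integrand. rewrite Cmod_div by apply Hnt.
    rewrite Cmod_div by apply Hnz.
    assert (Hfe : Cmod (F (x, y)) <= e).
    { destruct (HB (x, y)) as [H1 H2]; [simpl; apply Rabs_def1; lra|]. simpl in H1, H2.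
      destruct He; lra. }
    apply Rmult_le_compat.
    + apply Rmult_le_pos; [apply Cmod_ge_0|]. left. apply Rinv_0_lt_compat. generalize (Hsn y). lra.
    + left. apply Rinv_0_lt_compat. generalize (Hdist y). lra.
    + replace e with (e * / 1) by field. apply Rmult_le_compat; [apply Cmod_ge_0| |exact Hfe|].
      * left. apply Rinv_0_lt_compat. generalize (Hsn y). lra.
      * apply Rinv_le_contravar; [lra|apply Hsn].
    + apply Rinv_le_contravar; [exact HD|apply Hdist].
Qed.

Lemma ccont_csum {A} (r : A -> R -> C) l t : (forall a, ccont (r a) t) ->
  ccont (fun t => csum (fun a => r a t) l) t.
Proof.
  intros H. induction l as [|a l IH]; [apply ccont_const|]. simpl. apply ccont_plus; [apply H|exact IH].
Qed.

Lemma CInt_csum {A} (r : A -> R -> C) l a b : (forall i t, ccont (r i) t) ->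
  CInt (fun t => csum (fun i => r i t) l) a b = csum (fun i => CInt (r i) a b) l.
Proof.
  intros H. induction l as [|i l IH]; simpl.
  - unfold CInt, RtoC. simpl. f_equal; rewrite RInt_const; apply (scal_zero_r (V := R_ModuleSpace)).
  - rewrite CInt_plus; [now rewrite IH|intros t _; apply H|].
    intros t _. apply (ccont_csum r); intros; apply H.
Qed.

Lemma continuous_sinc_shift h k t : 0 < h -> continuous (fun t => sinc (PI * (t / h - IZR k))) t.
Proof.
  intros Hh. apply (continuous_comp (fun t => PI * (t / h - IZR k)) sinc); [|apply continuous_sinc].
  apply (ex_derive_continuous (V := R_NormedModule)). auto_derive. trivial.
Qed.

Lemma CInt_RtoC f a b l : is_RInt f a b l -> CInt (fun t => RtoC (f t)) a b = RtoC l.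
Proof.
  intros H. unfold CInt, RtoC. simpl. f_equal.
  - apply is_RInt_unique. exact H.
  - rewrite RInt_const; apply (scal_zero_r (V := R_ModuleSpace)).
Qed.

Lemma CInt_interp_error F h m a b : 0 < h -> (forall t : R, cdiff F (RtoC t)) ->
  CInt (interp_error F h m) a b =
  (CInt (fun t => F (RtoC t)) a b
   - csum (fun k => F (RtoC (IZR k * h)) * RtoC (Jfun k h b - Jfun k h a)) (zlist (- m) m))%C /\
  (forall t, ccont (interp_error F h m) t).
Proof.
  intros Hh HF.
  assert (CF : forall t, ccont (fun t => F (RtoC t)) t).
  { intros t. apply (ccont_comp RtoC F); [apply ccont_RtoC|apply cdiff_ccont, HF]. }
  assert (CS : forall k t, ccont (fun t => (F (RtoC (IZR k * h)) * RtoC (sinc (PI * (t / h - IZR k))))%C) t).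
  { intros k t. apply ccont_mult; [apply ccont_const|]. now apply ccont_RtoC_comp, continuous_sinc_shift. }
  assert (CX : forall t, ccont (fun t => csum (fun k =>
    (F (RtoC (IZR k * h)) * RtoC (sinc (PI * (t / h - IZR k))))%C) (zlist (- m) m)) t).
  { intros t. apply (ccont_csum (fun k t => (F (RtoC (IZR k * h)) * RtoC (sinc (PI * (t / h - IZR k))))%C)).
    intros; apply CS. }
  split.
  - unfold interp_error.
    rewrite (CInt_ext _ (fun t => (F (RtoC t) + RtoC (- (1)) * csum (fun k =>
      (F (RtoC (IZR k * h)) * RtoC (sinc (PI * (t / h - IZR k))))%C) (zlist (- m) m))%C)).
    2: { intros. rewrite RtoC_opp. ring. }
    rewrite CInt_plus, CInt_scal.
    + rewrite (CInt_csum (fun k t => (F (RtoC (IZR k * h)) * RtoC (sinc (PI * (t / h - IZR k))))%C))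
        by (intros; apply CS).
      rewrite (csum_ext (fun k => CInt _ a b)
        (fun k => (F (RtoC (IZR k * h)) * RtoC (Jfun k h b - Jfun k h a))%C)).
      * rewrite RtoC_opp. ring.
      * intros k _. rewrite CInt_scal.
        -- f_equal. now apply CInt_RtoC, is_RInt_Jfun.
        -- intros t _. now apply ccont_RtoC_comp, continuous_sinc_shift.
    + intros t _. apply CX.
    + intros t _. apply CF.
    + intros t _. apply ccont_mult; [apply ccont_const|apply CX].
  - intros t. apply ccont_minus; [apply CF|apply CX].
Qed.

Lemma sinc_quadrature_finite F d B al be h del m a b rho :
  0 < h -> 0 < del < d -> (0 <= m)%Z -> 0 <= B -> 0 < al -> 0 < be ->
  (forall z, Rabs (Im z) < d -> cdiff F z) -> decays F d B al be ->
  a <= b -> Rabs a <= rho -> Rabs b <= rho -> rho < (IZR m + 1 / 2) * h -> cos (PI / h * a) = 0 ->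
  Cmod (CInt (fun t => F (RtoC t)) a b
   - csum (fun k => F (RtoC (IZR k * h)) * RtoC (Jfun k h b - Jfun k h a)) (zlist (- m) m))%C <=
  / (2 * PI) * (2 * (B / sinh (PI / h * del) * ((1 + PI) / (PI / h * del)) * (1 / al + 1 / be))
    + (b - a) * (2 * del * (B * exp (- al * ((IZR m + 1 / 2) * h)) / ((IZR m + 1 / 2) * h - rho))
      + 2 * del * (B * exp (- be * ((IZR m + 1 / 2) * h)) / ((IZR m + 1 / 2) * h - rho)))).
Proof.
  intros Hh Hdel Hm HB0 Hal Hbe HF HB Hab Ha Hb Hrho Hcos. generalize PI_RGT_0; intros HP.
  set (L := (IZR m + 1 / 2) * h) in *. set (k := PI / h) in *.
  assert (Hk : 0 < k) by (apply Rdiv_lt_0_compat; lra).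
  assert (HL : 0 < L) by (generalize (Rabs_pos a); lra).
  assert (Hreal : forall t : R, cdiff F (RtoC t)) by (intros t; apply HF; simpl; rewrite Rabs_R0; lra).
  destruct (CInt_interp_error F h m a b Hh Hreal) as [EI CE]. rewrite <- EI.
  set (T := fun y t => CInt (fun s => (RtoC (sin (k * t)) * cauchy_integrand F k t (s, y))%C) (- L) L).
  assert (Hrd : Rabs (- del) < d) by (rewrite Rabs_left; lra).
  assert (Hrd' : Rabs del < d) by (rewrite Rabs_pos_eq; lra).
  assert (CT1 : forall t, ccont (T (- del)) t).
  { intros t. apply ccont_CInt_param, ccont2_cauchy with (d := d); try assumption; lra. }
  assert (CT2 : forall t, ccont (T del) t).
  { intros t. apply ccont_CInt_param, ccont2_cauchy with (d := d); try assumption; lra. }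
  (* The share of the two vertical sides, defined through the other terms so that continuity in [t]
     is immediate. [ET] recovers its integral form for the bound. *)
  set (V := fun t => (2 * PI * Ci * interp_error F h m t + RtoC (- (1)) * T (- del)%R t + T del t)%C).
  assert (CV : forall t, ccont V t).
  { intros t. apply ccont_plus; [apply ccont_plus|apply CT2]; apply ccont_mult; try apply ccont_const;
     [apply CE|apply CT1]. }
  assert (EV : (2 * PI * Ci * CInt (interp_error F h m) a b)%C
     = (CInt V a b + CInt (T (- del)%R) a b - CInt (T del) a b)%C).
  { assert (CE' : forall t, ccont (fun t => (2 * PI * Ci * interp_error F h m t)%C) t).
    { intros t. apply ccont_mult; [apply ccont_const|exact (CE t)]. }
    assert (CT' : forall t, ccont (fun t => (RtoC (- (1)) * T (- del)%R t)%C) t).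
    { intros t. apply ccont_mult; [apply ccont_const|exact (CT1 t)]. }
    assert (E0 : CInt V a b = (2 * PI * Ci * CInt (interp_error F h m) a b
      + RtoC (- (1)) * CInt (T (- del)%R) a b + CInt (T del) a b)%C).
    { rewrite <- (CInt_scal (2 * PI * Ci)%C (interp_error F h m)) by (intros t _; exact (CE t)).
      rewrite <- (CInt_scal (RtoC (- (1))) (T (- del)%R)) by (intros t _; exact (CT1 t)).
      rewrite <- (CInt_plus (fun t => (2 * PI * Ci * interp_error F h m t)%C)
        (fun t => (RtoC (- (1)) * T (- del)%R t)%C)) by (intros t _; exact (CE' t) || exact (CT' t)).
      rewrite <- (CInt_plus _ (T del)); [reflexivity| |intros t _; exact (CT2 t)].
      intros t _. apply ccont_plus; [exact (CE' t)|exact (CT' t)]. }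
    rewrite E0. rewrite RtoC_opp. ring. }
  set (vb := 2 * del * (B * exp (- al * L) / (L - rho)) + 2 * del * (B * exp (- be * L) / (L - rho))).
  assert (BV : Cmod (CInt V a b) <= (b - a) * vb).
  { apply CInt_le_const; [exact Hab|intros t _; apply CV|]. intros t Ht.
    assert (Hta : Rabs t <= rho).
    { apply Rabs_le. apply Rabs_le_between in Ha. apply Rabs_le_between in Hb. lra. }
    assert (ET : V t = (RtoC (sin (k * t)) * (Ci * CInt (fun y => cauchy_integrand F k t (L, y)) (- del)%R del
       - Ci * CInt (fun y => cauchy_integrand F k t ((- L)%R, y)) (- del)%R del))%C).
    { unfold V. rewrite (interp_error_rect F h del m t) by
        (try assumption; try lra; try (intros z Hz; apply HF; lra); fold L; lra).
      fold L k. unfold T, rectInt.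
      assert (HS : forall y, y <> 0 -> Rabs y < d ->
        CInt (fun s => (RtoC (sin (k * t)) * cauchy_integrand F k t (s, y))%C) (- L) L =
        (RtoC (sin (k * t)) * CInt (fun s => cauchy_integrand F k t (s, y)) (- L)%R L)%C).
      { intros y Hy Hyd. apply CInt_scal. intros s _. unfold cauchy_integrand.
        apply ccont_div.
        - apply (ccont_h_quot F d); try assumption; lra.
        - apply ccont_minus; [apply ccont_hline|apply ccont_const].
        - apply RtoC_ne_off_axis. exact Hy. }
      rewrite !HS by (assumption || lra). rewrite RtoC_opp. ring. }
    rewrite ET, Cmod_mult, Cmod_R.
    apply Rle_trans with (1 * vb).
    2: lra.
    apply Rmult_le_compat; [apply Rabs_pos|apply Cmod_ge_0|apply Rabs_le, SIN_bound|].
    unfold Cminus. eapply Rle_trans; [apply Cmod_triangle|].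
    rewrite Cmod_opp, !Cmod_mult, Cmod_Ci, !Rmult_1_l. unfold vb. rewrite Rplus_comm.
    assert (SL : Rabs (sin (k * L)) = 1).
    { replace (k * L) with ((IZR m + 1 / 2) * PI) by (unfold k, L; field; lra). apply sin_half_PI. }
    apply Rabs_le_between in Hta.
    apply Rplus_le_compat.
    - apply (vertical_side F d B al be); try assumption; try lra.
      + replace (k * - L) with (- (k * L)) by ring. now rewrite sin_neg, Rabs_Ropp.
      + rewrite Rabs_left; lra.
      + left. right. f_equal. f_equal. ring.
    - apply (vertical_side F d B al be); try assumption; try lra.
      + rewrite Rabs_pos_eq; lra. }
  assert (B1 := horizontal_side F d B al be k (- del) a b L Hk ltac:(lra) Hrd HF HB HB0 Hal Hbe Hab
    ltac:(lra) Hcos).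
  assert (B2 := horizontal_side F d B al be k del a b L Hk ltac:(lra) Hrd' HF HB HB0 Hal Hbe Hab
    ltac:(lra) Hcos).
  rewrite Rabs_Ropp in B1. rewrite (Rabs_pos_eq del) in B1, B2 by lra.
  fold (T (- del)) in B1. fold (T del) in B2.
  assert (N : Cmod (2 * PI * Ci * CInt (interp_error F h m) a b)%C
     = 2 * PI * Cmod (CInt (interp_error F h m) a b)).
  { rewrite !Cmod_mult, Cmod_Ci, !Cmod_R, !Rabs_pos_eq by lra. ring. }
  rewrite EV in N.
  apply Rmult_le_reg_l with (2 * PI); [lra|]. rewrite <- N.
  rewrite <- Rmult_assoc, Rinv_r, Rmult_1_l by lra.
  unfold Cminus. eapply Rle_trans; [apply Cmod_triangle|]. rewrite Cmod_opp.
  eapply Rle_trans; [apply Rplus_le_compat_r, Cmod_triangle|]. lra.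
Qed.

(** * Truncation tails and the error of the full quadrature *)

Lemma exp_ge_1_plus x : 1 + x <= exp x.
Proof.
  destruct (Req_dec x 0) as [->|n]; [rewrite exp_0; lra|]. left. now apply exp_ineq1.
Qed.

(** A right-endpoint Riemann sum of a decreasing exponential lies below its integral from [N * h].
    The shift by one in [T] encodes the right endpoint. *)
Lemma tail_right be h N M' : 0 < be -> 0 < h -> (N <= M')%Z ->
  rsum (fun k => h * exp (- be * (IZR k * h))) (zlist (N + 1) M') <= exp (- be * (IZR N * h)) / be.
Proof.
  intros Hb Hh HN.
  set (T := fun k => - exp (- be * ((IZR k - 1) * h)) / be).
  eapply Rle_trans; [apply (rsum_telescope _ T); [lia|]|].
  - intros k _. unfold T. rewrite plus_IZR.
    replace (- be * ((IZR k + 1 - 1) * h)) with (- be * (IZR k * h)) by ring.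
    replace (- be * ((IZR k - 1) * h)) with (- be * (IZR k * h) + be * h) by ring.
    rewrite exp_plus. set (E := exp (- be * (IZR k * h))).
    assert (HE : 0 < E) by apply exp_pos.
    assert (H := exp_ge_1_plus (be * h)).
    replace (- E / be - - (E * exp (be * h)) / be) with (E * ((exp (be * h) - 1) / be)) by (field; lra).
    rewrite Rmult_comm. apply Rmult_le_compat_l; [lra|].
    apply Rmult_le_reg_r with be; [exact Hb|]. unfold Rdiv. rewrite Rmult_assoc, Rinv_l by lra. lra.
  - unfold T. rewrite !plus_IZR.
    replace (IZR N + 1 - 1) with (IZR N) by ring.
    assert (0 < exp (- be * ((IZR M' + 1 - 1) * h)) / be) by (apply Rdiv_lt_0_compat; [apply
      exp_pos|exact Hb]).
    unfold Rdiv in *. lra.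
Qed.

Lemma tail_left al h M M' : 0 < al -> 0 < h -> (M <= M')%Z ->
  rsum (fun k => h * exp (al * (IZR k * h))) (zlist (- M') (- M - 1)) <= exp (- al * (IZR M * h)) / al.
Proof.
  intros Ha Hh HM.
  set (T := fun k => exp (al * (IZR k * h)) / al).
  eapply Rle_trans; [apply (rsum_telescope _ T); [lia|]|].
  - intros k _. unfold T. rewrite plus_IZR.
    replace (al * ((IZR k + 1) * h)) with (al * (IZR k * h) + al * h) by ring.
    rewrite exp_plus. set (E := exp (al * (IZR k * h))).
    assert (HE : 0 < E) by apply exp_pos.
    assert (H := exp_ge_1_plus (al * h)).
    replace (E * exp (al * h) / al - E / al) with (E * ((exp (al * h) - 1) / al)) by (field; lra).
    rewrite Rmult_comm. apply Rmult_le_compat_l; [lra|].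
    apply Rmult_le_reg_r with al; [exact Ha|]. unfold Rdiv. rewrite Rmult_assoc, Rinv_l by lra. lra.
  - unfold T. replace (- M - 1 + 1)%Z with (- M)%Z by lia. rewrite !opp_IZR.
    replace (al * (- IZR M * h)) with (- al * (IZR M * h)) by ring.
    assert (0 < exp (al * (- IZR M' * h)) / al) by (apply Rdiv_lt_0_compat; [apply exp_pos|exact Ha]). lra.
Qed.

Lemma two_sided_geometric c m : 0 < c -> (0 <= m)%Z ->
  rsum (fun k => exp (- c * Rabs (IZR k))) (zlist (- m) m) <= 1 + 2 / c.
Proof.
  intros Hc Hm.
  rewrite (zlist_app (- m) (-1) m), (zlist_app (-1 + 1) 0 m), !rsum_app by lia.
  assert (A : rsum (fun k => exp (- c * Rabs (IZR k))) (zlist (- m) (-1)) <= 1 / c).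
  { assert (T := tail_left c 1 0 m Hc ltac:(lra) Hm).
    replace (exp (- c * (IZR 0 * 1)) / c) with (1 / c) in T by (rewrite Rmult_0_l, Rmult_0_r, exp_0;
      reflexivity).
    eapply Rle_trans; [|exact T]. apply rsum_le. intros k Hk. apply zlist_In in Hk.
    assert (K := IZR_le _ _ (proj2 Hk)). simpl in K. rewrite Rabs_left by lra. right.
    rewrite Rmult_1_l. f_equal. ring. }
  assert (B : rsum (fun k => exp (- c * Rabs (IZR k))) (zlist (0 + 1) m) <= 1 / c).
  { assert (T := tail_right c 1 0 m Hc ltac:(lra) Hm).
    replace (exp (- c * (IZR 0 * 1)) / c) with (1 / c) in T by (rewrite Rmult_0_l, Rmult_0_r, exp_0;
      reflexivity).
    eapply Rle_trans; [|exact T]. apply rsum_le. intros k Hk. apply zlist_In in Hk.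
    assert (K := IZR_le _ _ (proj1 Hk)). simpl in K. rewrite Rabs_pos_eq by lra. right.
    rewrite Rmult_1_l. f_equal. ring. }
  assert (Z0 : rsum (fun k => exp (- c * Rabs (IZR k))) (zlist (-1 + 1) 0) = 1).
  { change (zlist (-1 + 1) 0) with (0%Z :: nil). simpl. rewrite Rabs_R0, Rmult_0_r, exp_0. ring. }
  rewrite Z0. lra.
Qed.

(** Kept apart from [decays] because truncation samples [F] only at real nodes, where a smaller
    constant is available. *)
Definition real_decays (F : C -> C) (B al be : R) : Prop := forall t : R,
  Cmod (F (RtoC t)) <= B * exp (al * t) /\ Cmod (F (RtoC t)) <= B * exp (- be * t).

(* With [u = m + 1/2 + k], [m + 1/2 <= u + |k|]: either [J] is small (of order [1/u]) or [F] is. *)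
Lemma left_end_sum F B al be h (m : nat) (M' : Z) : 0 < h -> 0 <= B -> 0 < al -> 0 < be -> (0 <= M')%Z ->
  real_decays F B al be ->
  rsum (fun k => Cmod (F (RtoC (IZR k * h))) * Rabs (Jfun k h (- ((INR m + 1 / 2) * h)))) (zlist (- M') M')
  <= B * (h + (22 / 10) * h / (Rmin al be * h)) * (1 + 4 / (Rmin al be * h)) / (INR m + 1 / 2).
Proof.
  intros Hh HB Ha Hb HM HF. set (c := Rmin al be * h).
  assert (Hmu : 0 < Rmin al be) by (apply Rmin_glb_lt; assumption).
  assert (Hc : 0 < c) by (apply Rmult_lt_0_compat; assumption).
  set (q := INR m + 1 / 2). assert (Hq : 0 < q) by (unfold q; generalize (pos_INR m); lra).
  assert (K : forall k, Cmod (F (RtoC (IZR k * h))) * Rabs (Jfun k h (- (q * h))) <=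
    B * (h + (22 / 10) * h / c) / q * exp (- (c / 2) * Rabs (IZR k))).
  { intros k. set (J := Rabs (Jfun k h (- (q * h)))).
    assert (HJ : 0 <= J) by apply Rabs_pos.
    assert (HJ1 : J <= (11 / 10) * h) by now apply Jfun_abs_bound.
    assert (HFk : Cmod (F (RtoC (IZR k * h))) <= B * exp (- c * Rabs (IZR k))).
    { destruct (HF (IZR k * h)) as [F1 F2].
      assert (L1 := Rmin_l al be). assert (L2 := Rmin_r al be).
      assert (Mono : forall x y, x <= y -> exp x <= exp y).
      { intros x y [H|H]; [left; now apply exp_increasing|right; now rewrite H]. }
      unfold c, Rabs. destruct (Rcase_abs (IZR k)) as [H|H].
      - eapply Rle_trans; [exact F1|]. apply Rmult_le_compat_l; [exact HB|]. apply Mono.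
        assert (0 <= - IZR k * h) by (apply Rmult_le_pos; lra).
        assert (Rmin al be * (- IZR k * h) <= al * (- IZR k * h)) by (apply Rmult_le_compat_r;
          assumption). lra.
      - eapply Rle_trans; [exact F2|]. apply Rmult_le_compat_l; [exact HB|]. apply Mono.
        assert (0 <= IZR k * h) by (apply Rmult_le_pos; lra).
        assert (Rmin al be * (IZR k * h) <= be * (IZR k * h)) by (apply Rmult_le_compat_r; assumption). lra. }
    (* Half of the exponential decay: one factor [e] absorbs the growth [Rabs (IZR k)], the other
       stays for the summation over [k]. *)
    set (e := exp (- (c / 2) * Rabs (IZR k))). assert (He : 0 < e) by apply exp_pos.
    assert (E2 : exp (- c * Rabs (IZR k)) = e * e) by (unfold e; rewrite <- exp_plus; f_equal; field).
    assert (He1 : e <= 1).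
    { unfold e. rewrite <- exp_0. destruct (Rabs_pos (IZR k)) as [H|H].
      - left. apply exp_increasing. nra.
      - rewrite <- H. right. f_equal. ring. }
    assert (Hke : Rabs (IZR k) * e <= 2 / c).
    { assert (H := exp_ge_1_plus (c / 2 * Rabs (IZR k))).
      assert (E1 : exp (c / 2 * Rabs (IZR k)) * e = 1).
      { unfold e. rewrite <- exp_plus, <- exp_0. f_equal. ring. }
      apply Rmult_le_reg_l with (c / 2); [lra|].
      replace (c / 2 * (2 / c)) with 1 by (field; lra). rewrite <- E1, <- Rmult_assoc.
      apply Rmult_le_compat_r; lra. }
    assert (HqJ : q * J <= h + (11 / 10) * h * Rabs (IZR k)).
    { set (u := q + IZR k). assert (Hk := Rle_abs (- IZR k)). rewrite Rabs_Ropp in Hk.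
      destruct (Rlt_dec 0 u) as [Hu|Hu].
      - assert (D : J <= h / u).
        { apply Jfun_decay; [exact Hh|exact Hu|]. unfold u. field. lra. }
        assert (D2 : u * J <= h).
        { apply Rle_trans with (u * (h / u)); [apply Rmult_le_compat_l; lra|]. right. field. lra. }
        apply Rle_trans with ((u + Rabs (IZR k)) * J); [apply Rmult_le_compat_r; [exact HJ|unfold u; lra]|].
        rewrite Rmult_plus_distr_r.
        assert (Rabs (IZR k) * J <= Rabs (IZR k) * ((11 / 10) * h)) by (apply Rmult_le_compat_l; [apply
          Rabs_pos|exact HJ1]).
        lra.
      - apply Rle_trans with (Rabs (IZR k) * J); [apply Rmult_le_compat_r; [exact HJ|unfold u in Hu; lra]|].
        assert (Rabs (IZR k) * J <= Rabs (IZR k) * ((11 / 10) * h)) by (apply Rmult_le_compat_l; [apply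
          Rabs_pos|exact HJ1]).
        lra. }
    apply Rle_trans with (B * (e * e) * J); [apply Rmult_le_compat_r; [exact HJ|now rewrite <- E2]|].
    apply Rmult_le_reg_l with q; [exact Hq|].
    replace (q * (B * (h + (22 / 10) * h / c) / q * e)) with (B * e * (h + (22 / 10) * h / c)) by (field;
      lra).
    replace (q * (B * (e * e) * J)) with (B * e * (e * (q * J))) by ring.
    apply Rmult_le_compat_l; [apply Rmult_le_pos; lra|].
    apply Rle_trans with (e * (h + (11 / 10) * h * Rabs (IZR k))); [apply Rmult_le_compat_l; lra|].
    rewrite Rmult_plus_distr_l. apply Rplus_le_compat; [nra|].
    replace (e * ((11 / 10) * h * Rabs (IZR k))) with ((11 / 10) * h * (Rabs (IZR k) * e)) by ring.
    replace ((22 / 10) * h / c) with ((11 / 10) * h * (2 / c)) by (field; lra).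
    apply Rmult_le_compat_l; lra. }
  eapply Rle_trans; [apply rsum_le; intros k _; apply K|]. rewrite rsum_scal.
  assert (G := two_sided_geometric (c / 2) M' ltac:(lra) HM).
  replace (2 / (c / 2)) with (4 / c) in G by (field; lra).
  replace (B * (h + (22 / 10) * h / c) * (1 + 4 / c) / q) with (B * (h + (22 / 10) * h / c) / q * (1 + 4 / c))
    by (unfold Rdiv; ring).
  apply Rmult_le_compat_l; [|exact G].
  apply Rmult_le_pos; [|left; now apply Rinv_0_lt_compat].
  apply Rmult_le_pos; [exact HB|]. assert (0 < (22 / 10) * h / c) by (apply Rdiv_lt_0_compat; lra). lra.
Qed.

Lemma truncation_sums F B al be h x M N M' : 0 < h -> 0 <= B -> 0 < al -> 0 < be ->
  (0 <= M <= M')%Z -> (0 <= N <= M')%Z -> real_decays F B al be ->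
  Cmod (csum (fun k => F (RtoC (IZR k * h)) * RtoC (Jfun k h x)) (zlist (- M') M')
    - csum (fun k => F (RtoC (IZR k * h)) * RtoC (Jfun k h x)) (zlist (- M) N))%C
  <= (11 / 10) * B * (exp (- al * (IZR M * h)) / al + exp (- be * (IZR N * h)) / be).
Proof.
  intros Hh HB Ha Hb HM HN HF.
  set (g := fun k : Z => (F (RtoC (IZR k * h)) * RtoC (Jfun k h x))%C).
  rewrite (zlist_app (- M') (- M - 1) M'), (zlist_app (- M - 1 + 1) N M') by lia.
  replace (- M - 1 + 1)%Z with (- M)%Z by lia. rewrite !csum_app.
  replace (csum g (zlist (- M') (- M - 1)) + (csum g (zlist (- M) N) + csum g (zlist (N + 1) M'))
     - csum g (zlist (- M) N))%C with (csum g (zlist (- M') (- M - 1)) + csum g (zlist (N + 1) M'))%C by ring.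
  eapply Rle_trans; [apply Cmod_triangle|]. rewrite Rmult_plus_distr_l.
  assert (G : forall k e, Cmod (F (RtoC (IZR k * h))) <= B * e -> 0 <= e ->
    Cmod (g k) <= (11 / 10) * B * (h * e)).
  { intros k e He He0. unfold g. rewrite Cmod_mult, Cmod_R.
    replace ((11 / 10) * B * (h * e)) with (B * e * ((11 / 10) * h)) by ring.
    apply Rmult_le_compat; [apply Cmod_ge_0|apply Rabs_pos|exact He|now apply Jfun_abs_bound]. }
  apply Rplus_le_compat.
  - eapply Rle_trans; [apply (csum_le g (fun k => (11 / 10) * B * (h * exp (al * (IZR k * h)))))|].
    + intros k _. apply G; [apply HF|left; apply exp_pos].
    + rewrite (rsum_scal ((11 / 10) * B)). apply Rmult_le_compat_l; [lra|]. apply tail_left; try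
      assumption; lia.
  - eapply Rle_trans; [apply (csum_le g (fun k => (11 / 10) * B * (h * exp (- be * (IZR k * h)))))|].
    + intros k _. apply G; [apply HF|left; apply exp_pos].
    + rewrite (rsum_scal ((11 / 10) * B)). apply Rmult_le_compat_l; [lra|]. apply tail_right; try
      assumption; lia.
Qed.

(** [F] is controlled only in the open strip, so contours stop at [del < d]; this lets [del] reach
    [d] in the final bound. *)
Lemma le_limit_right (g : R -> R) Y d : 0 < d -> continuity_pt g d ->
  (forall del, 0 < del < d -> Y <= g del) -> Y <= g d.
Proof.
  intros Hd Hg H. apply Rnot_lt_le. intros Hlt.
  destruct (Hg (Y - g d)) as [al [Hal Hw]]; [lra|].
  set (x := Rmax (d / 2) (d - al / 2)).
  assert (X1 : d / 2 <= x) by apply Rmax_l. assert (X2 : d - al / 2 <= x) by apply Rmax_r.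
  assert (X3 : x < d) by (apply Rmax_lub_lt; lra).
  specialize (Hw x). assert (Hx := H x ltac:(lra)).
  assert (H0 : Rabs (g x - g d) < Y - g d).
  { apply Hw. split; [split; [exact I|lra]|]. simpl. unfold R_dist. rewrite Rabs_left; lra. }
  rewrite Rabs_pos_eq in H0; lra.
Qed.

(** The contribution of the two horizontal sides, divided by $2\pi$: what survives of
    [sinc_quadrature_finite] as the rectangle widens. *)
Definition disc_error (B al be h del : R) : R :=
  / (2 * PI) * (2 * (B / sinh (PI / h * del) * ((1 + PI) / (PI / h * del)) * (1 / al + 1 / be))).

Lemma continuity_disc_error B al be h d : 0 < h -> 0 < d -> continuity_pt (disc_error B al be h) d.
Proof.
  intros Hh Hd. generalize PI_RGT_0; intros HP.
  assert (Hs : 0 < PI / h * d) by (apply Rmult_lt_0_compat; [apply Rdiv_lt_0_compat|]; lra).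
  assert (Hsh := sinh_pos _ Hs).
  apply continuity_pt_filterlim.
  apply (ex_derive_continuous (V := R_NormedModule)). unfold disc_error, sinh in *.
  auto_derive. repeat split; try lra.
Qed.

Lemma sinc_quadrature F d B B0 al be h x M N I :
  0 < d -> 0 < h -> 0 <= B -> 0 <= B0 -> 0 < al -> 0 < be -> (0 <= M)%Z -> (0 <= N)%Z ->
  (forall z, Rabs (Im z) < d -> cdiff F z) -> decays F d B al be -> real_decays F B0 al be ->
  (forall eps, 0 < eps -> exists m0 : nat, forall m, (m0 <= m)%nat ->
     Cmod (I - CInt (fun t => F (RtoC t)) (- ((INR m + 1 / 2) * h)) x)%C <= eps) ->
  Cmod (I - csum (fun k => F (RtoC (IZR k * h)) * RtoC (Jfun k h x)) (zlist (- M) N))%C <=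
  disc_error B al be h d + (11 / 10) * B0 * (exp (- al * (IZR M * h)) / al + exp (- be * (IZR N * h)) / be).
Proof.
  intros Hd Hh HB HB0 Ha Hb HM HN HF HD HR HI. generalize PI_RGT_0; intros HP.
  set (S := csum _ (zlist (- M) N)).
  set (tails := (11 / 10) * B0 * (exp (- al * (IZR M * h)) / al + exp (- be * (IZR N * h)) / be)).
  apply (le_limit_right (fun del => disc_error B al be h del + tails)); [exact Hd| |].
  { apply continuity_pt_plus; [now apply continuity_disc_error|]. apply continuity_pt_const. intros ? ?;
    reflexivity. }
  intros del Hdel. apply le_epsilon. intros eps Heps.
  (* [C1 / q] will bound the vertical sides and [C2 / q] the terms left at the lower end [a];
     neither constant depends on [m]. *)
  set (C1 := / PI * (2 * del * B * (1 / al + 1 / be) / h)).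
  set (C2 := B0 * (h + (22 / 10) * h / (Rmin al be * h)) * (1 + 4 / (Rmin al be * h))).
  assert (Hmu : 0 < Rmin al be * h) by (apply Rmult_lt_0_compat; [apply Rmin_glb_lt|]; assumption).
  assert (Hia : 0 < 1 / al) by (apply Rdiv_lt_0_compat; lra).
  assert (Hib : 0 < 1 / be) by (apply Rdiv_lt_0_compat; lra).
  assert (HC1 : 0 <= C1).
  { unfold C1. apply Rmult_le_pos; [left; now apply Rinv_0_lt_compat|].
    apply Rmult_le_pos; [|left; now apply Rinv_0_lt_compat].
    apply Rmult_le_pos; [|lra]. apply Rmult_le_pos; lra. }
  assert (HC2 : 0 <= C2).
  { unfold C2. assert (0 < (22 / 10) * h / (Rmin al be * h)) by (apply Rdiv_lt_0_compat; lra).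
    assert (0 < 4 / (Rmin al be * h)) by (apply Rdiv_lt_0_compat; lra).
    apply Rmult_le_pos; [|lra]. apply Rmult_le_pos; lra. }
  destruct (HI (eps / 2) ltac:(lra)) as [m0 Hm0].
  destruct (INR_unbounded (2 * (C1 + C2) / eps + Rabs x / h)) as [m1 Hm1].
  (* [m0] serves the improper integral, [m1] the errors of order [1 / q] and the condition
     [Rabs x <= q * h]; [M] and [N] place the truncated range inside the full one. *)
  set (m := (m0 + m1 + Z.to_nat M + Z.to_nat N)%nat).
  assert (Hmm0 : (m0 <= m)%nat) by (unfold m; lia).
  assert (Hmm1 : INR m1 <= INR m) by (apply le_INR; unfold m; lia).
  assert (Hxh : 0 <= Rabs x / h) by (apply Rmult_le_pos; [apply Rabs_pos|left; now apply Rinv_0_lt_compat]).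
  assert (HCe : 0 <= 2 * (C1 + C2) / eps) by (apply Rmult_le_pos; [lra|left; now apply Rinv_0_lt_compat]).
  set (q := INR m + 1 / 2). assert (Hq : 0 < q) by (unfold q; generalize (pos_INR m); lra).
  (* Twice the size of the interval: the vertical sides at distance [(2 * m + 3 / 2) * h] from the
     origin stay [(m + 1) * h] away from [[a, x]], whose length is at most twice that. *)
  set (M' := (2 * Z.of_nat m + 1)%Z).
  assert (EM' : IZR M' = 2 * INR m + 1) by (unfold M'; rewrite plus_IZR, mult_IZR, <- INR_IZR_INZ;
    reflexivity).
  assert (Hxq : Rabs x <= q * h).
  { apply Rle_trans with (Rabs x / h * h); [right; field; lra|]. apply Rmult_le_compat_r; [lra|].
    unfold q. lra. }
  assert (Hsmall : (C1 + C2) / q <= eps / 2).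
  { apply Rmult_le_reg_r with (q * (2 / eps)); [apply Rmult_lt_0_compat; [exact Hq|apply
    Rdiv_lt_0_compat; lra]|].
    replace ((C1 + C2) / q * (q * (2 / eps))) with (2 * (C1 + C2) / eps) by (field; lra).
    replace (eps / 2 * (q * (2 / eps))) with q by (field; lra). unfold q. lra. }
  specialize (Hm0 m Hmm0). fold q in Hm0.
  set (a := - (q * h)) in *.
  assert (Hqh : 0 < q * h) by now apply Rmult_lt_0_compat.
  assert (Fin := sinc_quadrature_finite F d B al be h del M' a x (q * h) Hh Hdel ltac:(unfold M'; lia) HB
    Ha Hb HF HD).
  assert (Hax : a <= x) by (apply Rabs_le_between in Hxq; unfold a; lra).
  assert (EL : (IZR M' + 1 / 2) * h - q * h = (INR m + 1) * h) by (rewrite EM'; unfold q; field).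
  specialize (Fin Hax). rewrite EL in Fin.
  assert (Hm1p : 0 < (INR m + 1) * h) by (apply Rmult_lt_0_compat; [generalize (pos_INR m)|]; lra).
  specialize (Fin ltac:(unfold a; rewrite Rabs_Ropp, Rabs_pos_eq; lra) Hxq ltac:(lra)).
  assert (Hcos : cos (PI / h * a) = 0).
  { replace (PI / h * a) with (- ((IZR (Z.of_nat m) + 1 / 2) * PI)).
    - rewrite cos_neg. apply cos_half_PI.
    - rewrite <- INR_IZR_INZ. unfold a, q. field. lra. }
  specialize (Fin Hcos).
  set (L := (IZR M' + 1 / 2) * h) in *.
  assert (HL : q * h < L) by lra.
  (* Length over distance is bounded, so first-order decay of the exponential is enough to make the
     vertical sides vanish. *)
  assert (Small : forall c, 0 < c -> exp (- c * L) <= 1 / c / h / q).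
  { intros c Hc. assert (X := exp_ge_1_plus (c * L)).
    replace (exp (- c * L)) with (/ exp (c * L)) by (rewrite <- exp_Ropp; f_equal; ring).
    replace (1 / c / h / q) with (/ (c * (q * h))) by (field; lra).
    apply Rinv_le_contravar; [now apply Rmult_lt_0_compat|].
    assert (c * (q * h) <= c * L) by (apply Rmult_le_compat_l; lra). lra. }
  assert (V : / (2 * PI) * ((x - a) * (2 * del * (B * exp (- al * L) / ((INR m + 1) * h))
      + 2 * del * (B * exp (- be * L) / ((INR m + 1) * h)))) <= C1 / q).
  { assert (Hxa : x - a <= 2 * ((INR m + 1) * h)).
    { apply Rabs_le_between in Hxq. unfold a. unfold q in *. lra. }
    replace (C1 / q) with (/ (2 * PI) * (2 * ((INR m + 1) * h) * (2 * del * (B * (1 / al / h / q) / ((INR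
      m + 1) * h))
      + 2 * del * (B * (1 / be / h / q) / ((INR m + 1) * h))))).
    2: { unfold C1. field. generalize (pos_INR m). intros. repeat split; lra. }
    apply Rmult_le_compat_l; [left; apply Rinv_0_lt_compat; lra|].
    assert (P : forall e e', 0 <= e -> e <= e' -> 0 <= 2 * del * (B * e / ((INR m + 1) * h)) <= 2 * del *
      (B * e' / ((INR m + 1) * h))).
    { intros e e' H0 H1. split.
      - apply Rmult_le_pos; [lra|]. apply Rmult_le_pos; [nra|left; now apply Rinv_0_lt_compat].
      - apply Rmult_le_compat_l; [lra|]. apply Rmult_le_compat_r; [left; now apply Rinv_0_lt_compat|].
        now apply Rmult_le_compat_l. }
    destruct (P _ _ (Rlt_le _ _ (exp_pos (- al * L))) (Small al Ha)) as [P1 P2].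
    destruct (P _ _ (Rlt_le _ _ (exp_pos (- be * L))) (Small be Hb)) as [P3 P4].
    apply Rmult_le_compat; lra. }
  assert (T := truncation_sums F B0 al be h x M N M' Hh HB0 Ha Hb ltac:(unfold M', m; lia) ltac:(unfold
    M', m; lia) HR).
  fold S tails in T.
  assert (E := left_end_sum F B0 al be h m M' Hh HB0 Ha Hb ltac:(unfold M'; lia) HR).
  fold q C2 in E. fold a in E.
  assert (E' : Cmod (csum (fun k => F (RtoC (IZR k * h)) * RtoC (Jfun k h a)) (zlist (- M') M'))%C <= C2 / q).
  { eapply Rle_trans; [|exact E]. apply csum_le. intros k _. rewrite Cmod_mult, Cmod_R. lra. }
  rewrite (csum_ext (fun k => (F (RtoC (IZR k * h)) * RtoC (Jfun k h x - Jfun k h a))%C)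
    (fun k => ((F (RtoC (IZR k * h)) * RtoC (Jfun k h x)) - (F (RtoC (IZR k * h)) * RtoC (Jfun k h
      a)))%C)) in Fin
    by (intros; rewrite RtoC_minus; ring).
  rewrite csum_minus in Fin.
  set (Sx := csum (fun k => (F (RtoC (IZR k * h)) * RtoC (Jfun k h x))%C) (zlist (- M') M')) in *.
  set (Sa := csum (fun k => (F (RtoC (IZR k * h)) * RtoC (Jfun k h a))%C) (zlist (- M') M')) in *.
  set (Q := CInt (fun t => F (RtoC t)) a x) in *.
  (* Four errors: the missing piece of the integral below [a], the finite quadrature, the truncation
     of the sum, and the values of $J$ at [a]. *)
  replace (I - S)%C with ((I - Q) + ((Q - (Sx - Sa)) + ((Sx - S) - Sa)))%C by ring.
  eapply Rle_trans; [apply Cmod_triangle|].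
  assert (G1 : Cmod ((Q - (Sx - Sa)) + ((Sx - S) - Sa))%C <= Cmod (Q - (Sx - Sa))%C + (Cmod (Sx - S)%C +
    Cmod Sa)).
  { eapply Rle_trans; [apply Cmod_triangle|]. apply Rplus_le_compat_l. unfold Cminus at 1.
    eapply Rle_trans; [apply Cmod_triangle|]. rewrite Cmod_opp. lra. }
  assert (Fin' : Cmod (Q - (Sx - Sa))%C <= disc_error B al be h del + C1 / q).
  { eapply Rle_trans; [exact Fin|]. unfold disc_error. rewrite Rmult_plus_distr_l. lra. }
  replace ((C1 + C2) / q) with (C1 / q + C2 / q) in Hsmall by (unfold Rdiv; ring).
  lra.
Qed.

Lemma disc_error_le B al be h d : 0 <= B -> 0 < al -> 0 < be -> 0 < h -> 0 < d ->
  disc_error B al be h d <= B * (1 / al + 1 / be) * (h / d)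
    * (exp (- (PI * d / h)) / (1 - exp (- (2 * (PI * d / h))))).
Proof.
  intros HB Ha Hb Hh Hd. generalize PI_bounds; intros HP. unfold disc_error.
  set (y := PI * d / h). assert (Hy : 0 < y) by (unfold y; apply Rdiv_lt_0_compat; nra).
  replace (PI / h * d) with y by (unfold y; field; lra).
  assert (Hs := sinh_pos y Hy).
  assert (Es : exp (- y) / (1 - exp (- (2 * y))) = / (2 * sinh y)).
  { unfold sinh in *. replace (- (2 * y)) with (- y + - y) by ring. rewrite exp_plus.
    assert (E : exp y * exp (- y) = 1) by (rewrite <- exp_plus, Rplus_opp_r; apply exp_0).
    assert (Hp := exp_pos (- y)).
    replace (1 - exp (- y) * exp (- y)) with (exp (- y) * (exp y - exp (- y))) by lra.
    field. split; lra. }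
  rewrite Es.
  assert (Hi : 0 < 1 / al + 1 / be) by (apply Rplus_lt_0_compat; apply Rdiv_lt_0_compat; lra).
  set (w := 1 / al + 1 / be) in *.
  replace (/ (2 * PI) * (2 * (B / sinh y * ((1 + PI) / y) * w)))
    with (B * w * (h / d) * (/ sinh y * ((1 + PI) / (PI * PI)))) by (unfold y; field; unfold y in *;
      repeat split; lra).
  assert (Hw : 0 <= B * w * (h / d)).
  { apply Rmult_le_pos; [apply Rmult_le_pos; lra|left; apply Rdiv_lt_0_compat; lra]. }
  apply Rmult_le_compat_l; [exact Hw|].
  rewrite Rinv_mult, Rmult_comm. apply Rmult_le_compat_r; [left; now apply Rinv_0_lt_compat|].
  (* All that is left is $2(1+\pi)\le\pi^2$, already true for $\pi\ge3.1$. *)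
  apply Rmult_le_reg_r with (PI * PI); [nra|]. unfold Rdiv. rewrite Rmult_assoc, Rinv_l by nra. nra.
Qed.

(** * The transformed integrands *)

Lemma Cmod_Cpow_real z (r : R) : z <> RtoC 0 -> Cmod (Defs.Cpow z (RtoC r)) = Rpower (Cmod z) r.
Proof.
  intros Hz. unfold Defs.Cpow. destruct Req_EM_T as [e|_].
  - now apply Cmod_eq_0 in e.
  - rewrite Cmod_Cexp, re_scal_l. reflexivity.
Qed.

Lemma Rpower_le_neg x y e : 0 < x -> x <= y -> e <= 0 -> Rpower y e <= Rpower x e.
Proof.
  intros Hx Hxy He. replace e with (- - e) by ring. rewrite !(Rpower_Ropp _ (- e)).
  apply Rinv_le_contravar; [apply exp_pos|]. apply Rle_Rpower_l; lra.
Qed.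

Lemma Rpower_exp_l x e : Rpower (exp x) e = exp (e * x).
Proof. unfold Rpower. now rewrite ln_exp. Qed.

(** Bounding $1+e^{2x}$ below by $1$ gives the first estimate; by $e^{2x}$, which trades $e^{\alpha
    x}$ for $e^{-\beta x}$, the second. *)
Lemma weight_bound al be c P x : 0 < al -> 0 < be -> 0 < c -> c * (1 + exp (2 * x)) <= P ->
  exp (al * x) * Rpower P (- ((al + be) / 2)) <= / Rpower c ((al + be) / 2) * exp (al * x) /\
  exp (al * x) * Rpower P (- ((al + be) / 2)) <= / Rpower c ((al + be) / 2) * exp (- be * x).
Proof.
  intros Ha Hb Hc HP. assert (He := exp_pos (2 * x)). assert (Hx := exp_pos (al * x)).
  assert (H0 : Rpower P (- ((al + be) / 2)) <= Rpower (c * (1 + exp (2 * x))) (- ((al + be) / 2))).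
  { apply Rpower_le_neg; [apply Rmult_lt_0_compat; lra|exact HP|lra]. }
  assert (G : forall v, 0 < v -> v <= 1 + exp (2 * x) ->
     Rpower P (- ((al + be) / 2)) <= / Rpower c ((al + be) / 2) * Rpower v (- ((al + be) / 2))).
  { intros v Hv Hv1. eapply Rle_trans; [exact H0|].
    rewrite <- Rpower_mult_distr by lra. rewrite (Rpower_Ropp c).
    apply Rmult_le_compat_l; [left; apply Rinv_0_lt_compat, exp_pos|].
    apply Rpower_le_neg; lra. }
  split.
  - assert (G1 := G 1 ltac:(lra) ltac:(lra)).
    replace (Rpower 1 (- ((al + be) / 2))) with 1 in G1
      by (unfold Rpower; rewrite ln_1, Rmult_0_r; symmetry; apply exp_0).
    rewrite Rmult_1_r in G1. rewrite Rmult_comm. apply Rmult_le_compat_r; lra.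
  - assert (G2 := G (exp (2 * x)) He ltac:(lra)).
    rewrite Rpower_exp_l in G2.
    apply Rle_trans with (exp (al * x) * (/ Rpower c ((al + be) / 2) * exp (- ((al + be) / 2) * (2 * x)))).
    + apply Rmult_le_compat_l; lra.
    + right. rewrite Rmult_comm, Rmult_assoc, <- exp_plus. f_equal. f_equal. field.
Qed.

Lemma Cexp_half_plane z d : d < PI / 2 -> Rabs (Im z) < d -> 0 < Re (Cexp z).
Proof.
  intros Hd Hz. apply Rabs_lt_between in Hz. simpl.
  apply Rmult_lt_0_compat; [apply exp_pos|]. apply cos_gt_0; unfold Im in *; lra.
Qed.

(** With $E=e^{2x}$ one has $|1+e^{2z}|^2=\cos^2y\,(1+E)^2+\sin^2y\,(1-E)^2$, and $\cos y\ge\cos d$.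
    This is where the powers of $\cos d$ originate. *)
Lemma Cexp_sqr_lower z d : d < PI / 2 -> Rabs (Im z) < d ->
  cos d * (1 + exp (2 * Re z)) <= Cmod (1 + Cexp z * Cexp z).
Proof.
  intros Hd Hz. rewrite <- Cexp_plus. destruct z as [x y]. simpl in Hz.
  generalize PI_RGT_0; intros HP.
  assert (Hc : 0 < cos d) by (apply cos_gt_0; generalize (Rabs_pos y); lra).
  assert (Hcy : cos d <= cos y).
  { unfold Rabs in Hz. destruct Rcase_abs in Hz.
    - rewrite <- (cos_neg y). left. apply cos_decreasing_1; lra.
    - left. apply cos_decreasing_1; lra. }
  set (E := exp (2 * x)). assert (HE : 0 < E) by apply exp_pos.
  change (exp (2 * Re (x, y))) with E. unfold Cmod. rewrite <- (sqrt_pow2 (cos d * (1 + E))) by nra.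
  apply sqrt_le_1_alt. unfold Cexp, Cplus, RtoC; simpl fst; simpl snd.
  unfold Re, Im; simpl fst; simpl snd.
  replace (x + x) with (2 * x) by ring. fold E.
  replace (y + y) with (2 * y) by ring. rewrite cos_2a, sin_2a.
  assert (H := sin2_cos2 y). unfold Rsqr in H.
  set (C := cos y) in *. set (S := sin y) in *.
  assert (Hcc : cos d * cos d <= C * C) by nra.
  assert (HS : S * S = 1 - C * C) by lra.
  replace ((1 + E * (C * C - S * S)) ^ 2 + (0 + E * (2 * S * C)) ^ 2)
    with (1 + 2 * E * (C * C - S * S) + E * E * ((C * C + S * S) * (C * C + S * S))) by ring.
  rewrite HS.
  assert (HE2 : 0 <= (1 + E) * (1 + E)) by apply Rle_0_sqr.
  assert (Hq : cos d * cos d * ((1 + E) * (1 + E)) <= C * C * ((1 + E) * (1 + E)))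
    by (apply Rmult_le_compat_r; assumption).
  assert (HC1 : C * C <= 1) by (generalize (Rle_0_sqr S); unfold Rsqr; lra).
  assert (H1 : 0 <= (1 - C * C) * ((1 - E) * (1 - E))) by (apply Rmult_le_pos; [lra|apply Rle_0_sqr]).
  replace ((cos d * (1 + E)) ^ 2) with (cos d * cos d * ((1 + E) * (1 + E))) by ring. lra.
Qed.

(** For $\Re w>0$ the square $w^2$ is real only if $w$ is, and then positive. Hence the square root
    inside [Casinh] stays off its branch cut. *)
Lemma slit_1_Cexp_sqr z d : d < PI / 2 -> Rabs (Im z) < d -> slit (Cexp z * Cexp z + 1)%C.
Proof.
  intros Hd Hz. assert (H := Cexp_half_plane z d Hd Hz).
  destruct (Cexp z) as [u v]. simpl in H. unfold slit. simpl.
  destruct (Req_dec v 0) as [->|n]; [left; nra|right; nra].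
Qed.

Lemma one_plus_Cexp_sqr_nz z d : d < PI / 2 -> Rabs (Im z) < d -> (1 + Cexp z * Cexp z)%C <> RtoC 0.
Proof.
  intros Hd Hz. rewrite Cplus_comm. apply slit_nz. now apply slit_1_Cexp_sqr with d.
Qed.

Definition exp_integrand (f : C -> C) (z : C) : C := (f (psiC 2 z) * Cexp z)%C.

Lemma exp_integrand_cdiff f d : d < PI / 2 -> analytic_on (psi_domain 2 d) f ->
  forall z, Rabs (Im z) < d -> cdiff (exp_integrand f) z.
Proof.
  intros Hd Hf z Hz. apply cdiff_mult.
  - apply (cdiff_comp Cexp f); [eexists; apply cderiv_Cexp|].
    apply ex_derive_cdiff, Hf. now exists z.
  - eexists; apply cderiv_Cexp.
Qed.

Lemma exp_integrand_bound f d K al be z : d < PI / 2 -> Rabs (Im z) < d ->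
  (forall w, psi_domain 2 d w -> Cmod (f w) <= K * Cmod (E_fun 2 al be w)) ->
  Cmod (exp_integrand f z) <= K * (exp (al * Re z) * Rpower (Cmod (1 + Cexp z * Cexp z)) (- ((al + be) / 2))).
Proof.
  intros Hd Hz HK. unfold exp_integrand. rewrite Cmod_mult.
  eapply Rle_trans.
  - apply Rmult_le_compat_r; [apply Cmod_ge_0|]. apply HK. now exists z.
  - simpl psiC. unfold E_fun. rewrite Cmod_mult, !Cmod_Cpow_real.
    + rewrite Cmod_Cexp, Rpower_exp_l. right.
      replace (al * Re z) with ((al - 1) * Re z + Re z) by ring. rewrite exp_plus. ring.
    + now apply one_plus_Cexp_sqr_nz with d.
    + apply Cexp_nz.
Qed.

(** The meeting point of the two changes of variable: both integrands obey the hypothesis, with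
    different [K]. *)
Lemma decays_of_weight F d K al be c : 0 <= K -> 0 < al -> 0 < be -> 0 < c ->
  (forall z, Rabs (Im z) < d -> c * (1 + exp (2 * Re z)) <= Cmod (1 + Cexp z * Cexp z)) ->
  (forall z, Rabs (Im z) < d ->
    Cmod (F z) <= K * (exp (al * Re z) * Rpower (Cmod (1 + Cexp z * Cexp z)) (- ((al + be) / 2)))) ->
  decays F d (K / Rpower c ((al + be) / 2)) al be.
Proof.
  intros HK Ha Hb Hc Hl HF z Hz.
  destruct (weight_bound al be c _ (Re z) Ha Hb Hc (Hl z Hz)) as [W1 W2].
  specialize (HF z Hz).
  split; (eapply Rle_trans; [exact HF|]); unfold Rdiv; rewrite Rmult_assoc;
    apply Rmult_le_compat_l; assumption.
Qed.

Lemma exp_integrand_decays f d K al be : 0 < d -> d < PI / 2 -> 0 < K -> 0 < al -> 0 < be ->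
  (forall w, psi_domain 2 d w -> Cmod (f w) <= K * Cmod (E_fun 2 al be w)) ->
  decays (exp_integrand f) d (K / Rpower (cos d) ((al + be) / 2)) al be.
Proof.
  intros Hd0 Hd HK Ha Hb H. apply decays_of_weight; try lra.
  - apply cos_gt_0; lra.
  - intros z Hz. now apply Cexp_sqr_lower.
  - intros z Hz. now apply exp_integrand_bound with d.
Qed.

Lemma one_plus_Cexp_sqr_real (t : R) : Cmod (1 + Cexp t * Cexp t) = 1 + exp (2 * t).
Proof.
  rewrite Cexp_RtoC, <- RtoC_mult, <- RtoC_plus, Cmod_R, <- exp_plus.
  replace (t + t) with (2 * t) by ring. apply Rabs_pos_eq. generalize (exp_pos (2 * t)). lra.
Qed.

Lemma real_weight al be K t : 0 <= K -> 0 < al -> 0 < be -> forall v,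
  v <= K * (exp (al * t) * Rpower (1 + exp (2 * t)) (- ((al + be) / 2))) ->
  v <= K * exp (al * t) /\ v <= K * exp (- be * t).
Proof.
  intros HK Ha Hb v Hv.
  destruct (weight_bound al be 1 (1 + exp (2 * t)) t Ha Hb ltac:(lra) ltac:(lra)) as [W1 W2].
  replace (Rpower 1 ((al + be) / 2)) with 1 in W1, W2
    by (unfold Rpower; rewrite ln_1, Rmult_0_r; symmetry; apply exp_0).
  rewrite Rinv_1, Rmult_1_l in W1, W2.
  split; (eapply Rle_trans; [exact Hv|]); apply Rmult_le_compat_l; assumption.
Qed.

Lemma exp_integrand_real_decays f d K al be : 0 < d -> d < PI / 2 -> 0 < K -> 0 < al -> 0 < be ->
  (forall w, psi_domain 2 d w -> Cmod (f w) <= K * Cmod (E_fun 2 al be w)) ->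
  real_decays (exp_integrand f) K al be.
Proof.
  intros Hd0 Hd HK Ha Hb H t.
  assert (Hz : Rabs (Im t) < d) by (simpl; rewrite Rabs_R0; lra).
  assert (G := exp_integrand_bound f d K al be t Hd Hz H). rewrite one_plus_Cexp_sqr_real in G.
  apply real_weight; try lra. exact G.
Qed.

(** * The inverse hyperbolic sine *)

(** The root $\sqrt{1+e^{2z}}$ without the test at zero in [Cpow], hence a plain composition of
    holomorphic maps. *)
Definition Croot (z : C) : C := Cexp (RtoC (1 / 2) * Clog (Cexp z * Cexp z + 1)).

Lemma Croot_Cpow z d : d < PI / 2 -> Rabs (Im z) < d ->
  Defs.Cpow (Cplus (Cmult (Cexp z) (Cexp z)) (RtoC 1)) (RtoC (1 / 2)) = Croot z.
Proof.
  intros Hd Hz. unfold Defs.Cpow. destruct Req_EM_T as [e|_]; [|reflexivity].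
  apply Cmod_eq_0 in e. exfalso. revert e. apply slit_nz. now apply slit_1_Cexp_sqr with d.
Qed.

Lemma Croot_sqr z d : d < PI / 2 -> Rabs (Im z) < d -> (Croot z * Croot z)%C = (Cexp z * Cexp z + 1)%C.
Proof.
  intros Hd Hz. unfold Croot. rewrite <- Cexp_plus.
  set (l := Clog _).
  replace (RtoC (1 / 2) * l + RtoC (1 / 2) * l)%C with l.
  - apply Cexp_Clog. now apply slit_1_Cexp_sqr with d.
  - rewrite RtoC_div by lra. field.
Qed.

Lemma Croot_re z d : d < PI / 2 -> Rabs (Im z) < d -> 0 < Re (Croot z).
Proof.
  intros Hd Hz. unfold Croot.
  set (v := (Cexp z * Cexp z + 1)%C).
  assert (Hs : slit v) by now apply slit_1_Cexp_sqr with d.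
  assert (Hb := Carg_slit_bound v Hs).
  change (0 < exp (Re (RtoC (1 / 2) * Clog v)) * cos (Im (RtoC (1 / 2) * Clog v))).
  apply Rmult_lt_0_compat; [apply exp_pos|].
  rewrite im_scal_l. change (Im (Clog v)) with (Carg v). apply cos_gt_0; lra.
Qed.

(** Let [w] be the exponential, [s] the root and [a], [b] the parts of [Clog (w + s)]. Since
    $s^2-w^2=1$, $s-w$ is the inverse of $w+s$, that is $e^{-(a+ib)}$. Half the sum and half the
    difference give $s=\cosh(a+ib)$ and $w=\sinh(a+ib)$; then $\Re w>0$ forces $a>0$. *)
Lemma asinh_coordinates z d : d < PI / 2 -> Rabs (Im z) < d ->
  exists a b, psiC 3 z = ((a, b) : C) /\ 0 < a /\ - (PI / 2) < b < PI / 2 /\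
    Cexp z = ((sinh a * cos b, cosh a * sin b) : C) /\
    Croot z = ((cosh a * cos b, sinh a * sin b) : C).
Proof.
  intros Hd Hz. assert (Hw := Cexp_half_plane z d Hd Hz). assert (Hs := Croot_re z d Hd Hz).
  assert (E2 := Croot_sqr z d Hd Hz).
  change (psiC 3 z) with (Clog (Cplus (Cexp z) (Defs.Cpow (Cplus (Cmult (Cexp z) (Cexp z)) (RtoC 1))
    (RtoC (1 / 2))))).
  rewrite (Croot_Cpow z d Hd Hz).
  set (w := Cexp z) in *. set (s := Croot z) in *.
  set (v := (w + s)%C).
  assert (Hv : 0 < Re v) by (unfold v; rewrite re_plus; lra).
  assert (Sv : slit v) by now left.
  exists (Re (Clog v)), (Im (Clog v)).
  assert (Eb : Im (Clog v) = atan (Im v / Re v)) by (apply Carg_right; exact Hv).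
  assert (Bb := atan_bound (Im v / Re v)). rewrite <- Eb in Bb.
  assert (E1 := Cexp_Clog v Sv).
  assert (E3 : Cexp (- Clog v) = (s - w)%C).
  { rewrite Cexp_opp, E1. assert (Hvn := slit_nz v Sv).
    assert (P : (v * (s - w))%C = RtoC 1).
    { unfold v. replace ((w + s) * (s - w))%C with (s * s - w * w)%C by ring. rewrite E2. ring. }
    replace (s - w)%C with (/ v * (v * (s - w)))%C by (field; exact Hvn). rewrite P. ring. }
  set (a := Re (Clog v)) in *. set (b := Im (Clog v)) in *.
  assert (R1 : Re (w + s)%C = exp a * cos b) by (unfold v in E1; rewrite <- E1; reflexivity).
  assert (I1 : Im (w + s)%C = exp a * sin b) by (unfold v in E1; rewrite <- E1; reflexivity).
  assert (R2 : Re (s - w)%C = exp (- a) * cos b).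
  { rewrite <- E3. unfold Cexp. simpl Re. change (Re (- Clog v)) with (- a). change (Im (- Clog v)) with
    (- b).
    rewrite cos_neg. reflexivity. }
  assert (I2 : Im (s - w)%C = - (exp (- a) * sin b)).
  { rewrite <- E3. unfold Cexp. change (Re (- Clog v)) with (- a). change (Im (- Clog v)) with (- b).
    rewrite sin_neg. unfold Im. simpl. ring. }
  rewrite re_plus in R1. rewrite im_plus in I1. rewrite re_minus in R2. rewrite im_minus in I2.
  assert (Ew : Re w = sinh a * cos b) by (unfold sinh; lra).
  assert (Ewi : Im w = cosh a * sin b) by (unfold cosh; lra).
  assert (Es : Re s = cosh a * cos b) by (unfold cosh; lra).
  assert (Esi : Im s = sinh a * sin b) by (unfold sinh; lra).
  assert (Hcb : 0 < cos b) by (apply cos_gt_0; lra).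
  split; [|split; [|split; [lra|split]]].
  - apply injective_projections; reflexivity.
  - rewrite Ew in Hw. apply Rnot_le_lt. intros Ha.
    assert (sinh a <= 0).
    { unfold sinh. assert (exp a <= exp (- a)).
      { destruct (Req_dec a 0) as [->|n]; [rewrite Ropp_0; lra|]. left. apply exp_increasing. lra. }
      lra. }
    nra.
  - apply injective_projections; assumption.
  - apply injective_projections; assumption.
Qed.

Lemma Cmod_sinh_sqr a b : Cmod (sinh a * cos b, cosh a * sin b) ^ 2 = sinh a ^ 2 + sin b ^ 2.
Proof.
  rewrite Cmod2_alt. simpl Re; simpl Im. assert (H := cosh2_sinh2 a). assert (H2 := sin2_cos2 b).
  unfold Rsqr in H2. unfold Re, Im. simpl. nra.
Qed.

Lemma Cmod_cosh_sqr a b : Cmod (cosh a * cos b, sinh a * sin b) ^ 2 = sinh a ^ 2 + cos b ^ 2.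
Proof.
  rewrite Cmod2_alt. assert (H := cosh2_sinh2 a). assert (H2 := sin2_cos2 b).
  unfold Rsqr in H2. unfold Re, Im. simpl. nra.
Qed.

Lemma sinh_ge_id a : 0 <= a -> a <= sinh a.
Proof.
  intros [Ha|<-]; [|rewrite sinh_0; lra].
  destruct (MVT_gen (fun x => sinh x - x) 0 a (fun x => cosh x - 1)) as [c [Hc E]].
  - intros x _. apply (is_derive_minus (V := R_NormedModule) sinh (fun x => x)).
    + apply is_derive_Reals, derivable_pt_lim_sinh.
    + apply (is_derive_id (K := R_AbsRing)).
  - intros x _. apply continuity_pt_minus; [|apply continuity_pt_id].
    apply derivable_continuous_pt, derivable_pt_sinh.
  - rewrite sinh_0 in E.
    assert (1 <= cosh c).
    { assert (H := cosh2_sinh2 c). assert (0 < cosh c).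
      { unfold cosh. generalize (exp_pos c) (exp_pos (- c)). lra. }
      nra. }
    nra.
Qed.

Lemma sinh_le_double a : 0 <= a <= 1 -> sinh a <= 2 * a.
Proof.
  intros [[Ha|<-] H1]; [|rewrite sinh_0; lra].
  destruct (MVT_gen sinh 0 a cosh) as [c [Hc E]].
  - intros x _. apply is_derive_Reals, derivable_pt_lim_sinh.
  - intros x _. apply derivable_continuous_pt, derivable_pt_sinh.
  - rewrite Rmin_left, Rmax_right in Hc by lra. rewrite sinh_0 in E.
    assert (cosh c <= 2).
    { unfold cosh. assert (exp c <= exp 1).
      { destruct (Req_dec c 1) as [->|n]; [lra|]. left. apply exp_increasing. lra. }
      assert (exp (- c) <= 1).
      { rewrite <- exp_0. destruct (Req_dec c 0) as [->|n]; [rewrite Ropp_0; lra|].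
        left. apply exp_increasing. lra. }
      generalize exp_le_3. lra. }
    nra.
Qed.

Lemma Rabs_sin_le b : Rabs (sin b) <= Rabs b.
Proof.
  assert (P : forall b, 0 <= b -> sin b <= b).
  { intros x [Hx|<-]; [left; now apply sin_lt_x|rewrite sin_0; lra]. }
  assert (Q : forall b, 0 <= b -> - b <= sin b).
  { intros x Hx. destruct (Rle_dec x PI) as [H|H].
    - assert (0 <= sin x) by (apply sin_ge_0; lra). lra.
    - generalize (SIN_bound x) PI_bounds. lra. }
  destruct (Rle_dec 0 b) as [H|H].
  - rewrite (Rabs_pos_eq b) by exact H. apply Rabs_le. split; [now apply Q|now apply P].
  - rewrite (Rabs_left b) by lra. apply Rabs_le.
    assert (H1 := P (- b) ltac:(lra)). assert (H2 := Q (- b) ltac:(lra)). rewrite sin_neg in H1, H2. lra.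
Qed.

(* [|z / (1 + z)| <= sqrt 2 |tanh z|] *)
Lemma asinh_ratio_upper a b : 0 < a -> - (PI / 2) < b < PI / 2 ->
  (a ^ 2 + b ^ 2) * (sinh a ^ 2 + cos b ^ 2) <= 2 * (sinh a ^ 2 + sin b ^ 2) * ((1 + a) ^ 2 + b ^ 2).
Proof.
  intros Ha Hb. generalize PI_bounds; intros HP.
  assert (HS := sinh_ge_id a ltac:(lra)). set (S := sinh a ^ 2).
  assert (HS2 : a ^ 2 <= S) by (unfold S; nra).
  assert (H := sin2_cos2 b). unfold Rsqr in H.
  assert (Hsc : sin b ^ 2 + cos b ^ 2 = 1) by (simpl; lra).
  set (p := sin b ^ 2) in *. set (q := cos b ^ 2) in *.
  assert (Hp : 0 <= p) by (unfold p; nra). assert (Hq : 0 <= q) by (unfold q; nra).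
  set (B := b ^ 2). assert (HB : 0 <= B) by (unfold B; nra).
  assert (HA : 0 < a ^ 2) by nra.
  assert (HD : a ^ 2 + 1 + B <= (1 + a) ^ 2 + B) by nra.
  (* When $\cos^2b\le\sin^2b$, replacing the cosine by the sine suffices. Otherwise $|b|\le\pi/4$,
     and there $b^2\le2\sin^2b$. *)
  destruct (Rle_dec q p) as [Hqp|Hqp].
  - apply Rle_trans with ((a ^ 2 + B) * (S + p)); [apply Rmult_le_compat_l; lra|]. nra.
  - assert (Hpb : B <= 2 * p).
    { assert (Sb : 0.57 * Rabs b <= Rabs (sin b)).
      { destruct (Rle_dec 0 b) as [H0|H0].
        - rewrite (Rabs_pos_eq b) by exact H0. eapply Rle_trans; [apply sin_ge_linear; lra|apply Rle_abs].
        - rewrite (Rabs_left b) by lra. assert (L := sin_ge_linear (- b) ltac:(lra)).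
          rewrite sin_neg in L. eapply Rle_trans; [exact L|]. rewrite <- Rabs_Ropp. apply Rle_abs. }
      assert (Hb4 : Rabs b <= PI / 4).
      { apply Rnot_lt_le. intros Hlt. apply Hqp.
        assert (Hs : sin (PI / 4) <= sin (Rabs b)).
        { left. apply sin_increasing_1; try lra. unfold Rabs in *. destruct Rcase_abs; lra. }
        assert (Hs2 : sin (Rabs b) ^ 2 = p).
        { unfold p, Rabs. destruct Rcase_abs; [rewrite sin_neg; ring|reflexivity]. }
        assert (H4 : sin (PI / 4) ^ 2 = 1 / 2).
        { assert (X := sin2_cos2 (PI / 4)). rewrite <- sin_cos_PI4 in X. unfold Rsqr in X. simpl. lra. }
        assert (0 < sin (PI / 4)) by (apply sin_gt_0; lra). nra. }
      (* The cubic Taylor bound on $[0,\pi/4]$, where $u^2\le0.65$. Squared, it gives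
         $b^2\le2\sin^2b$ with room to spare. *)
      assert (Sb3 : Rabs b * 0.89 <= Rabs (sin b)).
      { assert (Abs : Rabs (sin b) = sin (Rabs b)).
        { unfold Rabs at 2. destruct Rcase_abs as [Hn|Hn].
          - rewrite sin_neg. apply Rabs_left1. rewrite <- (Ropp_involutive b), sin_neg.
            assert (0 <= sin (- b)) by (apply sin_ge_0; lra). lra.
          - apply Rabs_pos_eq. apply sin_ge_0; lra. }
        rewrite Abs. destruct (sin_bound (Rabs b) 0) as [X _]; [apply Rabs_pos|lra|].
        unfold sin_approx, sin_term in X. simpl in X.
        assert (Y := Rabs_pos b). set (u := Rabs b) in *.
        assert (u * u <= 0.65) by nra.
        assert (u * (u * u) <= u * 0.65) by (apply Rmult_le_compat_l; lra). lra. }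
      unfold B, p. rewrite <- (pow2_abs b), <- (pow2_abs (sin b)).
      assert (Y := Rabs_pos b). set (u := Rabs b) in *. set (v := Rabs (sin b)) in *. nra. }
    apply Rle_trans with (2 * (S + p) * (a ^ 2 + 1 + B)).
    2: { apply Rmult_le_compat_l; [lra|exact HD]. }
    assert (X1 : a ^ 2 + B <= 2 * (a ^ 2 + p)) by lra.
    (* cross-multiplied monotonicity in [S >= a^2] *)
    assert (X2 : (a ^ 2 + B) * (S + 1) <= 2 * (S + p) * (a ^ 2 + 1 + B)) by nra.
    apply Rle_trans with ((a ^ 2 + B) * (S + 1)); [apply Rmult_le_compat_l; lra|exact X2].
Qed.

(* [|tanh z| |1 + z| <= sqrt (8 (1 + 1 / c)) |z|] for [z = asinh w], when [|1 + w^2| >= c (1 + |w|^2)] *)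
Lemma asinh_ratio_lower a b c W S2 : 0 < a -> 0 < c ->
  W = sinh a ^ 2 + sin b ^ 2 -> c * (1 + W) <= S2 ->
  W * ((1 + a) ^ 2 + b ^ 2) <= 8 * (1 + 1 / c) * (a ^ 2 + b ^ 2) * S2.
Proof.
  intros Ha Hc HW HS. set (Z := a ^ 2 + b ^ 2). assert (HZ : 0 < Z) by (unfold Z; nra).
  assert (HW0 : 0 <= W) by (rewrite HW; nra).
  assert (H1 : (1 + a) ^ 2 + b ^ 2 <= 2 + 2 * Z)
    by (generalize (pow2_ge_0 (1 - a)) (pow2_ge_0 b); unfold Z; intros; nra).
  assert (Main : W * (1 + Z) <= 4 * Z * (1 + W)).
  (* If $3Z\ge1$, the term $3ZW$ alone pays for $W$. Otherwise [a] is below one and $W\le4Z$ holds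
     directly. *)
  { destruct (Rle_dec 1 (3 * Z)) as [H|H]; [nra|].
    assert (Ha1 : a <= 1) by (unfold Z in H; nra).
    assert (Hsa := sinh_le_double a ltac:(lra)). assert (Hsa0 := sinh_ge_id a ltac:(lra)).
    assert (Hsb := Rabs_sin_le b).
    assert (sinh a ^ 2 <= 4 * a ^ 2) by nra.
    assert (sin b ^ 2 <= b ^ 2).
    { rewrite <- (pow2_abs b), <- (pow2_abs (sin b)). generalize (Rabs_pos (sin b)). intros. nra. }
    assert (W <= 4 * Z) by (unfold Z; nra). nra. }
  apply Rle_trans with (W * (2 + 2 * Z)); [apply Rmult_le_compat_l; lra|].
  apply Rle_trans with (8 * Z * (1 + W)); [lra|].
  assert (Hic : 0 < / c) by now apply Rinv_0_lt_compat.
  assert (H2 : 1 + W <= (1 + 1 / c) * S2).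
  { assert (1 + W <= / c * S2).
    { apply Rmult_le_reg_l with c; [exact Hc|]. rewrite <- Rmult_assoc, Rinv_r, Rmult_1_l by lra. exact HS. }
    assert (0 <= S2) by nra. unfold Rdiv. lra. }
  replace (8 * (1 + 1 / c) * Z * S2) with (8 * Z * ((1 + 1 / c) * S2)) by ring.
  apply Rmult_le_compat_l; lra.
Qed.

(* [z / (1 + z) <= tanh z <= 2 z / (1 + z)] on the positive reals *)
Lemma asinh_ratio_real u : 0 < u -> u * cosh u <= (1 + u) * sinh u /\ (1 + u) * sinh u <= 2 * u * cosh u.
Proof.
  intros Hu. assert (P := exp_pos (- u)). assert (Q := exp_pos u).
  assert (E : exp u * exp (- u) = 1) by (rewrite <- exp_plus, Rplus_opp_r; apply exp_0).
  assert (L1 := exp_ge_1_plus (2 * u)).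
  assert (E2 : exp (2 * u) = exp u * exp u) by (rewrite <- exp_plus; f_equal; ring).
  split.
  - unfold cosh, sinh. apply Rmult_le_reg_r with (2 * exp u); [lra|]. nra.
  (* For $u\ge1$, use $1+u\le2u$ and $\sinh\le\cosh$. Below one, use $1+u\le2$ and $\tanh u\le
     u$. *)
  - destruct (Rle_dec 1 u) as [H|H].
    + unfold cosh, sinh. nra.
    + assert (T : sinh u <= u * cosh u).
      { destruct (MVT_gen (fun x => x * cosh x - sinh x) 0 u (fun x => x * sinh x)) as [c [Hc Ec]].
        - intros x _. replace (x * sinh x) with ((1 * cosh x + x * sinh x) - cosh x) by ring.
          apply (is_derive_minus (V := R_NormedModule) (fun x => x * cosh x) sinh).
          + apply is_derive_Reals, (derivable_pt_lim_mult (fun x => x) cosh);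
              [apply derivable_pt_lim_id|apply derivable_pt_lim_cosh].
          + apply is_derive_Reals, derivable_pt_lim_sinh.
        - intros x _. apply continuity_pt_minus.
          + apply continuity_pt_mult; [apply continuity_pt_id|]. apply derivable_continuous_pt,
            derivable_pt_cosh.
          + apply derivable_continuous_pt, derivable_pt_sinh.
        - rewrite Rmin_left, Rmax_right in Hc by lra. rewrite sinh_0, Rmult_0_l in Ec.
          assert (c <= sinh c) by (apply sinh_ge_id; lra).
          assert (0 <= c * sinh c * (u - 0)) by (apply Rmult_le_pos; [apply Rmult_le_pos|]; lra). lra. }
      assert (0 < cosh u) by (unfold cosh; lra). assert (0 < sinh u) by now apply sinh_pos.
      assert ((1 + u) * sinh u <= 2 * sinh u) by (apply Rmult_le_compat_r; lra). lra.
Qed.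

(** * The integrand transformed by asinh of exp *)

Definition asinh_integrand (f : C -> C) (z : C) : C := (f (psiC 3 z) * (Cexp z / Croot z))%C.

Lemma strip_near (z : C) d : Rabs (Im z) < d ->
  exists del, 0 < del /\ forall w, Cmod (w - z) < del -> Rabs (Im w) < d.
Proof.
  intros Hz. exists (d - Rabs (Im z)). split; [lra|]. intros w Hw.
  assert (H := im_le_Cmod (w - z)). rewrite im_minus in H.
  replace (Im w) with ((Im w - Im z) + Im z) by ring.
  eapply Rle_lt_trans; [apply Rabs_triang|lra].
Qed.

Lemma cdiff_Croot z d : d < PI / 2 -> Rabs (Im z) < d -> cdiff Croot z.
Proof.
  intros Hd Hz. unfold Croot.
  apply (cdiff_comp (fun z => RtoC (1 / 2) * Clog (Cexp z * Cexp z + 1))%C Cexp);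
    [|eexists; apply cderiv_Cexp].
  apply cdiff_mult; [apply cdiff_const|].
  apply (cdiff_comp (fun z => Cexp z * Cexp z + 1)%C Clog).
  - apply cdiff_plus; [|apply cdiff_const]. apply cdiff_mult; eexists; apply cderiv_Cexp.
  - eexists. apply cderiv_Clog. now apply slit_1_Cexp_sqr with d.
Qed.

Lemma psiC3_Croot z d : d < PI / 2 -> Rabs (Im z) < d -> psiC 3 z = Clog (Cexp z + Croot z)%C.
Proof. intros Hd Hz. rewrite <- (Croot_Cpow z d Hd Hz). reflexivity. Qed.

Lemma asinh_integrand_cdiff f d : d < PI / 2 -> analytic_on (psi_domain 3 d) f ->
  forall z, Rabs (Im z) < d -> cdiff (asinh_integrand f) z.
Proof.
  intros Hd Hf z Hz. assert (Hr := Croot_re z d Hd Hz). assert (Hw := Cexp_half_plane z d Hd Hz).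
  apply cdiff_mult.
  - apply (cdiff_comp (psiC 3) f).
    + destruct (strip_near z d Hz) as [del [Hdel Hn]].
      assert (D : cdiff (fun w => Clog (Cexp w + Croot w)%C) z).
      { apply (cdiff_comp (fun w => Cexp w + Croot w)%C Clog).
        - apply cdiff_plus; [eexists; apply cderiv_Cexp|now apply cdiff_Croot with d].
        - eexists. apply cderiv_Clog. left. rewrite re_plus. lra. }
      destruct D as [l Hl]. exists l. apply cderiv_ext_loc with (del := del) (3 := Hl); [exact Hdel|].
      intros w Hm. symmetry. apply psiC3_Croot with d; [exact Hd|now apply Hn].
    + apply ex_derive_cdiff, Hf. now exists z.
  - apply cdiff_div.
    + intros E. rewrite E in Hr. simpl in Hr. lra.
    + eexists; apply cderiv_Cexp.
    + now apply cdiff_Croot with d.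
Qed.

Lemma Rpower_sqr_half r e : 0 < r -> Rpower r e = Rpower (r ^ 2) (e / 2).
Proof.
  intros Hr. rewrite <- (Rpower_pow 2 r Hr), Rpower_mult. f_equal. simpl. field.
Qed.

(* The hypothesis compares [|z / (1 + z)|] with [|tanh z|] at [z = asinh (exp zeta)]. *)
Lemma asinh_integrand_bound f d K al be z cc : d < PI / 2 -> Rabs (Im z) < d -> 0 < K -> 0 < be ->
  (forall w, psi_domain 3 d w -> Cmod (f w) <= K * Cmod (E_fun 3 al be w)) ->
  (forall a b, psiC 3 z = ((a, b) : C) -> 0 < a -> - (PI / 2) < b < PI / 2 ->
     Cexp z = ((sinh a * cos b, cosh a * sin b) : C) -> 
     Rpower ((a ^ 2 + b ^ 2) / ((1 + a) ^ 2 + b ^ 2)) ((al - 1) / 2)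
     <= cc * Rpower (Cmod (Cexp z) ^ 2 / (sinh a ^ 2 + cos b ^ 2)) ((al - 1) / 2)) ->
  Cmod (asinh_integrand f z) <= K * cc * (exp (al * Re z) * Rpower (Cmod (1 + Cexp z * Cexp z)) (- ((al +
    be) / 2))).
Proof.
  intros Hd Hz HK Hb Hf Hcc.
  destruct (asinh_coordinates z d Hd Hz) as [a [b [E [Ha [Hbb [Ew Es]]]]]].
  specialize (Hcc a b E Ha Hbb Ew).
  assert (Hr := Croot_re z d Hd Hz).
  assert (Hsn : Croot z <> RtoC 0) by (intros E0; rewrite E0 in Hr; simpl in Hr; lra).
  unfold asinh_integrand. rewrite Cmod_mult, (Cmod_div _ _ Hsn).
  set (S := Cmod (Croot z)). assert (HS : 0 < S) by now apply Cmod_gt_0.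
  set (W := Cmod (Cexp z)) in *. assert (HW : 0 < W) by (apply Cmod_gt_0, Cexp_nz).
  assert (HS2 : S ^ 2 = sinh a ^ 2 + cos b ^ 2) by (unfold S; rewrite Es; apply Cmod_cosh_sqr).
  assert (HP : Cmod (1 + Cexp z * Cexp z) = S ^ 2).
  { rewrite Cplus_comm. rewrite <- (Croot_sqr z d Hd Hz), Cmod_mult.
    unfold S. ring. }
  rewrite HP. rewrite <- HS2 in Hcc.
  assert (Hf1 : Cmod (f (psiC 3 z)) <= K * (Rpower ((a ^ 2 + b ^ 2) / ((1 + a) ^ 2 + b ^ 2)) ((al - 1) / 2)
     * exp (- be * a))).
  { eapply Rle_trans; [apply Hf; now exists z|]. right. f_equal. rewrite E. unfold E_fun.
    assert (N1 : ((a, b) : C) <> RtoC 0) by (intros E0; injection E0; lra).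
    assert (N2 : (1 + ((a, b) : C))%C <> RtoC 0) by (intros E0; apply (f_equal Re) in E0; simpl in E0; lra).
    assert (M1 : 0 < Cmod (a, b)) by now apply Cmod_gt_0.
    assert (M2 : 0 < Cmod (1 + ((a, b) : C))) by now apply Cmod_gt_0.
    rewrite Cmod_mult, Cmod_Cpow_real, Cmod_Cexp, re_scal_l, Cmod_div by
      (try exact N2; intros E0; apply (f_equal Cmod) in E0; rewrite Cmod_div, Cmod_0 in E0 by exact N2;
       assert (0 < Cmod (a, b) / Cmod (1 + ((a, b) : C))) by (now apply Rdiv_lt_0_compat); lra).
    change (Re (a, b)) with a. f_equal.
    rewrite Rpower_sqr_half by now apply Rdiv_lt_0_compat. f_equal.
    unfold Rdiv. rewrite Rpow_mult_distr, pow_inv, !Cmod2_alt. f_equal.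
    f_equal. unfold Re, Im, Cplus, RtoC; simpl. ring. }
  (* $S=|\cosh(a+ib)|\le\cosh a\le e^a$, and the exponent is negative. *)
  assert (Hexp : exp (- be * a) <= Rpower S (- be)).
  { rewrite <- Rpower_exp_l. apply Rpower_le_neg; [exact HS| |lra].
    apply Rsqr_incr_0_var; [|left; apply exp_pos]. unfold Rsqr.
    replace (S * S) with (S ^ 2) by ring. rewrite HS2.
    assert (H1 := cosh2_sinh2 a). assert (H2 := sin2_cos2 b). unfold Rsqr in H2.
    assert (0 <= sin b * sin b) by apply Rle_0_sqr.
    assert (Hc : cosh a <= exp a).
    { unfold cosh. assert (exp (- a) <= exp a) by (left; apply exp_increasing; lra). lra. }
    assert (0 < cosh a) by (unfold cosh; generalize (exp_pos a) (exp_pos (- a)); lra).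
    assert (cosh a * cosh a <= exp a * exp a) by nra.
    simpl. lra. }
  (* The modulus [W / S] of the derivative of $\psi_3$ raises the exponent from [al - 1] to [al];
     with $W=e^{\Re z}$ and $S^2=|1+w^2|$ the common weight appears. *)
  assert (EW : Rpower (W ^ 2 / S ^ 2) ((al - 1) / 2) * Rpower S (- be) * (W / S) =
     exp (al * Re z) * Rpower (S ^ 2) (- ((al + be) / 2))).
  { replace (W ^ 2 / S ^ 2) with ((W / S) ^ 2) by (field; lra).
    assert (HWS : 0 < W / S) by now apply Rdiv_lt_0_compat.
    rewrite <- Rpower_sqr_half by exact HWS.
    replace (W / S) with (Rpower (W / S) 1) at 2 by now apply Rpower_1.
    rewrite (Rmult_comm _ (Rpower S (- be))), Rmult_assoc, <- Rpower_plus.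
    replace (al - 1 + 1) with al by ring.
    replace (- ((al + be) / 2)) with (- (al + be) / 2) by field. rewrite <- Rpower_sqr_half by exact HS.
    unfold W at 1. rewrite Cmod_Cexp. unfold Rdiv. rewrite <- Rpower_mult_distr;
      [|apply exp_pos|now apply Rinv_0_lt_compat].
    rewrite Rpower_exp_l.
    replace (Rpower (/ S) al) with (Rpower S (- al)).
    2: { unfold Rpower. rewrite ln_Rinv by exact HS. f_equal. ring. }
    replace (- (al + be)) with (- al + - be) by ring. rewrite Rpower_plus. ring. }
  assert (HRS : 0 < Rpower S (- be)) by apply exp_pos.
  assert (HWS : 0 < W / S) by now apply Rdiv_lt_0_compat.
  apply Rle_trans with (K * (cc * Rpower (W ^ 2 / S ^ 2) ((al - 1) / 2) * Rpower S (- be)) * (W / S)).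
  - apply Rmult_le_compat_r; [lra|]. eapply Rle_trans; [exact Hf1|].
    apply Rmult_le_compat_l; [lra|]. apply Rmult_le_compat; [left; apply exp_pos|left; apply
      exp_pos|exact Hcc|exact Hexp].
  - right. rewrite <- EW. ring.
Qed.

Definition asinh_strip_factor (al be d : R) : R := Rpower 2 (1 + be / 2) * c_alpha_d al d.

Lemma Rpower_ge_1 x e : 1 <= x -> 0 <= e -> 1 <= Rpower x e.
Proof.
  intros Hx He. replace 1 with (Rpower 1 e).
  - apply Rle_Rpower_l; lra.
  - unfold Rpower. rewrite ln_1, Rmult_0_r. apply exp_0.
Qed.

(** The sign of [al - 1] decides which comparison applies: a negative exponent calls for
    [asinh_ratio_lower], a nonnegative one for [asinh_ratio_upper]. This is the case split in
    [c_alpha_d]. *)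
Lemma asinh_integrand_ratio z d al be : 0 < d -> d < PI / 2 -> Rabs (Im z) < d -> 0 < al -> 0 < be ->
  forall a b, 0 < a -> - (PI / 2) < b < PI / 2 ->
     Cexp z = ((sinh a * cos b, cosh a * sin b) : C) -> Cmod (1 + Cexp z * Cexp z) = sinh a ^ 2 + cos b ^ 2 ->
     Rpower ((a ^ 2 + b ^ 2) / ((1 + a) ^ 2 + b ^ 2)) ((al - 1) / 2)
     <= asinh_strip_factor al be d * Rpower (Cmod (Cexp z) ^ 2 / (sinh a ^ 2 + cos b ^ 2)) ((al - 1) / 2).
Proof.
  intros Hd0 Hd Hz Hal Hbe a b Ha Hb Ew EP.
  assert (EW : Cmod (Cexp z) ^ 2 = sinh a ^ 2 + sin b ^ 2) by (rewrite Ew; apply Cmod_sinh_sqr).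
  assert (HW : 0 < Cmod (Cexp z) ^ 2) by (apply pow_lt, Cmod_gt_0, Cexp_nz).
  set (W := Cmod (Cexp z) ^ 2) in *.
  assert (Hcb : 0 < cos b) by (apply cos_gt_0; lra).
  assert (HS : 0 < sinh a ^ 2 + cos b ^ 2) by nra.
  set (S := sinh a ^ 2 + cos b ^ 2) in *.
  set (Z := a ^ 2 + b ^ 2). assert (HZ : 0 < Z) by (unfold Z; nra).
  set (Y := (1 + a) ^ 2 + b ^ 2). assert (HY : 0 < Y) by (unfold Y; nra).
  assert (HZY : 0 < Z / Y) by now apply Rdiv_lt_0_compat.
  assert (HWS : 0 < W / S) by now apply Rdiv_lt_0_compat.
  assert (P2 : 1 <= Rpower 2 (be / 2)) by (apply Rpower_ge_1; lra).
  assert (P3 : Rpower 2 (1 + be / 2) = 2 * Rpower 2 (be / 2)) by (rewrite Rpower_plus, Rpower_1 by lra;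
    reflexivity).
  unfold asinh_strip_factor, c_alpha_d. rewrite P3. destruct Rlt_dec as [H1|H1].
  - assert (Hc : 0 < cos d) by (apply cos_gt_0; lra).
    assert (Low := Cexp_sqr_lower z d Hd Hz). rewrite EP in Low.
    assert (E2 : exp (2 * Re z) = W).
    { unfold W. rewrite Cmod_Cexp. simpl. rewrite Rmult_1_r, <- exp_plus. f_equal. ring. }
    rewrite E2 in Low.
    assert (R := asinh_ratio_lower a b (cos d) W S Ha Hc EW Low). fold Z Y in R.
    set (q := 2 * (1 + 1 / cos d)) in *.
    assert (Hq : 0 < q) by (unfold q; assert (0 < 1 / cos d) by (apply Rdiv_lt_0_compat; lra); lra).
    assert (R2 : W / S <= 4 * q * (Z / Y)).
    { apply Rmult_le_reg_r with (S * Y); [nra|].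
      replace (W / S * (S * Y)) with (W * Y) by (field; lra).
      replace (4 * q * (Z / Y) * (S * Y)) with (8 * (1 + 1 / cos d) * Z * S) by (unfold q; field; lra).
        exact R. }
    set (e := (1 - al) / 2).
    replace ((al - 1) / 2) with (- e) by (unfold e; field).
    assert (He : 0 < e < 1 / 2) by (unfold e; lra).
    apply Rle_trans with (Rpower 4 e * Rpower q e * Rpower (W / S) (- e)).
    + rewrite Rpower_mult_distr by lra.
      apply Rmult_le_reg_l with (Rpower (4 * q) (- e)); [apply exp_pos|].
      rewrite <- Rmult_assoc, <- Rpower_plus. replace (- e + e) with 0 by ring.
      rewrite Rpower_O, Rmult_1_l by lra. rewrite Rpower_mult_distr by lra.
      apply Rpower_le_neg; lra.
    + apply Rmult_le_compat_r; [left; apply exp_pos|].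
      apply Rmult_le_compat_r; [left; apply exp_pos|].
      (* Since [e < 1 / 2]; this 2 is the one in [Rpower 2 (1 + be / 2) = 2 * Rpower 2 (be / 2)]. *)
      assert (Rpower 4 e <= 2).
      { replace 2 with (Rpower 4 (1 / 2)).
        - apply Rle_Rpower; lra.
        - replace (1 / 2) with (/ 2) by field. rewrite Rpower_sqrt by lra.
          replace 4 with (2 * 2) by ring. apply sqrt_square. lra. }
      lra.
  - assert (R := asinh_ratio_upper a b Ha Hb). fold Z S Y in R. rewrite <- EW in R.
    assert (R2 : Z / Y <= 2 * (W / S)).
    { apply Rmult_le_reg_r with (S * Y); [nra|].
      replace (Z / Y * (S * Y)) with (Z * S) by (field; lra).
      replace (2 * (W / S) * (S * Y)) with (2 * W * Y) by (field; lra). exact R. }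
    apply Rle_trans with (Rpower 2 ((al - 1) / 2) * Rpower (W / S) ((al - 1) / 2)).
    + rewrite Rpower_mult_distr by lra. apply Rle_Rpower_l; lra.
    + apply Rmult_le_compat_r; [left; apply exp_pos|].
      assert (0 < Rpower 2 ((al - 1) / 2)) by apply exp_pos.
      nra.
Qed.

Lemma asinh_sqr_mod z d a b : d < PI / 2 -> Rabs (Im z) < d -> 0 < a -> - (PI / 2) < b < PI / 2 ->
  Cexp z = ((sinh a * cos b, cosh a * sin b) : C) ->
  Cmod (1 + Cexp z * Cexp z) = sinh a ^ 2 + cos b ^ 2.
Proof.
  intros Hd Hz Ha Hb E. rewrite <- Cmod_cosh_sqr.
  replace (1 + Cexp z * Cexp z)%C
    with (Cmult (cosh a * cos b, sinh a * sin b) (cosh a * cos b, sinh a * sin b)).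
  - rewrite Cmod_mult. ring.
  - rewrite E. assert (H := cosh2_sinh2 a). assert (H2 := sin2_cos2 b). unfold Rsqr in H2.
    apply injective_projections; simpl; [|ring].
    replace (cosh a * cos b * (cosh a * cos b) - sinh a * sin b * (sinh a * sin b))
      with (cosh a * cosh a * (cos b * cos b) - sinh a * sinh a * (sin b * sin b)) by ring.
    replace (1 + (sinh a * cos b * (sinh a * cos b) - cosh a * sin b * (cosh a * sin b)))
      with (1 + sinh a * sinh a * (cos b * cos b) - cosh a * cosh a * (sin b * sin b)) by ring.
    rewrite H. replace (cos b * cos b) with (1 - sin b * sin b) by lra. ring.
Qed.

Lemma asinh_integrand_decays f d K al be : 0 < d -> d < PI / 2 -> 0 < K -> 0 < al -> 0 < be ->
  (forall w, psi_domain 3 d w -> Cmod (f w) <= K * Cmod (E_fun 3 al be w)) ->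
  decays (asinh_integrand f) d (K * asinh_strip_factor al be d / Rpower (cos d) ((al + be) / 2)) al be.
Proof.
  intros Hd0 Hd HK Ha Hb H. apply decays_of_weight; try assumption.
  - apply Rmult_le_pos; [lra|]. unfold asinh_strip_factor, c_alpha_d.
    apply Rmult_le_pos; [left; apply exp_pos|]. destruct Rlt_dec; left; apply exp_pos.
  - apply cos_gt_0; lra.
  - intros z Hz. now apply Cexp_sqr_lower.
  - intros z Hz. apply asinh_integrand_bound with d; try assumption.
    intros a b _ Ha0 Hb0 Ew. apply asinh_integrand_ratio; try assumption.
    now apply (asinh_sqr_mod z d).
Qed.

Lemma asinh_coordinates_real (t : R) a b : - (PI / 2) < b < PI / 2 ->
  Cexp t = ((sinh a * cos b, cosh a * sin b) : C) -> b = 0 /\ sinh a = exp t.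
Proof.
  intros Hb E. rewrite Cexp_RtoC in E. injection E as E1 E2.
  assert (0 < cosh a) by (unfold cosh; generalize (exp_pos a) (exp_pos (- a)); lra).
  assert (Hs : sin b = 0) by (symmetry in E2; apply Rmult_integral in E2; destruct E2; [lra|assumption]).
  assert (b = 0).
  { destruct (Rlt_dec 0 b) as [H1|H1]; [|destruct (Rlt_dec b 0) as [H2|H2]; [|lra]].
    - assert (0 < sin b) by (apply sin_gt_0; lra). lra.
    - assert (sin b < 0) by (apply sin_lt_0_var; lra). lra. }
  split; [assumption|]. subst. rewrite cos_0, Rmult_1_r in E1. now symmetry.
Qed.

Lemma psiC3_real (t : R) : psiC 3 t = RtoC (psiR 3 t).
Proof.
  generalize PI_RGT_0; intros HP.
  destruct (asinh_coordinates t (PI / 4)) as [a [b [E [Ha [Hb [Ew _]]]]]]; [lra|simpl; rewrite Rabs_R0; lra|].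
  destruct (asinh_coordinates_real t a b Hb Ew) as [-> Es].
  rewrite E. unfold psiR. rewrite <- Es, arcsinh_sinh. reflexivity.
Qed.

(** Equals $2^{1-\alpha}$ for $\alpha<1$ and $1$ otherwise: only a negative exponent pays for the
    factor 2 in [asinh_ratio_real]. *)
Definition asinh_real_factor (al : R) : R := Rpower 2 ((1 - al + Rabs (1 - al)) / 2).

Lemma asinh_integrand_real_decays f d K al be : 0 < d -> d < PI / 2 -> 0 < K -> 0 < al -> 0 < be ->
  (forall w, psi_domain 3 d w -> Cmod (f w) <= K * Cmod (E_fun 3 al be w)) ->
  real_decays (asinh_integrand f) (K * asinh_real_factor al) al be.
Proof.
  intros Hd0 Hd HK Ha Hb H t.
  assert (Hz : Rabs (Im t) < d) by (simpl; rewrite Rabs_R0; lra).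
  assert (HT : 0 < asinh_real_factor al) by apply exp_pos.
  apply real_weight; try assumption; [apply Rmult_le_pos; lra|].
  rewrite <- one_plus_Cexp_sqr_real. change t with (Re t) at 2.
  apply asinh_integrand_bound with d; try assumption.
  intros a b _ Ha0 Hb0 Ew. destruct (asinh_coordinates_real t a b Hb0 Ew) as [-> Es].
  rewrite Cexp_RtoC, Cmod_R, Rabs_pos_eq, <- Es by (left; apply exp_pos).
  rewrite cos_0. assert (Hc := cosh2_sinh2 a).
  assert (Hch : 0 < cosh a) by (unfold cosh; generalize (exp_pos a) (exp_pos (- a)); lra).
  assert (Hsh := sinh_pos a Ha0).
  replace ((a ^ 2 + 0 ^ 2) / ((1 + a) ^ 2 + 0 ^ 2)) with ((a / (1 + a)) ^ 2) by (field; lra).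
  replace (sinh a ^ 2 / (sinh a ^ 2 + 1 ^ 2)) with ((sinh a / cosh a) ^ 2).
  2: { replace (sinh a ^ 2 + 1 ^ 2) with (cosh a ^ 2) by (simpl; lra). field. lra. }
  assert (P1 : 0 < a / (1 + a)) by (apply Rdiv_lt_0_compat; lra).
  assert (P2 : 0 < sinh a / cosh a) by now apply Rdiv_lt_0_compat.
  rewrite <- !Rpower_sqr_half by assumption.
  destruct (asinh_ratio_real a Ha0) as [R1 R2]. unfold asinh_real_factor.
  destruct (Rle_dec 1 al) as [H1|H1].
  - rewrite (Rabs_left1 (1 - al)) by lra.
    replace ((1 - al + - (1 - al)) / 2) with 0 by field. rewrite Rpower_O, Rmult_1_l by lra.
    apply Rle_Rpower_l; [lra|]. split; [exact P1|].
    apply Rmult_le_reg_r with ((1 + a) * cosh a); [apply Rmult_lt_0_compat; lra|].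
    replace (a / (1 + a) * ((1 + a) * cosh a)) with (a * cosh a) by (field; lra).
    replace (sinh a / cosh a * ((1 + a) * cosh a)) with ((1 + a) * sinh a) by (field; lra). exact R1.
  - rewrite (Rabs_pos_eq (1 - al)) by lra.
    replace ((1 - al + (1 - al)) / 2) with (- (al - 1)) by field.
    apply Rmult_le_reg_l with (Rpower 2 (al - 1)); [apply exp_pos|].
    rewrite <- Rmult_assoc, <- Rpower_plus. replace (al - 1 + - (al - 1)) with 0 by ring.
    rewrite Rpower_O, Rmult_1_l by lra. rewrite Rpower_mult_distr by lra.
    apply Rpower_le_neg; [exact P2| |lra].
    apply Rmult_le_reg_r with ((1 + a) * cosh a); [apply Rmult_lt_0_compat; lra|].
    replace (2 * (a / (1 + a)) * ((1 + a) * cosh a)) with (2 * a * cosh a) by (field; lra).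
    replace (sinh a / cosh a * ((1 + a) * cosh a)) with ((1 + a) * sinh a) by (field; lra). exact R2.
Qed.

Lemma is_derive_psiR3 t : is_derive (psiR 3) t (exp t / sqrt (exp t ^ 2 + 1)).
Proof.
  change (psiR 3) with (fun t => arcsinh (exp t)).
  assert (D := is_derive_comp arcsinh exp t _ _
    (proj2 (is_derive_Reals _ _ _) (derivable_pt_lim_arcsinh (exp t)))
    (proj2 (is_derive_Reals _ _ _) (derivable_pt_lim_exp t))).
  exact D.
Qed.

Lemma asinh_integrand_real f (t : R) : asinh_integrand f t = (f (RtoC (psiR 3 t)) * RtoC (exp t / sqrt
  (exp t ^ 2 + 1)))%C.
Proof.
  generalize PI_RGT_0; intros HP. unfold asinh_integrand. rewrite psiC3_real. f_equal.
  destruct (asinh_coordinates t (PI / 4)) as [a [b [_ [Ha [Hb [Ew Es]]]]]]; [lra|simpl; rewrite Rabs_R0;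
    lra|].
  destruct (asinh_coordinates_real t a b Hb Ew) as [-> E].
  assert (Hch : 0 < cosh a) by (unfold cosh; generalize (exp_pos a) (exp_pos (- a)); lra).
  assert (Hr : Croot t = RtoC (sqrt (exp t ^ 2 + 1))).
  { rewrite Es, cos_0, sin_0. unfold RtoC. f_equal; [|ring].
    rewrite <- E. replace (sinh a ^ 2 + 1) with (cosh a ^ 2) by (assert (H := cosh2_sinh2 a); simpl; lra).
    rewrite sqrt_pow2; lra. }
  rewrite Hr, Cexp_RtoC, RtoC_div; [reflexivity|].
  apply Rgt_not_eq, sqrt_lt_R0. generalize (pow2_ge_0 (exp t)). lra.
Qed.

(** * The improper integral and the final estimate *)

Lemma CInt_decay_bound (G : R -> C) B al a b : 0 <= B -> 0 < al -> a <= b ->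
  (forall t, ccont G t) -> (forall t, Cmod (G t) <= B * exp (al * t)) ->
  Cmod (CInt G a b) <= B / al * exp (al * b).
Proof.
  intros HB Hal Hab HG H.
  assert (I := is_RInt_exp B al a b ltac:(lra)).
  eapply Rle_trans.
  - apply (CInt_le G (fun s => B * exp (al * s))); [exact Hab|intros t _; apply HG|eexists; exact I|].
    intros; apply H.
  - rewrite (is_RInt_unique (V := R_CompleteNormedModule) _ _ _ _ I).
    assert (0 <= B / al * exp (al * a)).
    { apply Rmult_le_pos; [|left; apply exp_pos]. apply Rmult_le_pos; [exact HB|left; now apply
      Rinv_0_lt_compat]. }
    lra.
Qed.

Lemma exp_small c eps : 0 < c -> 0 < eps -> exists A, forall a, a < A -> exp (c * a) < eps.
Proof.
  intros Hc He. exists (ln eps / c). intros a Ha.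
  rewrite <- (exp_ln eps He). apply exp_increasing.
  replace (ln eps) with (c * (ln eps / c)) by (field; lra). now apply Rmult_lt_compat_l.
Qed.

(** By the Cauchy criterion, as no closed form of the limit is at hand; the integral between two far
    left points is exponentially small. *)
Lemma CInt_left_limit (G : R -> C) B al x : 0 <= B -> 0 < al ->
  (forall t, ccont G t) -> (forall t, Cmod (G t) <= B * exp (al * t)) ->
  exists I : C, filterlim (fun a => CInt G a x : C_R_CompleteNormedModule) (Rbar_locally m_infty) (locally I).
Proof.
  intros HB Hal HG H.
  apply (filterlim_locally_cauchy (U := C_R_CompleteNormedModule) (F := Rbar_locally m_infty)
    (fun a => CInt G a x)).
  intros eps.
  destruct (exp_small al (eps / (B / al + 1)) Hal) as [A HA].
  { apply Rdiv_lt_0_compat; [apply cond_pos|].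
    assert (0 <= B / al) by (apply Rmult_le_pos; [exact HB|left; now apply Rinv_0_lt_compat]). lra. }
  assert (HBa : 0 <= B / al) by (apply Rmult_le_pos; [exact HB|left; now apply Rinv_0_lt_compat]).
  assert (Main : forall u v, u <= v -> v < A -> Cmod (CInt G v x - CInt G u x)%C < eps).
  { intros u v Huv Hv.
    rewrite <- (CInt_Chasles G u v x) by (intros t _; apply HG).
    replace (CInt G v x - (CInt G u v + CInt G v x))%C with (- CInt G u v)%C by ring.
    rewrite Cmod_opp. eapply Rle_lt_trans; [apply (CInt_decay_bound G B al); assumption|].
    apply Rle_lt_trans with ((B / al + 1) * exp (al * v)).
    - apply Rmult_le_compat_r; [left; apply exp_pos|lra].
    - replace (pos eps) with ((B / al + 1) * (eps / (B / al + 1))) by (field; lra).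
      apply Rmult_lt_compat_l; [lra|now apply HA]. }
  exists (fun a => a < A). split; [now exists A|].
  assert (Ball : forall p q : C, Cmod (q - p)%C < eps -> ball (M := C_UniformSpace) p eps q).
  { intros p q Hpq. split; (eapply Rle_lt_trans; [|exact Hpq]).
    - apply (re_le_Cmod (q - p)%C).
    - apply (im_le_Cmod (q - p)%C). }
  intros u v Hu Hv. apply Ball.
  destruct (Rle_dec u v) as [Huv|Huv].
  - now apply Main.
  - rewrite <- Cmod_opp, Copp_minus_distr. apply Main; [lra|exact Hu].
Qed.

(** [RInt_gen] carries no information until convergence is shown. The limit in the variable $s$
    exists by [CInt_left_limit], and substitution transports it to the lower limit tending to zero
    from the right. *)
Lemma RInt_gen_substitution (f F : C -> C) (psi dpsi : R -> R) tau x B al :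
  (forall s, is_derive psi s (dpsi s)) -> (forall s, continuous dpsi s) ->
  (forall s t, s < t -> psi s < psi t) -> (forall s, 0 < psi s) ->
  (forall e, 0 < e -> exists s, psi s = e) -> psi x = tau ->
  (forall s, ccont (fun t => f (RtoC t)) (psi s)) ->
  (forall s : R, F s = (f (RtoC (psi s)) * RtoC (dpsi s))%C) ->
  0 <= B -> 0 < al -> (forall s : R, cdiff F s) -> (forall s : R, Cmod (F s) <= B * exp (al * s)) ->
  forall eps, 0 < eps -> exists A, forall a, a < A ->
    Cmod (@RInt_gen C_R_CompleteNormedModule (fun t : R => f (RtoC t)) (at_right 0) (at_point tau)
      - CInt (fun t => F (RtoC t)) a x)%C <= eps.
Proof.
  intros Hpsi Hdpsi Hinc Hpos Hsurj Htau Hf HF HB Hal HdF HBd.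
  set (G := fun t : R => F (RtoC t)).
  assert (CG : forall t, ccont G t).
  { intros t. apply (ccont_comp RtoC F); [apply ccont_RtoC|apply cdiff_ccont, HdF]. }
  destruct (CInt_left_limit G B al x HB Hal CG HBd) as [I HI].
  assert (Sub : forall a, is_RInt (V := C_R_NormedModule) (fun t => f (RtoC t)) (psi a) tau (CInt G a x)).
  { intros a. rewrite <- Htau.
    assert (J1 := is_RInt_comp (V := C_R_CompleteNormedModule) (fun t => f (RtoC t)) psi dpsi a x
      (fun s _ => Hf s) (fun s _ => conj (Hpsi s) (Hdpsi s))).
    assert (X : ex_RInt (V := C_R_CompleteNormedModule) (fun t => f (RtoC t)) (psi a) (psi x)).
    { apply ex_RInt_continuous. intros t Ht. 
      assert (0 < t).
      { eapply Rlt_le_trans; [|apply Ht]. apply Rmin_glb_lt; apply Hpos. }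
      destruct (Hsurj t) as [s <-]; [assumption|]. apply Hf. }
    assert (J2 : CInt G a x = RInt (V := C_R_CompleteNormedModule) (fun t => f (RtoC t)) (psi a) (psi x)).
    { apply CInt_unique. eapply is_RInt_ext; [|exact J1].
      intros s _. unfold G. rewrite HF, scal_R_Cmult. apply Cmult_comm. }
    rewrite J2. apply (RInt_correct (V := C_R_CompleteNormedModule)). exact X. }
  assert (Gen : is_RInt_gen (V := C_R_NormedModule) (fun t => f (RtoC t)) (at_right 0) (at_point tau) I).
  { intros P HP. destruct (HI P HP) as [A HA].
    (* As [psi] is increasing, a lower limit below [psi A] is the image of a point below [A]. *)
    apply (Filter_prod _ _ _ (fun e => 0 < e < psi A) (fun t => t = tau)).
    - exists (mkposreal _ (Hpos A)). intros e He He0. split; [exact He0|].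
      unfold ball in He; simpl in He; unfold AbsRing_ball, abs, minus, plus, opp in He; simpl in He.
      rewrite Rabs_pos_eq in He; lra.
    - reflexivity.
    - intros e t [He1 He2] ->. destruct (Hsurj e He1) as [a <-]. exists (CInt G a x). split; [apply Sub|].
      apply HA. apply Rnot_le_lt. intros HaA. destruct HaA as [HaA|HaA].
      + apply Hinc in HaA. lra.
      + subst. lra. }
  assert (EI : @RInt_gen C_R_CompleteNormedModule (fun t : R => f (RtoC t)) (at_right 0) (at_point tau) = I).
  { apply (is_RInt_gen_unique (V := C_R_CompleteNormedModule)). exact Gen. }
  rewrite EI. intros eps He.
  assert (He2 : 0 < eps / 2) by lra.
  destruct (HI (ball (M := C_UniformSpace) I (eps / 2)) (locally_ball (T := C_UniformSpace) I (mkposreal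
    _ He2))) as [A HA].
  exists A. intros a Ha. destruct (HA a Ha) as [H1 H2].
  rewrite <- Cmod_opp, Copp_minus_distr.
  eapply Rle_trans; [apply Cmod_le_abs|]. rewrite re_minus, im_minus.
  change (Rabs (Re (CInt G a x) - Re I) < eps / 2) in H1.
  change (Rabs (Im (CInt G a x) - Im I) < eps / 2) in H2. fold G. lra.
Qed.

Lemma Rceil_ge x : x <= IZR (Rceil x).
Proof. unfold Rceil. rewrite opp_IZR. generalize (base_Int_part (- x)). lra. Qed.

Lemma exp_le_mono x y : x <= y -> exp x <= exp y.
Proof. intros [H|H]; [left; now apply exp_increasing|right; now rewrite H]. Qed.

(** Here [A] is the extra factor of the strip bound and [T] that of the real bound. The hypotheses
    on [M] and [N] say that both truncation exponents reach at least [mu * n * h]. *)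
Lemma final_constants (d K al be A T : R) (n : nat) (M N : Z) : 0 < d -> 0 < K -> 0 < al -> 0 < be ->
  d < PI / 2 -> (0 < n)%nat -> 0 <= A -> 0 <= T ->
  let mu := Rmin al be in
  let h := sqrt (PI * d / (mu * INR n)) in
  mu * INR n <= al * IZR M -> mu * INR n <= be * IZR N ->
  disc_error (K * A / Rpower (cos d) ((al + be) / 2)) al be h d
  + 11 / 10 * (K * T) * (exp (- al * (IZR M * h)) / al + exp (- be * (IZR N * h)) / be)
  <= 2 * K / mu * (A / ((1 - exp (- (2 * sqrt (PI * d * mu)))) * Rpower (cos d) ((al + be) / 2))
       * sqrt (PI / (d * mu)) + 11 / 10 * T) * exp (- sqrt (PI * d * mu * INR n)).
Proof.
  intros Hd HK Ha Hb Hd2 Hn HA HT mu h HM HN. generalize PI_RGT_0; intros HP.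
  assert (Hmu : 0 < mu) by (apply Rmin_glb_lt; assumption).
  assert (L1 : mu <= al) by apply Rmin_l. assert (L2 : mu <= be) by apply Rmin_r.
  assert (Hn1 : 1 <= INR n) by (change 1 with (INR 1); apply le_INR; lia).
  assert (HPd : 0 < PI * d) by now apply Rmult_lt_0_compat.
  assert (Hmn : 0 < mu * INR n) by (apply Rmult_lt_0_compat; lra).
  assert (Hh : 0 < h) by (apply sqrt_lt_R0; now apply Rdiv_lt_0_compat).
  assert (Hh2 : h * h = PI * d / (mu * INR n)) by (apply sqrt_sqrt; left; now apply Rdiv_lt_0_compat).
  set (y := sqrt (PI * d * mu * INR n)).
  (* With [Ey2], the balance that determines [h]: one number [y] is the exponent of the
     discretization error and the target for both tails. *)
  assert (Ey : y = PI * d / h).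
  { apply sqrt_lem_1; [nra|left; now apply Rdiv_lt_0_compat|].
    replace (PI * d / h * (PI * d / h)) with (PI * d * (PI * d) / (h * h)) by (field; lra).
    rewrite Hh2. field. lra. }
  assert (Ey2 : y = mu * INR n * h).
  { rewrite Ey. apply Rmult_eq_reg_r with h; [|lra].
    replace (PI * d / h * h) with (PI * d) by (field; lra).
    rewrite Rmult_assoc, Hh2. field. lra. }
  set (y1 := sqrt (PI * d * mu)).
  assert (HPdm : 0 < PI * d * mu) by now apply Rmult_lt_0_compat.
  assert (Hy1 : 0 < y1) by now apply sqrt_lt_R0.
  assert (Hy1y : y1 <= y).
  { apply sqrt_le_1_alt. rewrite <- (Rmult_1_r (PI * d * mu)) at 1. apply Rmult_le_compat_l; lra. }
  set (Rp := Rpower (cos d) ((al + be) / 2)). assert (HRp : 0 < Rp) by apply exp_pos.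
  set (B := K * A / Rp). assert (HB : 0 <= B).
  { apply Rmult_le_pos; [nra|left; now apply Rinv_0_lt_compat]. }
  assert (I1 : 1 / al <= 1 / mu) by (unfold Rdiv; rewrite !Rmult_1_l; apply Rinv_le_contravar; lra).
  assert (I2 : 1 / be <= 1 / mu) by (unfold Rdiv; rewrite !Rmult_1_l; apply Rinv_le_contravar; lra).
  assert (I3 : 0 < 1 / al) by (apply Rdiv_lt_0_compat; lra).
  assert (I4 : 0 < 1 / be) by (apply Rdiv_lt_0_compat; lra).
  assert (E0 : 0 < exp (- y)) by apply exp_pos.
  assert (Hden : 0 < 1 - exp (- (2 * y1))).
  { assert (exp (- (2 * y1)) < exp 0) by (apply exp_increasing; lra). rewrite exp_0 in H. lra. }
  assert (Hden2 : 1 - exp (- (2 * y1)) <= 1 - exp (- (2 * y))).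
  { assert (exp (- (2 * y)) <= exp (- (2 * y1))) by (apply exp_le_mono; lra). lra. }
  assert (Hhd : h / d <= sqrt (PI / (d * mu))).
  { rewrite <- (sqrt_square (h / d)) by (left; now apply Rdiv_lt_0_compat).
    apply sqrt_le_1_alt.
    replace (h / d * (h / d)) with (PI / (d * mu) * / INR n).
    - rewrite <- (Rmult_1_r (PI / (d * mu))) at 2. apply Rmult_le_compat_l.
      + left. apply Rdiv_lt_0_compat; [exact HP|now apply Rmult_lt_0_compat].
      + rewrite <- Rinv_1. apply Rinv_le_contravar; lra.
    - replace (h / d * (h / d)) with (h * h / (d * d)) by (field; lra). rewrite Hh2. field. lra. }
  assert (Disc := disc_error_le B al be h d HB Ha Hb Hh Hd). rewrite <- Ey in Disc.
  assert (D2 : B * (1 / al + 1 / be) * (h / d) * (exp (- y) / (1 - exp (- (2 * y))))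
    <= B * (2 / mu) * sqrt (PI / (d * mu)) * (exp (- y) / (1 - exp (- (2 * y1))))).
  { assert (0 < h / d) by now apply Rdiv_lt_0_compat.
    apply Rmult_le_compat.
    - apply Rmult_le_pos; [apply Rmult_le_pos|]; lra.
    - left. apply Rdiv_lt_0_compat; lra.
    - apply Rmult_le_compat; [apply Rmult_le_pos; lra|lra| |exact Hhd].
      apply Rmult_le_compat_l; [exact HB|]. replace (2 / mu) with (1 / mu + 1 / mu) by (field; lra). lra.
    - apply Rmult_le_compat_l; [lra|]. apply Rinv_le_contravar; lra. }
  assert (Tl : exp (- al * (IZR M * h)) / al + exp (- be * (IZR N * h)) / be <= 2 / mu * exp (- y)).
  { assert (X1 : exp (- al * (IZR M * h)) <= exp (- y)).
    { apply exp_le_mono. rewrite Ey2.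
      assert (mu * INR n * h <= al * IZR M * h) by (apply Rmult_le_compat_r; lra). lra. }
    assert (X2 : exp (- be * (IZR N * h)) <= exp (- y)).
    { apply exp_le_mono. rewrite Ey2.
      assert (mu * INR n * h <= be * IZR N * h) by (apply Rmult_le_compat_r; lra). lra. }
    replace (2 / mu * exp (- y)) with (exp (- y) * (1 / mu) + exp (- y) * (1 / mu)) by (field; lra).
    replace (exp (- al * (IZR M * h)) / al) with (exp (- al * (IZR M * h)) * (1 / al)) by (field; lra).
    replace (exp (- be * (IZR N * h)) / be) with (exp (- be * (IZR N * h)) * (1 / be)) by (field; lra).
    apply Rplus_le_compat; apply Rmult_le_compat; try lra; left; apply exp_pos. }
  assert (Tl2 : 11 / 10 * (K * T) * (exp (- al * (IZR M * h)) / al + exp (- be * (IZR N * h)) / be)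
    <= 11 / 10 * (K * T) * (2 / mu * exp (- y))).
  { apply Rmult_le_compat_l; [|exact Tl]. apply Rmult_le_pos; [lra|apply Rmult_le_pos; lra]. }
  eapply Rle_trans; [apply Rplus_le_compat; [eapply Rle_trans; [exact Disc|exact D2]|exact Tl2]|].
  right. unfold B. field. lra.
Qed.

Lemma sinc_indefinite_bound (i : nat) (d K al be : R) (f F : C -> C) (A T : R) (n : nat) (dpsi : R -> R)
  (tau : R) :
  0 < d -> d < PI / 2 -> 0 < K -> 0 < al -> 0 < be -> 0 <= A -> 0 <= T -> (0 < n)%nat ->
  (forall z, Rabs (Im z) < d -> cdiff F z) ->
  decays F d (K * A / Rpower (cos d) ((al + be) / 2)) al be -> real_decays F (K * T) al be ->
  (forall s, is_derive (psiR i) s (dpsi s)) -> (forall s, continuous dpsi s) ->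
  (forall s t, s < t -> psiR i s < psiR i t) -> (forall s, 0 < psiR i s) ->
  (forall e, 0 < e -> psiR i (psiR_inv i e) = e) ->
  (forall s, cdiff f (RtoC (psiR i s))) ->
  (forall s : R, F s = (f (RtoC (psiR i s)) * RtoC (dpsi s))%C) -> 0 < tau ->
  let mu := Rmin al be in
  let h := sqrt (PI * d / (mu * INR n)) in
  let M : Z := if Rle_dec al be then Z.of_nat n else Rceil (be * INR n / al) in
  let N : Z := if Rle_dec al be then Rceil (al * INR n / be) else Z.of_nat n in
  Cmod (Cminus
    (@RInt_gen C_R_CompleteNormedModule (fun t : R => f (RtoC t)) (at_right 0) (at_point tau))
    (sumZ (- M) N (fun k : Z => Cmult (f (RtoC (psiR i (IZR k * h))))
       (RtoC (Derive (psiR i) (IZR k * h) * Jfun k h (psiR_inv i tau))))))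
  <= 2 * K / mu * (A / ((1 - exp (- (2 * sqrt (PI * d * mu)))) * Rpower (cos d) ((al + be) / 2))
       * sqrt (PI / (d * mu)) + 11 / 10 * T) * exp (- sqrt (PI * d * mu * INR n)).
Proof.
  intros Hd Hd2 HK Ha Hb HA HT Hn HcF HD HR Hpsi Hdpsi Hinc Hpos Hinv Hf HF Htau mu h M N.
  generalize PI_RGT_0; intros HP.
  assert (Hmu : 0 < mu) by (apply Rmin_glb_lt; assumption).
  assert (Hn1 : 1 <= INR n) by (change 1 with (INR 1); apply le_INR; lia).
  assert (Hh : 0 < h).
  { apply sqrt_lt_R0, Rdiv_lt_0_compat; apply Rmult_lt_0_compat; lra. }
  (* Equality on the side with the slower rate, which takes [n] terms; rounding up gives the
     inequality on the other. *)
  assert (MN : mu * INR n <= al * IZR M /\ mu * INR n <= be * IZR N).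
  { unfold M, N, mu. destruct (Rle_dec al be) as [H|H].
    - rewrite Rmin_left, <- INR_IZR_INZ by exact H. split; [lra|].
      apply Rle_trans with (be * (al * INR n / be)); [right; field; lra|].
      apply Rmult_le_compat_l; [lra|apply Rceil_ge].
    - rewrite Rmin_right, <- INR_IZR_INZ by lra. split; [|lra].
      apply Rle_trans with (al * (be * INR n / al)); [right; field; lra|].
      apply Rmult_le_compat_l; [lra|apply Rceil_ge]. }
  destruct MN as [HM HN].
  assert (Hmn : 0 < mu * INR n) by (apply Rmult_lt_0_compat; lra).
  assert (HM0 : (0 <= M)%Z) by (apply Z.lt_le_incl, lt_IZR; nra).
  assert (HN0 : (0 <= N)%Z) by (apply Z.lt_le_incl, lt_IZR; nra).
  eapply Rle_trans; [|apply (final_constants d K al be A T n M N); assumption].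
  fold mu. fold h. rewrite sumZ_csum.
  rewrite (csum_ext _ (fun k => (F (RtoC (IZR k * h)) * RtoC (Jfun k h (psiR_inv i tau)))%C)).
  2: { intros k _. rewrite HF, (is_derive_unique _ _ _ (Hpsi _)), RtoC_mult. ring. }
  assert (HB : 0 <= K * A / Rpower (cos d) ((al + be) / 2)).
  { apply Rmult_le_pos; [apply Rmult_le_pos; lra|left; apply Rinv_0_lt_compat, exp_pos]. }
  apply sinc_quadrature; try assumption; try (apply Rmult_le_pos; lra).
  assert (Lim := RInt_gen_substitution f F (psiR i) dpsi tau (psiR_inv i tau) (K * T) al Hpsi Hdpsi Hinc Hpos
    (fun e He => ex_intro _ (psiR_inv i e) (Hinv e He)) (Hinv tau Htau)
    (fun s => ccont_comp RtoC f (psiR i s) (ccont_RtoC _) (cdiff_ccont _ _ (Hf s))) HF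
    (Rmult_le_pos _ _ (Rlt_le _ _ HK) HT) Ha).
  specialize (Lim ltac:(intros s; apply HcF; simpl; rewrite Rabs_R0; exact Hd) (fun s => proj1 (HR s))).
  intros eps He. destruct (Lim eps He) as [A0 HA0].
  destruct (INR_unbounded (Rabs A0 / h)) as [m0 Hm0].
  exists m0. intros m Hm. apply HA0.
  assert (INR m0 <= INR m) by now apply le_INR.
  assert (Rabs A0 < INR m * h).
  { replace (Rabs A0) with (Rabs A0 / h * h) by (field; lra). apply Rmult_lt_compat_r; lra. }
  generalize (Rle_abs (- A0)). rewrite Rabs_Ropp. lra.
Qed.

Theorem theorem11 (i : nat) (d K alpha beta : R) (f : C -> C) (n : nat) :
  (i = 2%nat \/ i = 3%nat) ->
  0 < d -> d < PI / 2 ->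
  analytic_on (psi_domain i d) f ->
  0 < K -> 0 < alpha -> 0 < beta ->
  (forall z, psi_domain i d z -> Cmod (f z) <= K * Cmod (E_fun i alpha beta z)) ->
  (0 < n)%nat ->
  let mu := Rmin alpha beta in
  let h := sqrt (PI * d / (mu * INR n)) in
  let M : Z := if Rle_dec alpha beta then Z.of_nat n
               else Rceil (beta * INR n / alpha) in
  let N : Z := if Rle_dec alpha beta then Rceil (alpha * INR n / beta)
               else Z.of_nat n in
  forall tau : R, 0 < tau ->
    Cmod (Cminus
            (@RInt_gen C_R_CompleteNormedModule (fun t : R => f (RtoC t)) (at_right 0) (at_point tau))
            (sumZ (- M) N (fun k : Z =>
               Cmult (f (RtoC (psiR i (IZR k * h))))
                     (RtoC (Derive (psiR i) (IZR k * h)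
                            * Jfun k h (psiR_inv i tau))))))
    <= const_C i K alpha beta d * exp (- sqrt (PI * d * mu * INR n)).
Proof.
  intros Hi Hd Hd2 Hf HK Ha Hb HE Hn mu h M N tau Htau.
  assert (Hstrip : forall s : R, strip d s) by (intros s; unfold strip; simpl; rewrite Rabs_R0; exact Hd).
  destruct Hi as [-> | ->].
  - assert (X := sinc_indefinite_bound 2 d K alpha beta f (exp_integrand f) 1 1 n exp tau Hd Hd2 HK Ha Hb
    Rle_0_1 Rle_0_1 Hn).
    rewrite !Rmult_1_r in X. apply X; clear X; try assumption.
    + now apply exp_integrand_cdiff.
    + now apply exp_integrand_decays.
    + now apply (exp_integrand_real_decays f d).
    + intros s. apply is_derive_Reals, derivable_pt_lim_exp.
    + intros s. apply continuous_exp.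
    + intros s t. apply exp_increasing.
    + intros s. apply exp_pos.
    + intros e He. now apply exp_ln.
    + intros s. apply ex_derive_cdiff, Hf. exists (RtoC s). split; [apply Hstrip|].
      symmetry. apply Cexp_RtoC.
    + intros s. unfold exp_integrand. simpl psiC. now rewrite Cexp_RtoC.
  - assert (HA : 0 <= asinh_strip_factor alpha beta d).
    { unfold asinh_strip_factor, c_alpha_d. apply Rmult_le_pos; [left; apply exp_pos|]. destruct Rlt_dec;
      left; apply exp_pos. }
    assert (HT : 0 <= asinh_real_factor alpha) by (left; apply exp_pos).
    apply (sinc_indefinite_bound 3 d K alpha beta f (asinh_integrand f) (asinh_strip_factor alpha beta d)
      (asinh_real_factor alpha) n
      (fun t => exp t / sqrt (exp t ^ 2 + 1)) tau Hd Hd2 HK Ha Hb HA HT Hn); try assumption.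
    + now apply asinh_integrand_cdiff.
    + now apply asinh_integrand_decays.
    + now apply (asinh_integrand_real_decays f d).
    + apply is_derive_psiR3.
    + intros s. apply (ex_derive_continuous (V := R_NormedModule)). auto_derive.
      assert (0 < exp s * (exp s * 1) + 1) by (generalize (exp_pos s); nra).
      split; [lra|]. split; [|trivial]. apply Rgt_not_eq. now apply sqrt_lt_R0.
    + intros s t H. apply arcsinh_lt. now apply exp_increasing.
    + intros s. simpl. rewrite <- arcsinh_0. apply arcsinh_lt, exp_pos.
    + intros e He. simpl. rewrite exp_ln by now apply sinh_pos. apply arcsinh_sinh.
    + intros s. apply ex_derive_cdiff, Hf. exists (RtoC s). split; [apply Hstrip|].
      symmetry. apply psiC3_real.
    + apply asinh_integrand_real.
Qed.
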